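(* Let $\mathscr{C}$ be a fiat category. (a) For any object $\mathtt{i}$ of $\mathscr{C}$ the $2$-representation $\mathbf{P}_{\mathtt{i}}$ is cyclic and generated by $P_{\mathbf{1}_{\mathtt{i}}}$. (b) For any right cell $\mathcal{R}$ of $\mathcal{C}$ the cell $2$-representation $\mathbf{C}_{\mathcal{R}}$ is cyclic and generated by $L_{\mathrm{G}_{\mathcal{R}}}$.
   Context: Fix an algebraically closed field $\Bbbk$. All $2$-categories are strict; functors between $\Bbbk$-linear categories (and $2$-functors) are additive and $\Bbbk$-linear. A $2$-category $\mathscr{C}$ is $\Bbbk$-finitary if (I) it has finitely many objects; (II) each $\mathscr{C}(\mathtt{i},\mathtt{j})$ is a fully additive (i.e. karoubian) $\Bbbk$-linear category with finite-dimensional morphism spaces and finitely many isomorphism classes of indecomposable objects, and horizontal composition of $1$-morphisms is biadditive; (III) every identity $1$-morphism $\mathbf{1}_{\mathtt{i}}$ is indecomposable. An involution $*$ on $\mathscr{C}$ is a lax involutive object-preserving anti-automorphism (sending $\mathrm{F}\in\mathscr{C}(\mathtt{i},\mathtt{j})$ to $\mathrm{F}^*\in\mathscr{C}(\mathtt{j},\mathtt{i})$). $\mathscr{C}$ is fiat if it is $\Bbbk$-finitary with an involution $*$ and adjunctions: for every $\mathrm{F}\in\mathscr{C}(\mathtt{i},\mathtt{j})$ there are $2$-morphisms $\alpha:\mathrm{F}\circ\mathrm{F}^*\to\mathbf{1}_{\mathtt{j}}$ and $\beta:\mathbf{1}_{\mathtt{i}}\to\mathrm{F}^*\circ\mathrm{F}$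 with $\alpha_{\mathrm{F}}\circ_1\mathrm{F}(\beta)=\mathrm{id}_{\mathrm{F}}$ and $\mathrm{F}^*(\alpha)\circ_1\beta_{\mathrm{F}^*}=\mathrm{id}_{\mathrm{F}^*}$, where $\circ_0,\circ_1$ are horizontal and vertical composition, $\mathrm{F}(\beta)=\mathrm{id}_{\mathrm{F}}\circ_0\beta$, $\alpha_{\mathrm{F}}=\alpha\circ_0\mathrm{id}_{\mathrm{F}}$. $\mathfrak{R}_{\Bbbk}$ is the $2$-category whose objects are categories equivalent to module categories of finite-dimensional $\Bbbk$-algebras, $1$-morphisms are functors, $2$-morphisms are natural transformations. A $2$-representation of $\mathscr{C}$ is a strict $2$-functor $\mathbf{M}:\mathscr{C}\to\mathfrak{R}_{\Bbbk}$; write $\mathrm{F}\,X$ for $\mathbf{M}(\mathrm{F})(X)$. $\overline{\mathscr{C}}(\mathtt{i},\mathtt{j})$ has as objects the diagrams $\mathrm{F}\overset{\alpha}{\to}\mathrm{G}$ with $\alpha$ a $2$-morphism in $\mathscr{C}(\mathtt{i},\mathtt{j})$; morphisms from $\mathrm{F}\overset{\alpha}{\to}\mathrm{G}$ to $\mathrm{F}'\overset{\alpha'}{\to}\mathrm{G}'$ are pairs $(\beta:\mathrm{F}\to\mathrm{F}',\beta':\mathrm{G}\to\mathrm{G}')$ with $\beta'\alpha=\alpha'\beta$, modulo those for which there is $\xi:\mathrm{G}\to\mathrm{F}'$ with $\alpha'\xi=\beta'$. This is an abelian category equivalent to the module category of a finite-dimensional algebra. $\mathbf{P}_{\mathtt{i}}$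 is the $2$-representation with $\mathbf{P}_{\mathtt{i}}(\mathtt{j})=\overline{\mathscr{C}}(\mathtt{i},\mathtt{j})$, where $1$- and $2$-morphisms act by left horizontal composition. For $\mathrm{F}\in\mathscr{C}(\mathtt{i},\mathtt{j})$, $P_{\mathrm{F}}$ is the projective object $0\to\mathrm{F}$; for $\mathrm{F}$ indecomposable, $L_{\mathrm{F}}$ is its unique simple quotient. $\mathcal{C}_{\mathtt{i},\mathtt{j}}$ is a complete set of pairwise non-isomorphic indecomposable objects of $\mathscr{C}(\mathtt{i},\mathtt{j})$ and $\mathcal{C}=\bigcup_{\mathtt{i},\mathtt{j}}\mathcal{C}_{\mathtt{i},\mathtt{j}}$. For $\mathrm{F},\mathrm{G}\in\mathcal{C}$ write $\mathrm{F}\leq_R\mathrm{G}$ if $\mathrm{G}$ is a direct summand of $\mathrm{H}\circ\mathrm{F}$ for some $1$-morphism $\mathrm{H}$. The equivalence classes of this preorder are the right cells. Let $\mathcal{R}$ be a right cell; all its elements lie in $\bigcup_{\mathtt{j}}\mathcal{C}_{\mathtt{i},\mathtt{j}}$ for a single object $\mathtt{i}$. There is a unique submodule $K_{\mathcal{R}}$ of $P_{\mathbf{1}_{\mathtt{i}}}$ such that every simple subquotient of $P_{\mathbf{1}_{\mathtt{i}}}/K_{\mathcal{R}}$ is annihilated by every $\mathrm{F}\in\mathcal{R}$ and $K_{\mathcal{R}}$ has simple top $L_{\mathrm{G}_{\mathcal{R}}}$ for some $\mathrm{G}_{\mathcal{R}}\in\mathcal{C}$ with $\mathrm{F}\,L_{\mathrm{G}_{\mathcal{R}}}\neq0$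 for all $\mathrm{F}\in\mathcal{R}$; moreover $\mathrm{G}_{\mathcal{R}}\in\mathcal{R}\cap\mathcal{C}_{\mathtt{i},\mathtt{i}}$. The cell $2$-representation $\mathbf{C}_{\mathcal{R}}$: $\mathbf{C}_{\mathcal{R}}(\mathtt{j})$ is the full subcategory of $\mathbf{P}_{\mathtt{i}}(\mathtt{j})$ of all $M$ with a presentation $X_1\to X_0\twoheadrightarrow M$, $X_1,X_0\in\mathrm{add}\big(\bigoplus_{\mathrm{F}\in\mathcal{R}\cap\mathcal{C}_{\mathtt{i},\mathtt{j}}}\mathrm{F}\,L_{\mathrm{G}_{\mathcal{R}}}\big)$, with the action of $\mathscr{C}$ restricted from $\mathbf{P}_{\mathtt{i}}$. The objects $\mathrm{F}\,L_{\mathrm{G}_{\mathcal{R}}}$, $\mathrm{F}\in\mathcal{R}\cap\mathcal{C}_{\mathtt{i},\mathtt{j}}$, are the indecomposable projectives of $\mathbf{C}_{\mathcal{R}}(\mathtt{j})$; $L_{\mathrm{G}_{\mathcal{R}}}$, as an object of $\mathbf{C}_{\mathcal{R}}(\mathtt{i})$, is the simple top there of $\mathrm{G}_{\mathcal{R}}\,L_{\mathrm{G}_{\mathcal{R}}}$. For a $2$-morphism $\alpha:\mathrm{F}\to\mathrm{G}$ in $\mathscr{C}(\mathtt{i},\mathtt{j})$, left horizontal composition gives a natural transformation of functors $\bigoplus_{\mathtt{k}}\overline{\mathscr{C}}(\mathtt{k},\mathtt{i})\to\bigoplus_{\mathtt{k}}\overline{\mathscr{C}}(\mathtt{k},\mathtt{j})$;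 $\mathrm{Coker}(\alpha)$ is its cokernel functor. $\hat{\mathscr{C}}$ is the $2$-category with the objects of $\mathscr{C}$, with $1$-morphisms from $\mathtt{i}$ to $\mathtt{j}$ the functors $\mathrm{Coker}(\alpha)$, and with $2$-morphisms $\mathrm{Coker}(\alpha)\to\mathrm{Coker}(\alpha')$ (where $\alpha':\mathrm{F}'\to\mathrm{G}'$) the natural transformations induced by pairs of $2$-morphisms $\xi':\mathrm{F}\to\mathrm{F}'$, $\xi:\mathrm{G}\to\mathrm{G}'$ with $\xi\alpha=\alpha'\xi'$. Every $2$-representation $\mathbf{M}$ of $\mathscr{C}$ is viewed as a $2$-representation of $\hat{\mathscr{C}}$ via $\mathbf{M}(\mathrm{Coker}(\alpha))=\mathrm{Coker}(\mathbf{M}(\alpha))$ and the induced maps on $2$-morphisms (for $\mathbf{C}_{\mathcal{R}}$ cokernels are taken in the abelian categories $\mathbf{C}_{\mathcal{R}}(\mathtt{j})$). An object $M\in\mathbf{M}(\mathtt{i})$ generates $\mathbf{M}$ if for any $\mathtt{j}$ and $X,Y\in\mathbf{M}(\mathtt{j})$ there are $\mathrm{F},\mathrm{G}\in\hat{\mathscr{C}}(\mathtt{i},\mathtt{j})$ with $\mathrm{F}\,M\cong X$, $\mathrm{G}\,M\cong Y$ and with surjective evaluation map $\mathrm{Hom}_{\hat{\mathscr{C}}(\mathtt{i},\mathtt{j})}(\mathrm{F},\mathrm{G})\to\mathrm{Hom}_{\mathbf{M}(\mathtt{j})}(\mathrm{F}\,M,\mathrm{G}\,M)$. $\mathbf{M}$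 is cyclic if it is generated by some object of some $\mathbf{M}(\mathtt{i})$. *)

(* Defs.v *)
From HB Require Import structures.
From mathcomp Require Import all_boot all_algebra.
From mathcomp Require Import boolp.

Set Implicit Arguments.
Unset Strict Implicit.
Unset Printing Implicit Defensive.

Import GRing.Theory.
Local Open Scope ring_scope.
Local Open Scope quotient_scope.

Section LmodQuotient.
Variables (k : fieldType) (V : lmodType k) (S0 : {pred V}).
Hypothesis S0closed : GRing.submod_closed S0.

Definition qpred of GRing.submod_closed S0 : {pred V} := S0.
Local Notation S := (qpred S0closed).
HB.instance Definition _ := GRing.isSubmodClosed.Build k V S
  (GRing.submod_closed_semi S0closed).

Definition lquot : Type := Quotient.quot S.
HB.instance Definition _ := GRing.Zmodule.on lquot.

Definition lproj (x : V) : lquot := \pi_(Quotient.quot S) x.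

Lemma lproj_eq x y : lproj x = lproj y <-> x - y \in S0.
Proof.
rewrite -[_ \in S0]/(_ \in S) Quotient.idealrBE.
by split=> [/eqP|/eqP].
Qed.

Definition lrepr (q : lquot) : V := repr (q : Quotient.quot S).

Lemma lreprK q : lproj (lrepr q) = q.
Proof. by rewrite /lproj /lrepr reprK. Qed.

Lemma lproj_surj (q : lquot) : exists x, q = lproj x.
Proof. by exists (lrepr q); rewrite lreprK. Qed.

Lemma lprojD x y : lproj (x + y) = lproj x + lproj y.
Proof. exact: (raddfD (\pi_(Quotient.quot S))). Qed.

Definition lqscale (a : k) (q : lquot) : lquot :=
  lproj (a *: lrepr q).

Lemma lqscaleE a x : lqscale a (lproj x) = lproj (a *: x).
Proof.
apply/lproj_eq; rewrite -scalerBr -[_ \in S0]/(_ \in S) rpredZ //.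
by apply/lproj_eq; rewrite lreprK.
Qed.
Fact lqscaleA a b q : lqscale a (lqscale b q) = lqscale (a * b) q.
Proof. by have [x ->] := lproj_surj q; rewrite !lqscaleE scalerA. Qed.
Fact lqscale1 : left_id 1 lqscale.
Proof. by move=> q; have [x ->] := lproj_surj q; rewrite lqscaleE scale1r. Qed.
Fact lqscaleDr : right_distributive lqscale +%R.
Proof.
move=> a q r; have [x ->] := lproj_surj q; have [y ->] := lproj_surj r.
by rewrite -lprojD !lqscaleE -lprojD scalerDr.
Qed.
Fact lqscaleDl q : {morph lqscale^~ q : a b / a + b}.
Proof.
by move=> a b; have [x ->] := lproj_surj q; rewrite !lqscaleE -lprojD scalerDl.
Qed.
HB.instance Definition _ := GRing.Zmodule_isLmodule.Build k lquot
  lqscaleA lqscale1 lqscaleDr lqscaleDl.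

Fact lproj_linear : linear lproj.
Proof. by move=> a x y; rewrite lprojD -lqscaleE. Qed.
HB.instance Definition _ := GRing.isLinear.Build k V lquot *:%R lproj lproj_linear.

End LmodQuotient.

Section Categories.
Variable k : closedFieldType.

Record klincat := KLinCat {
  ob :> Type;
  mor : ob -> ob -> lmodType k;
  idm : forall A, mor A A;
  cmp : forall A B D, mor B D -> mor A B -> mor A D;
  cmpA : forall A B D E (h : mor D E) (g : mor B D) (f : mor A B),
    cmp h (cmp g f) = cmp (cmp h g) f;
  cmp1m : forall A B (f : mor A B), cmp (idm B) f = f;
  cmpm1 : forall A B (f : mor A B), cmp f (idm A) = f;
  cmp_linl : forall A B D (f : mor A B), linear (fun g : mor B D => cmp g f);
  cmp_linr : forall A B D (g : mor B D), linear (fun f : mor A B => cmp g f)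
}.

End Categories.

Arguments mor {k C} A B : rename.
Arguments idm {k C} A : rename.
Arguments cmp {k C A B D} g f : rename.
Notation "g '∘' f" := (cmp g f) (at level 40, left associativity).

Section CategoryTheory.
Variable k : closedFieldType.
Implicit Types C : klincat k.

Lemma cmpDl C (A B D : C) (g h : mor B D) (f : mor A B) :
  (g + h) ∘ f = g ∘ f + h ∘ f.
Proof. by have := cmp_linl f 1 g h; rewrite !scale1r. Qed.
Lemma cmpDr C (A B D : C) (g : mor B D) (f h : mor A B) :
  g ∘ (f + h) = g ∘ f + g ∘ h.
Proof. by have := cmp_linr g 1 f h; rewrite !scale1r. Qed.
Lemma cmp0m C (A B D : C) (f : mor A B) : (0 : mor B D) ∘ f = 0.
Proof. by apply: (addIr (0 ∘ f)); rewrite -cmpDl !add0r. Qed.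
Lemma cmpm0 C (A B D : C) (g : mor B D) : g ∘ (0 : mor A B) = 0.
Proof. by apply: (addIr (g ∘ 0)); rewrite -cmpDr !add0r. Qed.
Lemma cmpZl C (A B D : C) c (g : mor B D) (f : mor A B) :
  (c *: g) ∘ f = c *: (g ∘ f).
Proof. by have := cmp_linl f c g 0; rewrite cmp0m !addr0. Qed.
Lemma cmpZr C (A B D : C) c (g : mor B D) (f : mor A B) :
  g ∘ (c *: f) = c *: (g ∘ f).
Proof. by have := cmp_linr g c f 0; rewrite cmpm0 !addr0. Qed.
Lemma cmpNl C (A B D : C) (g : mor B D) (f : mor A B) : (- g) ∘ f = - (g ∘ f).
Proof. by rewrite -scaleN1r cmpZl scaleN1r. Qed.
Lemma cmpNr C (A B D : C) (g : mor B D) (f : mor A B) : g ∘ (- f) = - (g ∘ f).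
Proof. by rewrite -scaleN1r cmpZr scaleN1r. Qed.
Lemma cmpBl C (A B D : C) (g h : mor B D) (f : mor A B) :
  (g - h) ∘ f = g ∘ f - h ∘ f.
Proof. by rewrite cmpDl cmpNl. Qed.
Lemma cmpBr C (A B D : C) (g : mor B D) (f h : mor A B) :
  g ∘ (f - h) = g ∘ f - g ∘ h.
Proof. by rewrite cmpDr cmpNr. Qed.

(* The morphisms of C with their endpoints: an equality of arrows is an equality
   of morphisms whose endpoints are only propositionally equal. *)
Record arrow C := Arrow { asrc : C; atgt : C; amor : mor asrc atgt }.

Definition eqm C (A B : C) (e : A = B) : mor A B :=
  match e with erefl => idm A end.

Definition iso C (A B : C) : Prop :=
  exists (f : mor A B) (g : mor B A), g ∘ f = idm A /\ f ∘ g = idm B.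

Definition mono C (A B : C) (f : mor A B) : Prop :=
  forall X (g h : mor X A), f ∘ g = f ∘ h -> g = h.

Definition epi C (A B : C) (f : mor A B) : Prop :=
  forall X (g h : mor B X), g ∘ f = h ∘ f -> g = h.

Definition is_zero C (A : C) : Prop := idm A = 0.

Definition is_biprod C (A B S : C) : Prop :=
  exists (i1 : mor A S) (i2 : mor B S) (p1 : mor S A) (p2 : mor S B),
    [/\ p1 ∘ i1 = idm A, p2 ∘ i2 = idm B, p1 ∘ i2 = 0, p2 ∘ i1 = 0
      & i1 ∘ p1 + i2 ∘ p2 = idm S].

Definition is_dsum C n (f : 'I_n -> C) (S : C) : Prop :=
  exists (i : forall t, mor (f t) S) (p : forall t, mor S (f t)),
    [/\ forall t, p t ∘ i t = idm (f t),
        forall s t, s != t -> p s ∘ i t = 0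
      & \sum_(t < n) i t ∘ p t = idm S].

Definition dsummand C (A X : C) : Prop := exists B, is_biprod A B X.

(* For Q the predicate "is one of the X_s", this is add(\bigoplus_s X_s). *)
Definition in_add C (Q : C -> Prop) (X : C) : Prop :=
  exists n (f : 'I_n -> C) S,
    [/\ forall t, Q (f t), is_dsum f S & dsummand X S].

Definition indecomposable C (A : C) : Prop :=
  ~ is_zero A /\ forall B D, is_biprod B D A -> is_zero B \/ is_zero D.

Definition additive C : Prop :=
  (exists Z : C, is_zero Z) /\ forall A B : C, exists S, is_biprod A B S.

Definition karoubian C : Prop :=
  forall (A : C) (e : mor A A), e ∘ e = e ->
    exists (B : C) (r : mor A B) (s : mor B A), r ∘ s = idm B /\ s ∘ r = e.

Record finitary_cat C : Prop := FinitaryCat {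
  fc_additive : additive C;
  fc_karoubian : karoubian C;
  fc_findim : forall A B : C, exists n, inhabited (Vector.axiom n (mor A B));
  fc_indec : exists n (f : 'I_n -> C),
    forall A, indecomposable A -> exists t, iso A (f t)
}.

Definition is_coker C (A B Z : C) (f : mor A B) (p : mor B Z) : Prop :=
  p ∘ f = 0 /\
  forall E (h : mor B E), h ∘ f = 0 -> exists! u : mor Z E, u ∘ p = h.

Definition has_cokers C : Prop :=
  forall (A B : C) (f : mor A B), exists Z (p : mor B Z), is_coker f p.

Definition simple C (S : C) : Prop :=
  ~ is_zero S /\
  forall A (f : mor A S), mono f -> is_zero A \/ exists g, g ∘ f = idm A /\ f ∘ g = idm S.

Definition simple_subquotient C (S M : C) : Prop :=
  simple S /\ exists U (m : mor U M) (e : mor U S), mono m /\ epi e.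

Definition maximal_sub C (M V : C) (m : mor V M) : Prop :=
  mono m /\ forall Z (p : mor M Z), is_coker m p -> simple Z.

(* r : U -> M is the intersection of the maximal subobjects of M. *)
Definition is_radical C (M U : C) (r : mor U M) : Prop :=
  [/\ mono r,
      forall V (m : mor V M), maximal_sub m -> exists u, r = m ∘ u
    & forall W (w : mor W M), mono w ->
        (forall V (m : mor V M), maximal_sub m -> exists u, w = m ∘ u) ->
        exists u, w = r ∘ u].

Definition is_top C (M T : C) : Prop :=
  exists U (r : mor U M) (p : mor M T), is_radical r /\ is_coker r p.

Definition is_simple_top C (M T : C) : Prop := simple T /\ is_top M T.

Lemma coker_epi C (A B Z : C) (f : mor A B) (p : mor B Z) : is_coker f p -> epi p.
Proof.
move=> [pf up] X g h gh.
have [|u [_ uu]] := up X (g ∘ p); first by rewrite -cmpA pf cmpm0.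
by rewrite -(uu g) // -(uu h).
Qed.

Section ChosenCokernels.
Variables (C : klincat k) (HC : has_cokers C).

Definition coker_ob (A B : C) (f : mor A B) : C := sval (cid (HC f)).
Definition coker_map (A B : C) (f : mor A B) : mor B (coker_ob f) :=
  sval (cid (svalP (cid (HC f)))).

Lemma coker_mapP (A B : C) (f : mor A B) : is_coker f (coker_map f).
Proof. exact: (svalP (cid (svalP (cid (HC f))))). Qed.

Fact coker_lift_subproof (A B A' B' : C) (f : mor A B) (f' : mor A' B')
    (a : mor A A') (b : mor B B') :
  b ∘ f = f' ∘ a -> exists u, u ∘ coker_map f = coker_map f' ∘ b.
Proof.
move=> sq; have [_ up] := coker_mapP f; have [p'f' _] := coker_mapP f'.
have [|u [e _]] := up _ (coker_map f' ∘ b); last by exists u.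
by rewrite -cmpA sq cmpA p'f' cmp0m.
Qed.

Definition coker_lift (A B A' B' : C) (f : mor A B) (f' : mor A' B')
    (a : mor A A') (b : mor B B') (sq : b ∘ f = f' ∘ a) :
  mor (coker_ob f) (coker_ob f') := sval (cid (coker_lift_subproof sq)).

Lemma coker_liftE (A B A' B' : C) (f : mor A B) (f' : mor A' B')
    (a : mor A A') (b : mor B B') (sq : b ∘ f = f' ∘ a) :
  coker_lift sq ∘ coker_map f = coker_map f' ∘ b.
Proof. exact: (svalP (cid (coker_lift_subproof sq))). Qed.

Lemma coker_lift_unique (A B A' B' : C) (f : mor A B) (f' : mor A' B')
    (a : mor A A') (b : mor B B') (sq : b ∘ f = f' ∘ a) u :
  u ∘ coker_map f = coker_map f' ∘ b -> u = coker_lift sq.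
Proof.
by move=> e; apply: (coker_epi (coker_mapP f)); rewrite e coker_liftE.
Qed.

End ChosenCokernels.

Record functor (C D : klincat k) := Functor {
  fob :> C -> D;
  fmap : forall A B, mor A B -> mor (fob A) (fob B);
  fmap1 : forall A, fmap (idm A) = idm (fob A);
  fmapM : forall A B E (g : mor B E) (f : mor A B),
    fmap (g ∘ f) = fmap g ∘ fmap f;
  fmap_lin : forall A B, linear (@fmap A B)
}.

Record nat_trans (C D : klincat k) (F G : functor C D) := NatTrans {
  ntr :> forall A, mor (F A) (G A);
  ntrP : forall A B (f : mor A B), ntr B ∘ fmap F f = fmap G f ∘ ntr A
}.

Lemma fmap0 (C D : klincat k) (F : functor C D) (A B : C) :
  fmap F (0 : mor A B) = 0.
Proof.
have := fmap_lin F 1 (0 : mor A B) 0; rewrite !scale1r addr0 => e.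
by apply: (addIr (fmap F 0)); rewrite -e add0r.
Qed.
Lemma fmapD (C D : klincat k) (F : functor C D) (A B : C) (f g : mor A B) :
  fmap F (f + g) = fmap F f + fmap F g.
Proof. by have := fmap_lin F 1 f g; rewrite !scale1r. Qed.
Lemma fmapB (C D : klincat k) (F : functor C D) (A B : C) (f g : mor A B) :
  fmap F (f - g) = fmap F f - fmap F g.
Proof. by apply: (addIr (fmap F g)); rewrite -fmapD !subrK. Qed.

Section CokernelFunctor.
Variables (C D : klincat k) (HD : has_cokers D).

Section One.
Variables (F G : functor C D) (eta : nat_trans F G).

Definition cokf_ob (X : C) : D := coker_ob HD (eta X).
Definition cokf_map X Y (f : mor X Y) : mor (cokf_ob X) (cokf_ob Y) :=
  coker_lift HD (esym (ntrP eta f)).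

Lemma cokf_mapE X Y (f : mor X Y) :
  cokf_map f ∘ coker_map HD (eta X) = coker_map HD (eta Y) ∘ fmap G f.
Proof. exact: coker_liftE. Qed.

Fact cokf1 X : cokf_map (idm X) = idm (cokf_ob X).
Proof.
by apply/esym/coker_lift_unique; rewrite fmap1 cmp1m cmpm1.
Qed.
Fact cokfM X Y Z (g : mor Y Z) (f : mor X Y) :
  cokf_map (g ∘ f) = cokf_map g ∘ cokf_map f.
Proof.
apply/esym/coker_lift_unique.
by rewrite -cmpA cokf_mapE cmpA cokf_mapE -cmpA fmapM.
Qed.
Fact cokf_lin X Y : linear (@cokf_map X Y).
Proof.
move=> a f g; apply/esym/coker_lift_unique.
by rewrite cmpDl cmpZl !cokf_mapE fmap_lin cmpDr cmpZr.
Qed.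

Definition coker_functor : functor C D := Functor cokf1 cokfM cokf_lin.
End One.

Section Two.
Variables (F G F' G' : functor C D).
Variables (eta : nat_trans F G) (eta' : nat_trans F' G').
Variables (x : nat_trans F F') (y : nat_trans G G').
Hypothesis sq : forall X, y X ∘ eta X = eta' X ∘ x X.

Definition coker_nat_map X : mor (coker_functor eta X) (coker_functor eta' X) :=
  coker_lift HD (sq X).

Lemma coker_nat_mapE X :
  coker_nat_map X ∘ coker_map HD (eta X) = coker_map HD (eta' X) ∘ y X.
Proof. exact: coker_liftE. Qed.

Fact coker_natP X Y (f : mor X Y) :
  coker_nat_map Y ∘ fmap (coker_functor eta) f =
  fmap (coker_functor eta') f ∘ coker_nat_map X.
Proof.
apply: (coker_epi (coker_mapP HD (eta X))) => /=.
rewrite -cmpA cokf_mapE cmpA coker_nat_mapE -cmpA ntrP cmpA -cokf_mapE.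
by rewrite -!cmpA coker_nat_mapE.
Qed.

Definition coker_nat : nat_trans (coker_functor eta) (coker_functor eta') :=
  NatTrans coker_natP.
End Two.

End CokernelFunctor.

Section FullSubcategory.
Variables (C : klincat k) (P : C -> Prop).

Definition fullsub : klincat k := {|
  ob := {A : C | P A};
  mor A B := @mor k C (sval A) (sval B);
  idm A := idm (sval A);
  cmp A B D g f := g ∘ f;
  cmpA A B D E h g f := cmpA h g f;
  cmp1m A B f := cmp1m f;
  cmpm1 A B f := cmpm1 f;
  cmp_linl A B D f := @cmp_linl k C _ _ (sval D) f;
  cmp_linr A B D g := @cmp_linr k C (sval A) _ _ g
|}.
End FullSubcategory.

Section Abelianization.
Variable C : klincat k.
Implicit Types a b c : arrow C.

(* An arrow a is the diagram asrc a -> atgt a; morphisms are commutative squares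
   modulo those whose lower side factors through the target diagram. *)
Definition sq_pred a b : {pred mor (asrc a) (asrc b) * mor (atgt a) (atgt b)} :=
  fun p => p.2 ∘ amor a == amor b ∘ p.1.
Arguments sq_pred : clear implicits.

Fact sq_pred_closed a b : GRing.submod_closed (sq_pred a b).
Proof.
split=> [|c p q]; rewrite !unfold_in /sq_pred /=; first by rewrite cmp0m cmpm0.
by move=> /eqP e /eqP e'; rewrite cmpDl cmpZl cmpDr cmpZr e e'.
Qed.
HB.instance Definition _ a b := GRing.isSubmodClosed.Build k _ (sq_pred a b)
  (GRing.submod_closed_semi (sq_pred_closed a b)).

Record square a b := Square { sqv; sqvP : sqv \in sq_pred a b }.
HB.instance Definition _ a b := [isSub for @sqv a b].
HB.instance Definition _ a b := [Choice of square a b by <:].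
HB.instance Definition _ a b := [SubChoice_isSubLmodule of square a b by <:].

Lemma squareP a b (p : square a b) : (sqv p).2 ∘ amor a = amor b ∘ (sqv p).1.
Proof. by apply/eqP; exact: sqvP. Qed.

Definition mk_square a b (x : mor (asrc a) (asrc b)) (y : mor (atgt a) (atgt b))
  (e : y ∘ amor a = amor b ∘ x) : square a b :=
  @Square a b (x, y) (introT eqP e).

Definition null_sq a b : {pred square a b} :=
  fun p => `[< exists xi : mor (atgt a) (asrc b), amor b ∘ xi = (sqv p).2 >].
Arguments null_sq : clear implicits.

Fact null_sq_closed a b : GRing.submod_closed (null_sq a b).
Proof.
split=> [|c p q]; rewrite !unfold_in /null_sq.
  by apply/asboolP; exists 0; rewrite cmpm0.
move=> /asboolP[x ex] /asboolP[y ey]; apply/asboolP.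
by exists (c *: x + y); rewrite cmpDr cmpZr ex ey.
Qed.

Definition bar_hom a b : lmodType k := lquot (null_sq_closed a b).
Definition bar_cl a b (p : square a b) : bar_hom a b :=
  lproj (null_sq_closed a b) p.


Lemma bar_cl_eq a b (p q : square a b) :
  bar_cl p = bar_cl q <->
  exists xi, amor b ∘ xi = (sqv p).2 - (sqv q).2.
Proof.
by rewrite lproj_eq unfold_in /null_sq; split=> [/asboolP|?]; last exact/asboolP.
Qed.

Lemma bar_cl_surj a b (f : bar_hom a b) : exists p, f = bar_cl p.
Proof. exact: lproj_surj. Qed.

Lemma bar_clD a b (p q : square a b) : bar_cl (p + q) = bar_cl p + bar_cl q.
Proof. exact: raddfD. Qed.
Lemma bar_clZ a b x (p : square a b) : bar_cl (x *: p) = x *: bar_cl p.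
Proof. exact: linearZ. Qed.

Fact sq_id_subproof a : idm (atgt a) ∘ amor a = amor a ∘ idm (asrc a).
Proof. by rewrite cmp1m cmpm1. Qed.
Definition sq_id a : square a a := mk_square (sq_id_subproof a).

Fact sq_cmp_subproof a b c (q : square b c) (p : square a b) :
  ((sqv q).2 ∘ (sqv p).2) ∘ amor a = amor c ∘ ((sqv q).1 ∘ (sqv p).1).
Proof. by rewrite -cmpA squareP cmpA squareP cmpA. Qed.
Definition sq_cmp a b c (q : square b c) (p : square a b) : square a c :=
  mk_square (sq_cmp_subproof q p).

Lemma sq_cmp_cl a b c (q q' : square b c) (p p' : square a b) :
  bar_cl q = bar_cl q' -> bar_cl p = bar_cl p' ->
  bar_cl (sq_cmp q p) = bar_cl (sq_cmp q' p').
Proof.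
move=> /bar_cl_eq[x ex] /bar_cl_eq[y ey]; apply/bar_cl_eq.
exists (x ∘ (sqv p).2 + (sqv q').1 ∘ y) => /=.
rewrite cmpDr cmpA ex cmpA -squareP -cmpA ey cmpBl cmpBr.
by rewrite addrA subrK.
Qed.

Definition bar_idm a : bar_hom a a := bar_cl (sq_id a).
Definition bar_cmp a b c (g : bar_hom b c) (f : bar_hom a b) : bar_hom a c :=
  bar_cl (sq_cmp (lrepr g) (lrepr f)).

Lemma bar_cmpE a b c (q : square b c) (p : square a b) :
  bar_cmp (bar_cl q) (bar_cl p) = bar_cl (sq_cmp q p).
Proof. by apply: sq_cmp_cl; exact: lreprK. Qed.

Lemma square_eq a b (p q : square a b) :
  (sqv p).1 = (sqv q).1 -> (sqv p).2 = (sqv q).2 -> p = q.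
Proof.
by move=> e1 e2; apply: val_inj => /=; case: (sqv p) (sqv q) e1 e2 => ? ? [? ?] /= -> ->.
Qed.

Fact bar_cmpA a b c d (h : bar_hom c d) (g : bar_hom b c) (f : bar_hom a b) :
  bar_cmp h (bar_cmp g f) = bar_cmp (bar_cmp h g) f.
Proof.
have [[r ->] [q ->] [p ->]] := And3 (bar_cl_surj h) (bar_cl_surj g) (bar_cl_surj f).
by rewrite !bar_cmpE; congr bar_cl; apply: square_eq; rewrite /= cmpA.
Qed.
Fact bar_cmp1m a b (f : bar_hom a b) : bar_cmp (bar_idm b) f = f.
Proof.
have [p ->] := bar_cl_surj f; rewrite bar_cmpE; congr bar_cl.
by apply: square_eq; rewrite /= cmp1m.
Qed.
Fact bar_cmpm1 a b (f : bar_hom a b) : bar_cmp f (bar_idm a) = f.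
Proof.
have [p ->] := bar_cl_surj f; rewrite bar_cmpE; congr bar_cl.
by apply: square_eq; rewrite /= cmpm1.
Qed.
Fact bar_cmp_linl a b c (f : bar_hom a b) :
  linear (fun g : bar_hom b c => bar_cmp g f).
Proof.
move=> x g h; have [[q ->] [r ->] [p ->]] := And3 (bar_cl_surj g) (bar_cl_surj h) (bar_cl_surj f).
rewrite -bar_clZ -bar_clD !bar_cmpE -bar_clZ -bar_clD; congr bar_cl.
by apply: square_eq; rewrite /= cmpDl cmpZl.
Qed.
Fact bar_cmp_linr a b c (g : bar_hom b c) :
  linear (fun f : bar_hom a b => bar_cmp g f).
Proof.
move=> x f h; have [[q ->] [r ->] [p ->]] := And3 (bar_cl_surj f) (bar_cl_surj h) (bar_cl_surj g).
rewrite -bar_clZ -bar_clD !bar_cmpE -bar_clZ -bar_clD; congr bar_cl.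
by apply: square_eq; rewrite /= cmpDr cmpZr.
Qed.

Definition barcat : klincat k :=
  KLinCat bar_cmpA bar_cmp1m bar_cmpm1 bar_cmp_linl bar_cmp_linr.

Fact bar_has_cokers : additive C -> has_cokers barcat.
Proof.
move=> [_ biC] a b f; have [p ->] := bar_cl_surj f.
have [S [i1 [i2 [p1 [p2 [p11 p22 p12 p21 sumE]]]]]] := biC (asrc b) (atgt a).
pose c : barcat := Arrow (amor b ∘ p1 + (sqv p).2 ∘ p2).
have ec : idm (atgt b) ∘ amor b = amor c ∘ i1.
  by rewrite cmp1m cmpDl -!cmpA p11 p21 cmpm1 cmpm0 addr0.
exists c, (bar_cl (@mk_square b c i1 (idm _) ec)); split.
  rewrite [LHS]bar_cmpE -[RHS](linear0 (lproj (null_sq_closed a c))).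
  apply/bar_cl_eq; exists i2 => /=.
  by rewrite subr0 cmp1m cmpDl -!cmpA p12 p22 cmpm0 cmpm1 add0r.
move=> d h; have [q ->] := bar_cl_surj h; rewrite [_ ∘ _]bar_cmpE.
rewrite -[0](linear0 (lproj (null_sq_closed a d))) => /bar_cl_eq[z] /=.
rewrite subr0 => ez.
have ed : (sqv q).2 ∘ amor c = amor d ∘ ((sqv q).1 ∘ p1 + z ∘ p2).
  by rewrite !cmpDr !cmpA squareP ez.
exists (bar_cl (@mk_square c d _ _ ed)); split.
  rewrite [LHS]bar_cmpE; congr bar_cl; apply: square_eq => /=; last exact: cmpm1.
  by rewrite cmpDl -!cmpA p11 p21 cmpm1 cmpm0 addr0.
move=> u; have [r ->] := bar_cl_surj u.
move=> /(etrans (esym (bar_cmpE _ _)))/bar_cl_eq[x ex]; apply/bar_cl_eq.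
exists (- x); rewrite cmpNr ex /= cmpm1 opprB //.
Qed.

End Abelianization.

Section BarFunctor.
Variables C D : klincat k.

Section Fun.
Variable F : functor C D.

Definition bar_fob (a : barcat C) : barcat D := Arrow (fmap F (amor a)).

Fact bar_fsq_subproof (a b : arrow C) (p : square a b) :
  fmap F (sqv p).2 ∘ fmap F (amor a) = fmap F (amor b) ∘ fmap F (sqv p).1.
Proof. by rewrite -!fmapM squareP. Qed.
Definition bar_fsq (a b : arrow C) (p : square a b) :
    square (bar_fob a) (bar_fob b) :=
  @mk_square _ (bar_fob a) (bar_fob b) _ _ (bar_fsq_subproof p).

Definition bar_fmap (a b : barcat C) (f : mor a b) : mor (bar_fob a) (bar_fob b) :=
  bar_cl (bar_fsq (lrepr f)).

Lemma bar_fmapE (a b : barcat C) (p : square a b) :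
  bar_fmap (bar_cl p : mor a b) = bar_cl (bar_fsq p).
Proof.
apply/bar_cl_eq; have /bar_cl_eq[x ex] : bar_cl (lrepr (bar_cl p)) = bar_cl p.
  exact: lreprK.
by exists (fmap F x); rewrite /= -fmapM ex fmapB.
Qed.

Fact bar_fmap1 a : bar_fmap (idm a) = idm (bar_fob a).
Proof.
by rewrite [LHS]bar_fmapE; congr bar_cl; apply: square_eq; rewrite /= fmap1.
Qed.
Fact bar_fmapM a b c (g : mor b c) (f : mor a b) :
  bar_fmap (g ∘ f) = bar_fmap g ∘ bar_fmap f.
Proof.
have [[q ->] [p ->]] := conj (bar_cl_surj g) (bar_cl_surj f).
rewrite [_ ∘ _]bar_cmpE !bar_fmapE [RHS]bar_cmpE; congr bar_cl.
by apply: square_eq; rewrite /= fmapM.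
Qed.
Fact bar_fmap_lin a b : linear (@bar_fmap a b).
Proof.
move=> x f g; have [[q ->] [p ->]] := conj (bar_cl_surj g) (bar_cl_surj f).
rewrite -bar_clZ -bar_clD !bar_fmapE -bar_clZ -bar_clD; congr bar_cl.
by apply: square_eq; rewrite /= fmap_lin.
Qed.

Definition bar_functor : functor (barcat C) (barcat D) :=
  Functor bar_fmap1 bar_fmapM bar_fmap_lin.
End Fun.

Section Nat.
Variables (F G : functor C D) (eta : nat_trans F G).

Definition bar_nsq (a : arrow C) : square (bar_fob F a) (bar_fob G a) :=
  @mk_square _ (bar_fob F a) (bar_fob G a) _ _ (ntrP eta (amor a)).

Definition bar_ntr (a : barcat C) : mor (bar_functor F a) (bar_functor G a) :=
  bar_cl (bar_nsq a).

Fact bar_ntrP a b (f : mor a b) :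
  bar_ntr b ∘ fmap (bar_functor F) f = fmap (bar_functor G) f ∘ bar_ntr a.
Proof.
have [p ->] := bar_cl_surj f; rewrite /= !bar_fmapE [LHS]bar_cmpE [RHS]bar_cmpE.
by congr bar_cl; apply: square_eq; rewrite /= ntrP.
Qed.

Definition bar_nat : nat_trans (bar_functor F) (bar_functor G) := NatTrans bar_ntrP.
End Nat.
End BarFunctor.

Lemma arrow_inj (C : klincat k) (A B : C) (f g : mor A B) : Arrow f = Arrow g -> f = g.
Proof.
pose conv (x : arrow C) (h : asrc x = A) (h' : atgt x = B) : mor A B :=
  eq_rect _ (mor A) (eq_rect _ (fun Y => mor Y (atgt x)) (amor x) _ h) _ h'.
have gen x y h1 h2 h3 h4 : x = y -> conv x h1 h2 = conv y h3 h4.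
  move=> e; case: _ / e h3 h4 => h3 h4.
  by rewrite (Prop_irrelevance h1 h3) (Prop_irrelevance h2 h4).
by move=> e; exact: (gen (Arrow f) (Arrow g) erefl erefl erefl erefl e).
Qed.

Lemma bar_arrow_eq (C : klincat k) (a b a' b' : barcat C)
    (p : square a b) (p' : square a' b') :
  a = a' -> b = b' ->
  Arrow (sqv p).1 = Arrow (sqv p').1 -> Arrow (sqv p).2 = Arrow (sqv p').2 ->
  Arrow (bar_cl p : mor a b) = Arrow (bar_cl p' : mor a' b').
Proof.
move=> ea eb; case: _ / ea p'; case: _ / eb => p' /arrow_inj e1 /arrow_inj e2.
by rewrite (square_eq e1 e2).
Qed.

End CategoryTheory.

(* Equalities between 2-morphisms (or between morphisms F X -> G X) whose ends
   agree only up to the strict laws on 1-morphisms are stated on arrows. *)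
Record cat2 (k : closedFieldType) := Cat2 {
  obj :> Type;
  hcat : obj -> obj -> klincat k;
  id1 : forall i, hcat i i;
  hc1 : forall i j l, hcat j l -> hcat i j -> hcat i l;
  hc2 : forall i j l (G G' : hcat j l) (F F' : hcat i j),
    mor G G' -> mor F F' -> mor (hc1 G F) (hc1 G' F');
  hc2_id : forall i j l (G : hcat j l) (F : hcat i j),
    hc2 (idm G) (idm F) = idm (hc1 G F);
  hc2_cmp : forall i j l (G G' G'' : hcat j l) (F F' F'' : hcat i j)
    (b' : mor G' G'') (b : mor G G') (a' : mor F' F'') (a : mor F F'),
    hc2 (b' ∘ b) (a' ∘ a) = hc2 b' a' ∘ hc2 b a;
  hc2_linl : forall i j l (G G' : hcat j l) (F F' : hcat i j) (a : mor F F'),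
    linear (fun b : mor G G' => hc2 b a);
  hc2_linr : forall i j l (G G' : hcat j l) (F F' : hcat i j) (b : mor G G'),
    linear (fun a : mor F F' => hc2 b a);
  hc1A : forall i j l m (H : hcat l m) (G : hcat j l) (F : hcat i j),
    hc1 H (hc1 G F) = hc1 (hc1 H G) F;
  hc11l : forall i j (F : hcat i j), hc1 (id1 j) F = F;
  hc11r : forall i j (F : hcat i j), hc1 F (id1 i) = F;
  hc2A : forall i j l m (H H' : hcat l m) (G G' : hcat j l) (F F' : hcat i j)
    (c : mor H H') (b : mor G G') (a : mor F F'),
    Arrow (hc2 c (hc2 b a)) = Arrow (hc2 (hc2 c b) a);
  hc21l : forall i j (F F' : hcat i j) (a : mor F F'),
    Arrow (hc2 (idm (id1 j)) a) = Arrow a;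
  hc21r : forall i j (F F' : hcat i j) (a : mor F F'),
    Arrow (hc2 a (idm (id1 i))) = Arrow a
}.

Arguments hcat {k} C i j : rename.
Arguments id1 {k C} i : rename.
Arguments hc1 {k C i j l} G F : rename.
Arguments hc2 {k C i j l G G' F F'} b a : rename.
Notation "G ⊙ F" := (hc1 G F) (at level 40, left associativity).
Notation "b ⊛ a" := (hc2 b a) (at level 38, left associativity).

Section TwoCategories.
Variables (k : closedFieldType) (C : cat2 k).

Record finitary : Prop := Finitary {
  fin_obj : exists n (f : 'I_n -> C), forall i, exists t, f t = i;
  fin_hom : forall i j, finitary_cat (hcat C i j);
  fin_id1 : forall i, indecomposable (id1 i : hcat C i i)
}.

(* An object-preserving pseudofunctor F |-> inv1 F from C to itself, reversing both
   1- and 2-morphisms, whose square is isomorphic to the identity: inv_mu is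
   (G F)^* = F^* G^*, inv_nu is 1^* = 1 and inv_om is F = F^**, with inverses
   inv_muV, inv_nuV and inv_omV. *)
Record involution := Involution {
  inv1 : forall i j, hcat C i j -> hcat C j i;
  inv2 : forall i j (F G : hcat C i j), mor F G -> mor (inv1 G) (inv1 F);
  inv2_id : forall i j (F : hcat C i j), inv2 (idm F) = idm (inv1 F);
  inv2_cmp : forall i j (F G H : hcat C i j) (b : mor G H) (a : mor F G),
    inv2 (b ∘ a) = inv2 a ∘ inv2 b;
  inv2_lin : forall i j (F G : hcat C i j), linear (@inv2 i j F G);
  inv_mu : forall i j l (G : hcat C j l) (F : hcat C i j),
    mor (inv1 (G ⊙ F)) (inv1 F ⊙ inv1 G);
  inv_muV : forall i j l (G : hcat C j l) (F : hcat C i j),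
    mor (inv1 F ⊙ inv1 G) (inv1 (G ⊙ F));
  inv_muK : forall i j l (G : hcat C j l) (F : hcat C i j),
    inv_muV G F ∘ inv_mu G F = idm _;
  inv_muVK : forall i j l (G : hcat C j l) (F : hcat C i j),
    inv_mu G F ∘ inv_muV G F = idm _;
  inv_mu_nat : forall i j l (G G' : hcat C j l) (F F' : hcat C i j)
    (b : mor G G') (a : mor F F'),
    inv_mu G F ∘ inv2 (b ⊛ a) = (inv2 a ⊛ inv2 b) ∘ inv_mu G' F';
  inv_nu : forall i, mor (inv1 (id1 i)) (id1 i);
  inv_nuV : forall i, mor (id1 i) (inv1 (id1 i));
  inv_nuK : forall i, inv_nuV i ∘ inv_nu i = idm _;
  inv_nuVK : forall i, inv_nu i ∘ inv_nuV i = idm _;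
  inv_mu_assoc : forall i j l m
    (H : hcat C l m) (G : hcat C j l) (F : hcat C i j),
    Arrow ((idm (inv1 F) ⊛ inv_mu H G) ∘ inv_mu (H ⊙ G) F) =
    Arrow ((inv_mu G F ⊛ idm (inv1 H)) ∘ inv_mu H (G ⊙ F));
  inv_mu_unitl : forall i j (F : hcat C i j),
    Arrow ((idm (inv1 F) ⊛ inv_nu j) ∘ inv_mu (id1 j) F) = Arrow (idm (inv1 F));
  inv_mu_unitr : forall i j (F : hcat C i j),
    Arrow ((inv_nu i ⊛ idm (inv1 F)) ∘ inv_mu F (id1 i)) = Arrow (idm (inv1 F));
  inv_om : forall i j (F : hcat C i j), mor F (inv1 (inv1 F));
  inv_omV : forall i j (F : hcat C i j), mor (inv1 (inv1 F)) F;
  inv_omK : forall i j (F : hcat C i j), inv_omV F ∘ inv_om F = idm _;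
  inv_omVK : forall i j (F : hcat C i j), inv_om F ∘ inv_omV F = idm _;
  inv_om_nat : forall i j (F G : hcat C i j) (a : mor F G),
    inv_om G ∘ a = inv2 (inv2 a) ∘ inv_om F;
  inv_om_mu : forall i j l (G : hcat C j l) (F : hcat C i j),
    inv_om (G ⊙ F) =
    inv2 (inv_mu G F) ∘ inv_muV (inv1 F) (inv1 G) ∘ (inv_om G ⊛ inv_om F);
  inv_om_nu : forall i, inv_om (id1 i) ∘ inv_nu i = inv2 (inv_nu i)
}.

Definition has_adjunctions (I : involution) : Prop :=
  forall i j (F : hcat C i j), let Fs := inv1 I F in
  exists (al : mor (F ⊙ Fs) (id1 j)) (be : mor (id1 i) (Fs ⊙ F)),
    eqm (hc11l F) ∘ (al ⊛ idm F) ∘ eqm (hc1A F Fs F)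
      ∘ (idm F ⊛ be) ∘ eqm (esym (hc11r F)) = idm F /\
    eqm (hc11r Fs) ∘ (idm Fs ⊛ al) ∘ eqm (esym (hc1A Fs F Fs))
      ∘ (be ⊛ idm Fs) ∘ eqm (esym (hc11l Fs)) = idm Fs.

Definition has_fiat_involution : Prop := exists I, has_adjunctions I.

Record fiat : Prop := Fiat {
  fiat_finitary : finitary;
  fiat_involution : has_fiat_involution
}.

Section LeftComposition.
Variables i j l : C.

Fact lcomp1 (F : hcat C j l) (A : hcat C i j) : idm F ⊛ idm A = idm (F ⊙ A).
Proof. exact: hc2_id. Qed.
Fact lcompM (F : hcat C j l) (A B D : hcat C i j) (g : mor B D) (f : mor A B) :
  idm F ⊛ (g ∘ f) = (idm F ⊛ g) ∘ (idm F ⊛ f).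
Proof. by rewrite -hc2_cmp cmp1m. Qed.

Definition lcomp (F : hcat C j l) : functor (hcat C i j) (hcat C i l) :=
  Functor (@lcomp1 F) (@lcompM F) (fun A B => @hc2_linr k C i j l F F A B (idm F)).

Fact lcomp_natP (F G : hcat C j l) (a : mor F G) (A B : hcat C i j) (f : mor A B) :
  (a ⊛ idm B) ∘ fmap (lcomp F) f = fmap (lcomp G) f ∘ (a ⊛ idm A).
Proof. by rewrite /= -!hc2_cmp !cmp1m !cmpm1. Qed.

Definition lcomp_nat (F G : hcat C j l) (a : mor F G) :
  nat_trans (lcomp F) (lcomp G) :=
  @NatTrans _ _ _ (lcomp F) (lcomp G) (fun A => a ⊛ idm A) (lcomp_natP a).
End LeftComposition.

(* A strict k-linear 2-functor; cokernels in the target are all that is needed to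
   extend the action to the functors Coker(a). The laws on fmap also give, at
   identities, the equalities ract (id1 i) X = X and
   ract (G ⊙ F) X = ract G (ract F X). *)
Record two_rep := TwoRep {
  rcat :> C -> klincat k;
  rcok : forall i, has_cokers (rcat i);
  ract : forall i j, hcat C i j -> functor (rcat i) (rcat j);
  ract2 : forall i j (F G : hcat C i j), mor F G -> nat_trans (ract F) (ract G);
  ract_id1 : forall i (X Y : rcat i) (f : mor X Y),
    Arrow (fmap (ract (id1 i)) f) = Arrow f;
  ract_hc1 : forall i j l (G : hcat C j l) (F : hcat C i j)
    (X Y : rcat i) (f : mor X Y),
    Arrow (fmap (ract (G ⊙ F)) f) = Arrow (fmap (ract G) (fmap (ract F) f));
  ract2_id : forall i j (F : hcat C i j) X, ract2 (idm F) X = idm (ract F X);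
  ract2_cmp : forall i j (F G H : hcat C i j) (b : mor G H) (a : mor F G) X,
    ract2 (b ∘ a) X = ract2 b X ∘ ract2 a X;
  ract2_lin : forall i j (F G : hcat C i j) X,
    linear (fun a : mor F G => ract2 a X);
  ract2_hc2 : forall i j l (G G' : hcat C j l) (F F' : hcat C i j)
    (b : mor G G') (a : mor F F') X,
    Arrow (ract2 (b ⊛ a) X) = Arrow (ract2 b (ract F' X) ∘ fmap (ract G) (ract2 a X))
}.
Arguments rcok : clear implicits.

Section Principal.
Variables (HC : finitary) (i : C).

Definition principal_cat (j : C) : klincat k := barcat (hcat C i j).
Definition principal_act (j l : C) (F : hcat C j l) :
  functor (principal_cat j) (principal_cat l) := bar_functor (lcomp i F).
Definition principal_act2 (j l : C) (F G : hcat C j l) (a : mor F G) :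
  nat_trans (principal_act F) (principal_act G) := bar_nat (lcomp_nat i a).

Fact principal_cok j : has_cokers (principal_cat j).
Proof. exact/bar_has_cokers/fc_additive/fin_hom. Qed.

Lemma arrow_eta (D : klincat k) (a : arrow D) : Arrow (amor a) = a.
Proof. by case: a. Qed.

Fact principal_id1 j (X Y : principal_cat j) (f : mor X Y) :
  Arrow (fmap (principal_act (id1 j)) f) = Arrow f.
Proof.
have [p ->] := bar_cl_surj f; rewrite /= bar_fmapE.
apply: bar_arrow_eq => /=; try exact: hc21l.
  by rewrite [RHS](esym (arrow_eta X)); exact: hc21l.
by rewrite [RHS](esym (arrow_eta Y)); exact: hc21l.
Qed.

Fact principal_hc1 j l m (G : hcat C l m) (F : hcat C j l)
    (X Y : principal_cat j) (f : mor X Y) :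
  Arrow (fmap (principal_act (G ⊙ F)) f) =
  Arrow (fmap (principal_act G) (fmap (principal_act F) f)).
Proof.
have [p ->] := bar_cl_surj f; rewrite /= !bar_fmapE.
by apply: bar_arrow_eq; rewrite /bar_fob /= -hc2_id hc2A.
Qed.

Fact principal2_id j l (F : hcat C j l) X :
  principal_act2 (idm F) X = idm (principal_act F X).
Proof.
by congr bar_cl; apply: square_eq; rewrite /= hc2_id.
Qed.

Fact principal2_cmp j l (F G H : hcat C j l) (b : mor G H) (a : mor F G) X :
  principal_act2 (b ∘ a) X = principal_act2 b X ∘ principal_act2 a X.
Proof.
rewrite [RHS]bar_cmpE; congr bar_cl.
by apply: square_eq; rewrite /= -hc2_cmp cmp1m.
Qed.

Fact principal2_lin j l (F G : hcat C j l) X :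
  linear (fun a : mor F G => principal_act2 a X).
Proof.
move=> x a b; rewrite [RHS](esym (linearP (lproj _) _ _ _)); congr bar_cl.
by apply: square_eq; rewrite /= hc2_linl.
Qed.

Fact principal2_hc2 j l m (G G' : hcat C l m) (F F' : hcat C j l)
    (b : mor G G') (a : mor F F') X :
  Arrow (principal_act2 (b ⊛ a) X) =
  Arrow (principal_act2 b (principal_act F' X)
           ∘ fmap (principal_act G) (principal_act2 a X)).
Proof.
have -> : principal_act2 b (principal_act F' X)
    ∘ fmap (principal_act G) (principal_act2 a X) =
  bar_cl (sq_cmp (bar_nsq (lcomp_nat i b) (bar_fob (lcomp i F') X))
                 (bar_fsq (lcomp i G) (bar_nsq (lcomp_nat i a) X))).
  by rewrite /= bar_fmapE [LHS]bar_cmpE.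
apply: bar_arrow_eq => /=; last 2 first.
- by rewrite -hc2_cmp cmp1m cmpm1 hc2A.
- by rewrite -hc2_cmp cmp1m cmpm1 hc2A.
- by rewrite /bar_fob /= -hc2_id hc2A.
- by rewrite /bar_fob /= -hc2_id hc2A.
Qed.

Definition principal : two_rep :=
  TwoRep principal_cok principal_id1 principal_hc1 principal2_id principal2_cmp
    principal2_lin principal2_hc2.

End Principal.

Section SubRepresentation.
Variables (M : two_rep) (D : forall j, M j -> Prop).

Record is_subrep : Prop := IsSubrep {
  sub_act : forall j l (F : hcat C j l) (X : M j), D X -> D (ract M F X);
  sub_cok : forall j, has_cokers (fullsub (@D j))
}.

Hypothesis HD : is_subrep.

Definition sub_cat (j : C) : klincat k := fullsub (@D j).

Definition sub_ract (j l : C) (F : hcat C j l) : functor (sub_cat j) (sub_cat l) :=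
  @Functor _ (sub_cat j) (sub_cat l)
    (fun X => exist _ (ract M F (sval X)) (sub_act HD F (svalP X)))
    (fun X Y f => fmap (ract M F) f)
    (fun X => fmap1 (ract M F) (sval X))
    (fun X Y Z g f => fmapM (ract M F) g f)
    (fun X Y => @fmap_lin _ _ _ (ract M F) (sval X) (sval Y)).

Definition sub_ract2 (j l : C) (F G : hcat C j l) (a : mor F G) :
    nat_trans (sub_ract F) (sub_ract G) :=
  @NatTrans _ _ _ (sub_ract F) (sub_ract G)
    (fun X => ract2 M a (sval X)) (fun X Y f => ntrP (ract2 M a) f).

Lemma sub_arrow_eq j (X Y X' Y' : sub_cat j) (f : mor X Y) (f' : mor X' Y') :
  @Arrow _ (M j) (sval X) (sval Y) f = @Arrow _ (M j) (sval X') (sval Y') f' ->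
  Arrow f = Arrow f'.
Proof.
move=> e; have eX : X = X' by apply: eq_sig_hprop (congr1 (@asrc _ _) e) => *.
have eY : Y = Y' by apply: eq_sig_hprop (congr1 (@atgt _ _) e) => *.
by move: f' e; case: _ / eX; case: _ / eY => f' /arrow_inj ->.
Qed.

Definition subrep : two_rep.
refine (@TwoRep sub_cat (sub_cok HD) sub_ract sub_ract2 _ _ _ _ _ _).
- by move=> i X Y f; apply: sub_arrow_eq; exact: ract_id1.
- by move=> i j l G F X Y f; apply: sub_arrow_eq; exact: ract_hc1.
- by move=> i j F X; exact: ract2_id.
- by move=> i j F G H b a X; exact: ract2_cmp.
- by move=> i j F G X; exact: (@ract2_lin M).
- by move=> i j l G G' F F' b a X; apply: sub_arrow_eq; exact: ract2_hc2.
Defined.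

End SubRepresentation.

(* a : hat1 i j stands for the functor Coker(a), given on the principal
   2-representations, as on any other, by hat_fun. *)
Definition hat1 (i j : C) : Type := arrow (hcat C i j).

Definition hat_fun (M : two_rep) i j (a : hat1 i j) : functor (M i) (M j) :=
  coker_functor (rcok M j) (ract2 M (amor a)).

Fact hat_sq (M : two_rep) i j (a b : hat1 i j) (p : square a b) X :
  ract2 M (sqv p).2 X ∘ ract2 M (amor a) X =
  ract2 M (amor b) X ∘ ract2 M (sqv p).1 X.
Proof. by rewrite -!ract2_cmp squareP. Qed.

Definition hat_nat (M : two_rep) i j (a b : hat1 i j) (p : square a b) :
  nat_trans (hat_fun M a) (hat_fun M b) := coker_nat (rcok M j) (@hat_sq M i j a b p).

Lemma hat_natE (M : two_rep) i j (a b : hat1 i j) (p : square a b) X :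
  hat_nat M p X ∘ coker_map (rcok M j) (ract2 M (amor a) X) =
  coker_map (rcok M j) (ract2 M (amor b) X) ∘ ract2 M (sqv p).2 X.
Proof. exact: coker_nat_mapE. Qed.

Section Generation.
Hypothesis HC : finitary.

Definition zero_mor i j : hcat C i j :=
  sval (cid (fc_additive (fin_hom HC i j)).1).

Definition proj_ob i j (F : hcat C i j) : principal HC i j :=
  Arrow (0 : mor (zero_mor i j) F).

Record hat2 i j (a b : hat1 i j) := Hat2 {
  hat2_nat : forall l,
    nat_trans (hat_fun (principal HC l) a) (hat_fun (principal HC l) b);
  hat2_ind : exists p : square a b,
    forall l X, hat2_nat l X = hat_nat (principal HC l) p X
}.

Definition hat_act2 (M : two_rep) i j (a b : hat1 i j) (t : hat2 a b) :
  nat_trans (hat_fun M a) (hat_fun M b) := hat_nat M (sval (cid (hat2_ind t))).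

Lemma arrow_eqm (D : klincat k) (A B A' B' : D) (f : mor A B) (g : mor A' B')
    (eA : A = A') (eB : B = B') :
  Arrow f = Arrow g -> f = eqm (esym eB) ∘ g ∘ eqm eA.
Proof.
by case: _ / eA g; case: _ / eB => g /arrow_inj ->; rewrite /= cmp1m cmpm1.
Qed.

Lemma eqmK (D : klincat k) (A B : D) (e : A = B) : eqm (esym e) ∘ eqm e = idm A.
Proof. by case: _ / e; rewrite cmp1m. Qed.
Lemma eqmVK (D : klincat k) (A B : D) (e : A = B) : eqm e ∘ eqm (esym e) = idm B.
Proof. by case: _ / e; rewrite cmp1m. Qed.

(* A pair acts trivially on P_{1_i} only if its second component factors through
   the target; the action of a hat2 is thus independent of the inducing pair. *)
Lemma hat_nat_proj_eq i j (a b : hat1 i j) (p q : square a b) :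
  hat_nat (principal HC i) p (proj_ob (id1 i)) =
  hat_nat (principal HC i) q (proj_ob (id1 i)) ->
  exists z, amor b ∘ z = (sqv p).2 - (sqv q).2.
Proof.
set P := principal HC i; set X := proj_ob _ => e.
have epq : coker_map (rcok P j) (ract2 P (amor b) X) ∘ ract2 P (sqv p).2 X =
           coker_map (rcok P j) (ract2 P (amor b) X) ∘ ract2 P (sqv q).2 X.
  have := congr1 (fun u => u ∘ coker_map (rcok P j) (ract2 P (amor a) X)) e.
  by rewrite [LHS]hat_natE [RHS]hat_natE.
pose E : P j := Arrow (amor b ⊛ idm (id1 i)).
have eh : idm _ ∘ (idm (atgt b) ⊛ (0 : mor (zero_mor i i) (id1 i))) =
          (amor b ⊛ idm (id1 i)) ∘ 0.
  rewrite cmp1m cmpm0; exact: (fmap0 (lcomp i (atgt b))).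
pose h : mor (ract P (atgt b) X) E :=
  bar_cl (@mk_square _ _ (ract P (atgt b) X) E _ _ eh).
have h0 : h ∘ ract2 P (amor b) X = 0.
  rewrite [LHS]bar_cmpE -[RHS](linear0 (lproj (null_sq_closed _ _))).
  by apply/bar_cl_eq; exists (idm _); rewrite /= subr0 cmp1m cmpm1.
have [_ /(_ _ h h0) [u [eu _]]] := coker_mapP (rcok P j) (ract2 P (amor b) X).
have : h ∘ ract2 P (sqv p).2 X = h ∘ ract2 P (sqv q).2 X.
  by rewrite -eu -!cmpA epq.
move=> /(etrans (esym (bar_cmpE _ _))) /esym /(etrans (esym (bar_cmpE _ _))).
move=> /bar_cl_eq[z] /=; rewrite !cmp1m => ez.
exists (- (eqm (hc11r _) ∘ z ∘ eqm (esym (hc11r _)))).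
have strip (F G : hcat C i j) (x : mor F G) :
    x = eqm (hc11r G) ∘ (x ⊛ idm (id1 i)) ∘ eqm (esym (hc11r F)).
  rewrite (arrow_eqm (hc11r F) (hc11r G) (hc21r x)) !cmpA eqmVK cmp1m.
  by rewrite -cmpA eqmVK cmpm1.
rewrite cmpNr [X in X ∘ _]strip -!cmpA [eqm (esym _) ∘ (eqm _ ∘ _)]cmpA eqmK cmp1m.
rewrite [(_ ⊛ _) ∘ (_ ∘ _)]cmpA ez cmpBl cmpBr opprB !cmpA.
by rewrite -(strip _ _ (sqv p).2) -(strip _ _ (sqv q).2).
Qed.

Lemma hat_act2E (M : two_rep) i j (a b : hat1 i j) (t : hat2 a b) (p : square a b) X :
  (forall l Y, hat2_nat t l Y = hat_nat (principal HC l) p Y) ->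
  hat_act2 M t X = hat_nat M p X.
Proof.
move=> tp; rewrite /hat_act2; case: cid => q tq /=.
have [z ez] : exists z, amor b ∘ z = (sqv q).2 - (sqv p).2.
  by apply: hat_nat_proj_eq; rewrite -tp -tq.
apply: (coker_epi (coker_mapP (rcok M j) (ract2 M (amor a) X))).
rewrite [LHS]hat_natE [RHS]hat_natE -[(sqv q).2](subrK (sqv p).2) -ez.
have := ract2_lin X 1 (amor b ∘ z) (sqv p).2; rewrite !scale1r => ->.
rewrite cmpDr ract2_cmp cmpA (coker_mapP (rcok M j) (ract2 M (amor b) X)).1.
by rewrite cmp0m add0r.
Qed.

Definition generates (M : two_rep) i (X : M i) : Prop :=
  forall j (A B : M j), exists a b : hat1 i j,
    [/\ iso (hat_fun M a X) A, iso (hat_fun M b X) B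
      & forall f : mor (hat_fun M a X) (hat_fun M b X),
          exists t : hat2 a b, hat_act2 M t X = f].
Arguments generates M [i] X.

Definition cyclic (M : two_rep) : Prop := exists i (X : M i), generates M X.

(* L is the simple quotient L_F of P_F. *)
Definition is_simple_of i j (F : hcat C i j) (L : principal HC i j) : Prop :=
  simple L /\ exists e : mor (proj_ob F) L, epi e.

Definition complete_indec (I : forall i j, hcat C i j -> Prop) : Prop :=
  [/\ forall i j (F : hcat C i j), I i j F -> indecomposable F,
      forall i j (F G : hcat C i j), I i j F -> I i j G -> iso F G -> F = G
    & forall i j (F : hcat C i j), indecomposable F ->
        exists2 G, I i j G & iso F G].

Definition leR i j l (F : hcat C i j) (G : hcat C i l) : Prop :=
  exists H : hcat C j l, dsummand G (H ⊙ F).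

(* As leR only relates 1-morphisms with the same source, a right cell is given
   by that source i and by its sets of 1-morphisms from i to j, for all j. *)
Definition right_cell (I : forall i j, hcat C i j -> Prop) (i : C)
    (R : forall j, hcat C i j -> Prop) : Prop :=
  exists j0 (F0 : hcat C i j0), I i j0 F0 /\
    forall j (G : hcat C i j), R j G <-> [/\ I i j G, leR F0 G & leR G F0].

Section Cell.
Variables (I : forall i j, hcat C i j -> Prop) (i : C).
Variable R : forall j, hcat C i j -> Prop.

(* The subobject kap : K -> P_{1_i} is K_R, G is G_R and L is L_{G_R}. *)
Record cell_submodule (K : principal HC i i) (kap : mor K (proj_ob (id1 i)))
    (G : hcat C i i) (L : principal HC i i) : Prop := CellSubmodule {
  cs_mono : mono kap;
  cs_quot : forall Q (q : mor (proj_ob (id1 i)) Q), is_coker kap q ->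
    forall S, simple_subquotient S Q ->
    forall j (F : hcat C i j), R F -> is_zero (ract (principal HC i) F S);
  cs_ind : I G;
  cs_simple : is_simple_of G L;
  cs_top : is_simple_top K L;
  cs_nonzero : forall j (F : hcat C i j),
    R F -> ~ is_zero (ract (principal HC i) F L)
}.

Variable L : principal HC i i.

Definition cell_gen j (Y : principal HC i j) : Prop :=
  exists2 F, R F & Y = ract (principal HC i) F L.

Definition cell_ob j (M : principal HC i j) : Prop :=
  exists X1 X0 (f : mor X1 X0) (p : mor X0 M),
    [/\ in_add (@cell_gen j) X1, in_add (@cell_gen j) X0 & is_coker f p].

End Cell.
End Generation.
End TwoCategories.

Arguments generates {k C} HC M [i] X.

(* Main.v *)
(* Evaluating the 1-morphisms at P_1 := P_{1_i} gives the projectives F P_1 of the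
   principal 2-representation, and Hom(F P_1, G P_1) = Hom(F, G), so an object
   F -> G of the abelianization is the value at P_1 of Coker(F -> G); this is (a).

   For (b), let F kill P_1 / K. As F is exact, having F* as a left and right adjoint,
   F P_1 <- F K is invertible, and F K -> F L gives an epimorphism F P_1 -> F L
   through which every F P_1 -> H L factors. Hence Hom(F, H) -> Hom(F L, H L) is
   onto, F L is projective relative to cokernels of maps between such objects, and
   C_R consists of these cokernels. The adjunction Hom(F P_1, F L) = Hom(F* F P_1, L)
   shows that the top G of K lies above every F with F P_1 / F K = 0 and F L nonzero;
   it follows that G is in R and that the 1-morphisms above R and outside R kill L.
   If LG is the top of G L in C_R, there is a map LG -> L inducing a bijection on
   Hom(X, -) for X = F L; by adjunction F LG -> F L is invertible. An object of C_R
   with projective cover H L is then Coker(F -> H) LG, where F -> H covers all the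
   2-morphisms to H vanishing in that object; this makes evaluation at LG full. *)
From HB Require Import structures.
Require Import Defs.
From mathcomp Require Import all_boot all_algebra.
From mathcomp Require Import boolp.

Set Implicit Arguments.
Unset Strict Implicit.
Unset Printing Implicit Defensive.

Import GRing.Theory.
Local Open Scope ring_scope.

(** * Linear independence in possibly infinite-dimensional spaces *)

Section LinearAlgebra.
Variable k : fieldType.
Implicit Types V W : lmodType k.

(** Recursion on the list stands in for the [vectType] span and freeness, since spaces of morphisms
    are bare [lmodType]s. *)
Fixpoint inspan V (s : seq V) (y : V) : Prop :=
  if s is x :: s' then exists a, inspan s' (y - a *: x) else y = 0.

Fixpoint indep V (s : seq V) : Prop :=
  if s is x :: s' then ~ inspan s' x /\ indep s' else True.

(* A bound on the dimension inherited by subspaces and by quotients, with no finite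
   basis to choose. *)
Definition dimle V n : Prop := forall s : seq V, indep s -> (size s <= n)%N.

Definition subspace V (N : V -> Prop) : Prop :=
  N 0 /\ forall a x y, N x -> N y -> N (a *: x + y).

Lemma lin0 V W (f : V -> W) : linear f -> f 0 = 0.
Proof.
by move=> fl; have := fl (-1) 0 0; rewrite !scaleN1r addr0 oppr0 addNr.
Qed.

Lemma inspan_subspace V (s : seq V) : subspace (inspan s).
Proof.
elim: s => [|x s [IH0 IH]]; split => //=.
- by move=> a _ _ -> ->; rewrite scaler0 addr0.
- by exists 0; rewrite scale0r subr0.
- move=> a y z [b yb] [c zc]; exists (a * b + c).
  rewrite scalerDl opprD addrACA -scalerA -scalerBr; exact: IH.
Qed.

Lemma inspan_min V (N : V -> Prop) (s : seq V) y :
  subspace N -> (forall x, x \in s -> N x) -> inspan s y -> N y.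
Proof.
move=> [N0 NS]; elim: s y => [|x s IH] y /= sN; first by move=> ->.
move=> [a ya]; rewrite -[y](subrK (a *: x)) addrC; apply: NS.
  by apply: sN; rewrite mem_head.
by apply: IH ya => z zs; apply: sN; rewrite inE zs orbT.
Qed.

Lemma inspan_map V W (f : V -> W) (s : seq V) y :
  linear f -> inspan s y -> inspan (map f s) (f y).
Proof.
move=> fl; elim: s y => [|x s IH] y /=.
  by move=> ->; exact: lin0.
move=> [a /IH ya]; exists a; rewrite addrC -scaleNr -fl scaleNr addrC //.
Qed.

Lemma inspan_mapI V W (f : V -> W) (s : seq V) y :
  linear f -> injective f -> inspan (map f s) (f y) -> inspan s y.
Proof.
move=> fl fI; elim: s y => [|x s IH] y /=.
  by move=> y0; apply: fI; rewrite y0 lin0.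
by move=> [a ya]; exists a; apply: IH; rewrite addrC -scaleNr fl scaleNr addrC.
Qed.

Lemma indep_map V W (f : V -> W) (s : seq V) :
  linear f -> injective f -> indep s -> indep (map f s).
Proof.
move=> fl fI; elim: s => //= x s IH [xs /IH is_]; split => //.
by move=> /(inspan_mapI fl fI).
Qed.

Lemma indep_mapV V W (f : V -> W) (s : seq V) :
  linear f -> indep (map f s) -> indep s.
Proof.
move=> fl; elim: s => //= x s IH [xs /IH is_]; split => //.
by move=> /(inspan_map fl).
Qed.

Lemma map_surj V W (f : V -> W) : (forall y, exists x, f x = y) ->
  forall s : seq W, exists s', s = map f s'.
Proof.
move=> fs; elim=> [|y s [s' ->]]; first by exists [::].
by have [x <-] := fs y; exists (x :: s').
Qed.

Lemma dimle_inj V W (f : V -> W) n : linear f -> injective f ->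
  dimle W n -> dimle V n.
Proof. by move=> fl fI Wn s /(indep_map fl fI)/Wn; rewrite size_map. Qed.

Lemma dimle_surj V W (f : V -> W) n : linear f -> (forall y, exists x, f x = y) ->
  dimle V n -> dimle W n.
Proof.
move=> fl fs Vn s; have [s' ->] := map_surj fs s.
by move=> /(indep_mapV fl)/Vn; rewrite size_map.
Qed.

(** Adding [y], which lies outside the image, to the image of an independent family keeps it
    independent. *)
Lemma dimle_inj_strict V W (f : V -> W) y n : linear f -> injective f ->
  (forall x, f x <> y) -> dimle W n.+1 -> dimle V n.
Proof.
move=> fl fI fy Wn s si; have := Wn (y :: map f s); rewrite /= size_map; apply.
split; last exact: indep_map.
move=> /(@inspan_min _ (fun y => exists x, f x = y)) [].
- split; first by exists 0; exact: lin0.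
  by move=> a _ _ [x <-] [z <-]; exists (a *: x + z); rewrite fl.
- by move=> _ /mapP[x _ ->]; exists x.
- by move=> x; apply: fy.
Qed.

(** A lift of an independent family stays independent when the kernel vector [x] is appended:
    applying [f] to a relation removes [x]. *)
Lemma dimle_surj_strict V W (f : V -> W) x n : linear f ->
  (forall y, exists x, f x = y) -> f x = 0 -> x <> 0 -> dimle V n.+1 -> dimle W n.
Proof.
move=> fl fs fx0 x0 Vn s; have [s' ->] := map_surj fs s => si.
have := Vn (rcons s' x); rewrite size_rcons size_map; apply.
elim: s' si => /= [_|z s' IH [zs /IH is_]]; split => //.
move=> /(inspan_map fl); rewrite map_rcons fx0 => sp; apply: zs.
apply: inspan_min sp; first exact: inspan_subspace.
move=> w; rewrite mem_rcons inE => /predU1P[->|]; first exact: (inspan_subspace _).1.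
elim: (map f s') => //= v t IHt; rewrite inE => /predU1P[->|/IHt wt].
  by exists 1; rewrite scale1r subrr; exact: (inspan_subspace _).1.
by exists 0; rewrite scale0r subr0.
Qed.

(** The bound [n] provides a longest independent list inside [N]; a vector of [N] outside its span
    would lengthen it. *)
Lemma dimle_span V n (N : V -> Prop) : dimle V n ->
  exists s : seq V, (forall x, x \in s -> N x) /\ forall y, N y -> inspan s y.
Proof.
move=> Vn.
pose Q m := `[< exists s : seq V, [/\ size s = m, indep s & forall x, x \in s -> N x] >].
have Q0 : exists m, Q m by exists 0%N; apply/asboolP; exists [::].
have Qn m : Q m -> (m <= n)%N by move=> /asboolP[s [<- /Vn]].
case: (ex_maxnP Q0 Qn) => m /asboolP[s [sm si sN]] mm.
exists s; split=> // y Ny; apply: contrapT => ys.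
have /mm : Q m.+1; last by rewrite ltnn.
apply/asboolP; exists (y :: s); split=> //=; first by rewrite sm.
by move=> x; rewrite inE => /predU1P[->|/sN].
Qed.

Lemma dimle0 V (x : V) : dimle V 0 -> x = 0.
Proof. by move=> V0; apply: contrapT => x0; have := V0 [:: x]; rewrite /= => /(_ (conj x0 I)). Qed.

Lemma dimle_axiom V n : Vector.axiom n V -> dimle V n.
Proof.
case=> f fl /bij_inj fI; apply: (dimle_inj fl fI) => s si.
have sp (t : seq 'rV[k]_n) y : y \in <<t>>%VS -> inspan t y.
  elim: t y => [|x t IH] y /=; first by rewrite span_nil memv0 => /eqP.
  rewrite span_cons => /memv_addP[_ /vlineP[a ->]] [z /IH zt ->].
  by exists a; rewrite addrC addKr.
have : free s.
  elim: s si => [|x s IH] /= => [_|[xs /IH sf]]; first exact: nil_free.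
  by rewrite free_cons sf andbT; apply/negP => /sp.
move/eqP => <-; apply: leq_trans (dimvS (subvf _)) _.
by rewrite dimvf /dim /= mul1n.
Qed.

End LinearAlgebra.

(** * Retracts and indecomposables in linear categories *)

Section Factorization.
Variable k : closedFieldType.
Implicit Types C D : klincat k.

(* thru Q (idm X) says that X is a retract of a finite sum of objects satisfying Q. *)
Inductive thru C (Q : C -> Prop) (X Y : C) : mor X Y -> Prop :=
| thru0 : thru Q 0
| thruS A (i : mor A Y) (p : mor X A) h : Q A -> thru Q h -> thru Q (i ∘ p + h).

Lemma thru1 C (Q : C -> Prop) (X A Y : C) (i : mor A Y) (p : mor X A) :
  Q A -> thru Q (i ∘ p).
Proof. by move=> QA; rewrite -[_ ∘ _]addr0; apply: thruS QA (thru0 _ _ _). Qed.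

Lemma thruD C (Q : C -> Prop) (X Y : C) (g h : mor X Y) :
  thru Q g -> thru Q h -> thru Q (g + h).
Proof.
elim=> [|A i p g' QA _ IH] th; first by rewrite add0r.
by rewrite -addrA; apply: thruS QA (IH th).
Qed.

Lemma thru_sum C (Q : C -> Prop) (X Y : C) n (h : 'I_n -> mor X Y) :
  (forall t, thru Q (h t)) -> thru Q (\sum_(t < n) h t).
Proof. by move=> th; apply: big_ind => //; [exact: thru0 | exact: thruD]. Qed.

Lemma thru_cmp C (Q : C -> Prop) (X Y Z W : C) (h : mor Y Z) (f : mor Z W)
  (g : mor X Y) : thru Q h -> thru Q (f ∘ h ∘ g).
Proof.
elim=> [|A i p h' QA _ IH]; first by rewrite cmpm0 cmp0m; exact: thru0.
rewrite cmpDr cmpDl; apply: thruD IH.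
by rewrite cmpA -cmpA; apply: thru1.
Qed.

Lemma thru_trans C (Q Q' : C -> Prop) (X Y : C) (h : mor X Y) :
  (forall A, Q A -> thru Q' (idm A)) -> thru Q h -> thru Q' h.
Proof.
move=> QQ'; elim=> [|A i p h' QA _ IH]; first exact: thru0.
apply: thruD IH; have := thru_cmp i p (QQ' _ QA).
by rewrite cmpm1.
Qed.

Lemma thru_sub C (Q Q' : C -> Prop) (X Y : C) (h : mor X Y) :
  (forall A, Q A -> Q' A) -> thru Q h -> thru Q' h.
Proof.
move=> QQ'; apply: thru_trans => A /QQ' QA.
by rewrite -(cmp1m (idm A)); apply: thru1.
Qed.

Lemma thru_fmap C D (F : functor C D) (Q : C -> Prop) (Q' : D -> Prop) (X Y : C)
  (h : mor X Y) : (forall A, Q A -> Q' (F A)) -> thru Q h -> thru Q' (fmap F h).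
Proof.
move=> QQ'; elim=> [|A i p h' QA _ IH]; first by rewrite fmap0; exact: thru0.
by rewrite fmapD fmapM; apply: thruS IH; exact: QQ'.
Qed.

Lemma zero_mor_l C (A B : C) (f : mor A B) : is_zero A -> f = 0.
Proof. by move=> A0; rewrite -[f]cmpm1 A0 cmpm0. Qed.

Lemma zero_mor_r C (A B : C) (f : mor A B) : is_zero B -> f = 0.
Proof. by move=> B0; rewrite -[f]cmp1m B0 cmp0m. Qed.

Lemma thru_is_zero C (X Y : C) (h : mor X Y) : thru (@is_zero k C) h -> h = 0.
Proof.
by elim=> // A i p h' A0 _ ->; rewrite addr0 [p]zero_mor_r // cmpm0.
Qed.

Lemma is_zero_fmap C D (F : functor C D) (A : C) : is_zero A -> is_zero (F A).
Proof. by rewrite /is_zero -fmap1 => ->; rewrite fmap0. Qed.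

Definition retract C (A X : C) : Prop :=
  exists (i : mor A X) (p : mor X A), p ∘ i = idm A.

Lemma retract_trans C (A X Y : C) : retract A X -> retract X Y -> retract A Y.
Proof.
move=> [i [p pi]] [j [q qj]]; exists (j ∘ i), (p ∘ q).
by rewrite cmpA -[p ∘ q ∘ j]cmpA qj cmpm1.
Qed.

Lemma retract_fmap C D (F : functor C D) (A X : C) :
  retract A X -> retract (F A) (F X).
Proof.
by move=> [i [p pi]]; exists (fmap F i), (fmap F p); rewrite -fmapM pi fmap1.
Qed.

Lemma iso_retract C (A X : C) : iso A X -> retract A X.
Proof. by move=> [i [p [pi _]]]; exists i, p. Qed.

Lemma iso_sym C (A X : C) : iso A X -> iso X A.
Proof. by move=> [i [p [pi ip]]]; exists p, i. Qed.

Lemma dsummand_retract C (A X : C) : dsummand A X -> retract A X.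
Proof. by move=> [B [i [j [p [q []]]]]]; exists i, p. Qed.

(** The complement is cut out by the idempotent [idm X - i ∘ p]. *)
Lemma retract_compl C (A X : C) (i : mor A X) (p : mor X A) : karoubian C ->
  p ∘ i = idm A -> exists B (j : mor B X) (q : mor X B),
  [/\ q ∘ j = idm B, p ∘ j = 0, q ∘ i = 0 & i ∘ p + j ∘ q = idm X].
Proof.
move=> kC pi.
have ee : (idm X - i ∘ p) ∘ (idm X - i ∘ p) = idm X - i ∘ p.
  rewrite cmpBl cmp1m cmpBr cmpm1 cmpA -[i ∘ p ∘ i]cmpA pi cmpm1 subrr subr0 //.
have [B [r [s [rs sr]]]] := kC _ _ ee.
have pe : p ∘ (idm X - i ∘ p) = 0 by rewrite cmpBr cmpm1 cmpA pi cmp1m subrr.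
have ei : (idm X - i ∘ p) ∘ i = 0 by rewrite cmpBl -cmpA pi cmpm1 cmp1m subrr.
exists B, s, r; split=> //.
- by rewrite -[s]cmpm1 -rs [s ∘ (r ∘ s)]cmpA sr cmpA pe cmp0m.
- by rewrite -[r]cmp1m -rs -[r ∘ s ∘ r]cmpA sr -cmpA ei cmpm0.
- by rewrite sr addrC subrK.
Qed.

Lemma retract_dsummand C (A X : C) : karoubian C -> retract A X -> dsummand A X.
Proof.
move=> kC [i [p pi]]; have [B [j [q [qj pj qi e]]]] := retract_compl kC pi.
by exists B, i, j, p, q.
Qed.

(** The cokernel of [idm A - e] splits [e]. *)
Lemma cokers_karoubian C : has_cokers C -> karoubian C.
Proof.
move=> cC A e ee; have [B [r rP]] := cC _ _ (idm A - e); have [r0 ru] := rP.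
have [|s [sr _]] := ru _ e; first by rewrite cmpBr cmpm1 ee subrr.
exists B, r, s; split=> //; apply: (coker_epi rP).
by rewrite -cmpA sr cmp1m; apply/esym/subr0_eq; rewrite -[X in X - _]cmpm1 -cmpBr.
Qed.

Lemma biprod_sym C (A B S : C) : is_biprod A B S -> is_biprod B A S.
Proof.
move=> [i [j [p [q [pi qj pj qi e]]]]]; exists j, i, q, p; split=> //.
by rewrite addrC.
Qed.

Lemma biprod_thru C (Q : C -> Prop) (A B S : C) : is_biprod A B S ->
  thru Q (idm A) -> thru Q (idm B) -> thru Q (idm S).
Proof.
move=> [i [j [p [q [pi qj pj qi <-]]]]] tA tB; apply: thruD.
  by have := thru_cmp i p tA; rewrite cmpm1.
by have := thru_cmp j q tB; rewrite cmpm1.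
Qed.

Lemma biprod_fmap C D (F : functor C D) (A B S : C) :
  is_biprod A B S -> is_biprod (F A) (F B) (F S).
Proof.
move=> [i [j [p [q [pi qj pj qi e]]]]].
exists (fmap F i), (fmap F j), (fmap F p), (fmap F q).
by split; rewrite -?fmapM ?pi ?qj ?pj ?qi ?fmap1 ?fmap0 // -fmapD e fmap1.
Qed.

(** Finitely many factorizations through objects of [P] are collected into one through their
    biproduct, again in [P]. *)
Lemma thru_factor C (P : C -> Prop) (X Y : C) (h : mor X Y) :
  (exists2 Z, P Z & is_zero Z) ->
  (forall A B, P A -> P B -> exists2 S, P S & is_biprod A B S) ->
  thru P h -> exists2 S, P S & exists (b : mor S Y) (a : mor X S), h = b ∘ a.
Proof.
move=> [Z PZ Z0] PS; elim=> [|A i p h' PA _ [S PSS [b [a ->]]]].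
  by exists Z => //; exists 0, 0; rewrite cmp0m.
have [T PT [i1 [i2 [p1 [p2 [p11 p22 p12 p21 e]]]]]] := PS _ _ PA PSS.
exists T => //; exists (i ∘ p1 + b ∘ p2), (i1 ∘ p + i2 ∘ a).
rewrite cmpDr !cmpDl !cmpA -[i ∘ p1 ∘ i1]cmpA -[i ∘ p1 ∘ i2]cmpA.
rewrite -[b ∘ p2 ∘ i1]cmpA -[b ∘ p2 ∘ i2]cmpA p11 p12 p21 p22.
by rewrite !cmpm1 !cmpm0 !cmp0m addr0 add0r.
Qed.

Lemma in_add_thru C (Q : C -> Prop) (X : C) : in_add Q X -> thru Q (idm X).
Proof.
move=> [n [f [S [Qf [i [p [_ _ e]]] /dsummand_retract [j [q qj]]]]]].
rewrite -qj -[q]cmpm1 -e; apply/thru_cmp/thru_sum => t; exact: thru1.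
Qed.

Lemma dsum_cons C n (f : 'I_n -> C) (A S T : C) : is_dsum f S -> is_biprod A S T ->
  is_dsum (fun t : 'I_n.+1 => oapp f A (unlift ord0 t)) T.
Proof.
move=> [i [p [pi pis e]]] [i1 [i2 [p1 [p2 [p11 p22 p12 p21 e']]]]].
pose g t : C := oapp f A (unlift ord0 t).
pose i' (t : 'I_n.+1) : mor (g t) T :=
  match unlift ord0 t as o return mor (oapp f A o) T with
  | Some s => i2 ∘ i s | None => i1 end.
pose p' (t : 'I_n.+1) : mor T (g t) :=
  match unlift ord0 t as o return mor T (oapp f A o) with
  | Some s => p s ∘ p2 | None => p1 end.
have ip2 s t : p s ∘ p2 ∘ (i2 ∘ i t) = p s ∘ i t.
  by rewrite cmpA -[_ ∘ p2 ∘ i2]cmpA p22 cmpm1.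
exists i', p'; split.
- move=> t; rewrite /i' /p' /g; case: (unlift ord0 t) => [s|] //=.
  by rewrite ip2 pi.
- move=> s t st; rewrite /i' /p'.
  case: (unliftP ord0 s) (unliftP ord0 t) st => [s'|] -> [t'|] -> //=.
  + rewrite (inj_eq lift_inj) => st; rewrite ip2; exact: pis.
  + by rewrite -cmpA p21 cmpm0.
  + by rewrite cmpA p12 cmp0m.
- rewrite big_ord_recl /i' /p' unlift_none /= -e'; congr (_ + _).
  transitivity (i2 ∘ idm S ∘ p2); last by rewrite cmpm1.
  rewrite -e.
  rewrite (big_morph (fun h => i2 ∘ h) (cmpDr i2) (cmpm0 _ i2)).
  rewrite (big_morph (fun h => h ∘ p2) (fun x y => cmpDl x y p2) (cmp0m _ p2)).
  by apply: eq_bigr => t _; rewrite liftK /= !cmpA.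
Qed.

Lemma thru_in_add C (P Q : C -> Prop) (X : C) : karoubian C ->
  (exists2 Z, P Z & is_zero Z) ->
  (forall A B, P A -> P B -> exists2 S, P S & is_biprod A B S) ->
  (forall A, Q A -> P A) -> thru Q (idm X) -> in_add Q X.
Proof.
move=> kC [Z PZ Z0] PS QP.
suff gen Y (h : mor X Y) : thru Q h -> exists n (f : 'I_n -> C) S,
    [/\ P S, forall t, Q (f t), is_dsum f S
      & exists (b : mor S Y) (a : mor X S), h = b ∘ a].
  move=> /gen[n [f [S [_ Qf fS [b [a e]]]]]].
  by exists n, f, S; split=> //; apply: retract_dsummand => //; exists a, b.
elim=> [|A i p h' QA _ [n [f [S [PSS Qf fS [b [a ->]]]]]]].
  exists 0%N, (fun=> Z), Z; split=> //; first by case.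
    exists (fun=> 0), (fun=> 0); split; [by case|by case|].
    by rewrite big_ord0 Z0.
  by exists 0, 0; rewrite cmp0m.
have [T PT biT] := PS A S (QP _ QA) PSS.
exists n.+1, (fun t => oapp f A (unlift ord0 t)), T; split=> //.
- by move=> t; case: (unlift _ _).
- exact: dsum_cons biT.
case: biT => [i1 [i2 [p1 [p2 [p11 p22 p12 p21 e]]]]].
exists (i ∘ p1 + b ∘ p2), (i1 ∘ p + i2 ∘ a).
rewrite cmpDr !cmpDl !cmpA -[i ∘ p1 ∘ i1]cmpA -[i ∘ p1 ∘ i2]cmpA.
rewrite -[b ∘ p2 ∘ i1]cmpA -[b ∘ p2 ∘ i2]cmpA p11 p12 p21 p22.
by rewrite !cmpm1 !cmpm0 !cmp0m addr0 add0r.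
Qed.

(** Induction on the dimension of the endomorphism algebra. For a summand with nonzero complement,
    [a ↦ i ∘ a ∘ p] embeds its endomorphisms into those of [X] and misses [j ∘ q], so the dimension
    drops. *)
Lemma thru_dec C (X : C) n : dimle (mor X X) n ->
  thru (fun A => indecomposable A /\ retract A X) (idm X).
Proof.
elim: n X => [|n IH] X Xn; first by rewrite [idm X](dimle0 _ Xn); exact: thru0.
have [X0|X0] := pselect (is_zero X); first by rewrite X0; exact: thru0.
have [Xi|Xi] := pselect (indecomposable X).
  rewrite -(cmp1m (idm X)); apply: thru1; split=> //.
  by exists (idm X), (idm X); rewrite cmp1m.
have [A [B [biX A0 B0]]] : exists A B, [/\ is_biprod A B X, ~ is_zero A & ~ is_zero B].
  apply: contrapT => nX; apply: Xi; split=> // A B bi.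
  have [|A0] := pselect (is_zero A); first by left.
  by right; apply: contrapT => B0; apply: nX; exists A, B.
have part A' B' : is_biprod A' B' X -> ~ is_zero B' ->
    thru (fun A => indecomposable A /\ retract A X) (idm A').
  move=> [i [j [p [q [pi qj pj qi e]]]]] B'0.
  have AX : retract A' X by exists i, p.
  apply: (thru_sub (Q := fun A => indecomposable A /\ retract A A')).
    by move=> D [Di DA]; split=> //; exact: retract_trans DA AX.
  apply: IH; apply: (dimle_inj_strict (f := fun a => i ∘ a ∘ p) (y := j ∘ q)) Xn.
  - by move=> a x y; rewrite cmpDr cmpDl cmpZr cmpZl.
  - move=> x y /(congr1 (fun z => p ∘ z ∘ i)).
    rewrite !cmpA pi !cmp1m -!cmpA pi !cmpm1; exact.
  - move=> x /(congr1 (fun z => q ∘ z ∘ j)).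
    by rewrite !cmpA qi !cmp0m qj cmp1m qj => /esym.
by apply: (biprod_thru biX); [exact: part biX B0 | exact: part (biprod_sym biX) A0].
Qed.

End Factorization.

(** * Fitting's lemma: local endomorphism rings of indecomposables *)

Lemma power_stable_split (R : pzRingType) (a r : R) m :
  a * r = r * a -> a ^+ m = a ^+ m.+1 * r ->
  exists s, a * s = s * a /\ a ^+ m.+1 = a ^+ m.+1 * a ^+ m.+1 * s.
Proof.
move=> ar em.
have cra j : r * a ^+ j = a ^+ j * r by apply: commrX; exact: esym.
(* The hypothesis iterated [j] times; [j = m.+1] leads to [s = r ^+ m.+1]. *)
have emj j : a ^+ m = a ^+ (m + j) * r ^+ j.
  elim: j => [|j IH]; first by rewrite addn0 mulr1.
  have e : a ^+ (m + j) = a ^+ (m + j.+1) * r.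
    by rewrite exprD em -mulrA cra mulrA -exprD addSnnS.
  by rewrite {1}IH e -mulrA -exprS.
exists (r ^+ m.+1); split; first exact: commrX.
by rewrite -exprD addSn {1}exprS {1}(emj m.+1) mulrA -exprS.
Qed.

Section LocalEndomorphisms.
Variables (k : closedFieldType) (C : klincat k) (G : C).

(** A separate name carrying the ring structure with composition as product, which gives access to
    powers and commutation lemmas. *)
Definition endo : Type := mor G G.
HB.instance Definition _ := GRing.Zmodule.on endo.
Fact endo_mulDl : left_distributive (fun g f : endo => g ∘ f : endo) +%R.
Proof. by move=> x y z; exact: cmpDl. Qed.
Fact endo_mulDr : right_distributive (fun g f : endo => g ∘ f : endo) +%R.
Proof. by move=> x y z; exact: cmpDr. Qed.
HB.instance Definition _ := GRing.Zmodule_isPzRing.Build endo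
  (fun h g f => cmpA h g f) (fun f => cmp1m f) (fun f => cmpm1 f)
  endo_mulDl endo_mulDr.

Definition is_unit (a : mor G G) : Prop := exists b, b ∘ a = idm G /\ a ∘ b = idm G.

(** The powers from [a^0] to [a^n] are too many to be independent, so some [a^m] is a combination of
    later ones; factoring out [a^(m+1)] leaves an [r] that commutes with [a]. *)
Lemma power_stable (a : endo) n : dimle (mor G G) n ->
  exists m r, a * r = r * a /\ a ^+ m = a ^+ m.+1 * r.
Proof.
move=> Gn; pose l m d := [seq (a ^+ i : mor G G) | i <- iota m d].
have /asboolP : ~ indep (l 0%N n.+1).
  by move=> /Gn; rewrite size_map size_iota ltnn.
suff dep d m : ~ indep (l m d) -> exists m r, a * r = r * a /\ a ^+ m = a ^+ m.+1 * r.
  by move=> /asboolP /dep.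
elim: d m => [|d IH] m; first by case.
have [sp _|nsp] := pselect (inspan (l m.+1 d) (a ^+ m)); last first.
  by move=> ni; apply: (IH m.+1) => li; apply: ni.
exists m.
apply: (inspan_min (N := fun y : mor G G =>
  exists r : endo, a * r = r * a /\ y = a ^+ m.+1 * r)) sp.
  split; first by exists 0; rewrite !mulr0 mul0r.
  move=> c x y [r [ar ->]] [s [as_ ->]]; exists (c *: (r : mor G G) + s).
  have cl (x' y' : endo) : (c *: (x' : mor G G) : endo) * y' = c *: (x' * y' : mor G G).
    exact: cmpZl.
  have cr (x' y' : endo) : x' * (c *: (y' : mor G G) : endo) = c *: (x' * y' : mor G G).
    exact: cmpZr.
  split.
    by rewrite mulrDr mulrDl cl cr ar as_.
  by rewrite mulrDr cr.
move=> x /mapP[i]; rewrite mem_iota => /andP[mi _] ->.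
exists (a ^+ (i - m.+1)); split; first by rewrite -exprS exprSr.
by rewrite -exprD subnKC.
Qed.

(** With [p = a^(m+1)] and [s] from [power_stable_split], [p * s] is idempotent, hence 0 or 1 as [G]
    is indecomposable. In the first case [a] is nilpotent and a geometric sum inverts [1 - a]; in
    the second [a^m * s] inverts [a]. *)
Lemma endo_local (a : mor G G) n : karoubian C -> indecomposable G ->
  dimle (mor G G) n -> is_unit a \/ is_unit (idm G - a).
Proof.
move=> kC Gi Gn; have [m [r [ar em]]] := power_stable a Gn.
have [s [as_ pps]] := power_stable_split ar em.
pose p : endo := (a : endo) ^+ m.+1.
have ps : p * s = s * p by apply/esym/commrX/esym.
have ee : (p * s : endo) * (p * s) = p * s.
  by rewrite mulrA -[p * s * p]mulrA -ps mulrA -pps.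
have [B [u [v [uv vu]]]] := kC _ _ ee.
have [B' [v' [u' [uv' u'v v'u e]]]] := retract_compl kC uv.
case: (Gi.2 B B') => [|B0|B0]; first by exists v, v', u, u'.
  right; pose b : endo := \sum_(t < m.+1) (a : endo) ^+ t.
  have p0 : p = 0.
    by rewrite /p pps -mulrA -[_ * s]vu [v]zero_mor_l // cmp0m mulr0.
  have ab : ((a : endo) - 1) * b = - 1 by rewrite -subrX1 -/p p0 sub0r.
  have cab : (a : endo) * b = b * a.
    by apply: commr_sum => t _; exact: commrX.
  have e1 : (1 - (a : endo)) * b = 1 by rewrite -opprB mulNr ab opprK.
  exists b; split; first last; first exact: e1.
  change (b * (1 - (a : endo)) = 1).
  by rewrite mulrBr mulr1 -cab -[X in X - _]mul1r -mulrBl.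
left; have ps1 : p * s = 1.
  by rewrite -[p * s]vu -[RHS]e [v']zero_mor_l // cmp0m addr0.
have cas : (a : endo) ^+ m * s = s * (a : endo) ^+ m by apply/esym/commrX/esym.
exists ((a : endo) ^+ m * s : endo); split.
  by rewrite -[RHS]ps1 ps /p exprSr mulrA -cas.
by rewrite -[RHS]ps1 /p exprS -mulrA.
Qed.
End LocalEndomorphisms.

(** * Categories with a projective generator *)

Section ProjectiveGenerators.
Variable k : closedFieldType.
Implicit Types A D : klincat k.

(** No exactness is asked for, so that the record covers both projectives in an abelianization and
    all objects of a category of 1-morphisms. *)
Record fincover A (P : A -> Prop) : Prop := FinCover {
  cv_zero : exists2 Z, P Z & is_zero Z;
  cv_sum : forall Q Q', P Q -> P Q' -> exists2 S, P S & is_biprod Q Q' S;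
  cv_gen : exists2 G, P G & forall Q, P Q -> thru (eq G) (idm Q);
  cv_fin : forall Q X, P Q -> exists n, dimle (mor Q X) n
}.

(** A linear subfunctor of Hom(-, X), from which [subobject] later builds a subobject of [X]. *)
Record subfunctor A (X : A) (N : forall Q, mor Q X -> Prop) : Prop := Subfunctor {
  sf_subspace : forall Q, subspace (@N Q);
  sf_cmp : forall Q Q' (x : mor Q X) (u : mor Q' Q), N Q x -> N Q' (x ∘ u)
}.

(** A finite spanning list of [N G], for the generator [G], is assembled into one morphism [w] out
    of a power of [G]. Every [Q] in [P] is a retract of such a power, so its elements of [N] factor
    through [w] as well. *)
Lemma fincover_cover A (P : A -> Prop) (X : A) (N : forall Q, mor Q X -> Prop) :
  fincover P -> subfunctor N ->
  exists W (w : mor W X), [/\ P W, N W w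
    & forall Q (x : mor Q X), P Q -> N Q x -> exists u, x = w ∘ u].
Proof.
move=> cP sN; have [G PG Ggen] := cv_gen cP; have [n Gn] := cv_fin cP X PG.
have [s [sN' sp]] := dimle_span (@N G) Gn.
have [W [w [PW Nw sw]]] : exists W (w : mor W X),
    [/\ P W, N W w & forall x, x \in s -> exists u, x = w ∘ u].
  elim: s sN' {sp} => [|x s IH] sN'.
    by have [Z PZ _] := cv_zero cP; exists Z, 0; split=> //; exact: (sf_subspace sN Z).1.
  have [|W [w [PW Nw sw]]] := IH.
    by move=> y ys; apply: sN'; rewrite inE ys orbT.
  have [S PS [i [j [p [q [pi qj pj qi e]]]]]] := cv_sum cP PG PW.
  exists S, (x ∘ p + w ∘ q); split=> //.
    rewrite -[x ∘ p]scale1r; apply: (sf_subspace sN S).2; apply: sf_cmp => //.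
    by apply: sN'; rewrite mem_head.
  move=> y; rewrite inE => /predU1P[->|/sw[u ->]].
    by exists i; rewrite cmpDl -!cmpA pi qi cmpm1 cmpm0 addr0.
  by exists (j ∘ u); rewrite cmpDl -!cmpA [p ∘ _]cmpA [q ∘ _]cmpA pj qj
    cmp0m cmp1m cmpm0 add0r.
exists W, w; split=> // Q x /Ggen tQ Nx.
suff gen Q' (h : mor Q' Q) : thru (eq G) h -> exists u, x ∘ h = w ∘ u.
  by have [u e] := gen _ _ tQ; exists u; rewrite -e cmpm1.
elim=> [|Y i p h' GY _ [u e]]; first by exists 0; rewrite !cmpm0.
case: _ / GY in i p *.
have [v ev] : exists v, x ∘ i = w ∘ v.
  have := sp _ (sf_cmp sN i Nx).
  apply: (inspan_min (N := fun y : mor G X => exists v, y = w ∘ v)) => //.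
  split; first by exists 0; rewrite cmpm0.
  by move=> a _ _ [u1 ->] [u2 ->]; exists (a *: u1 + u2); rewrite cmpDr cmpZr.
by exists (v ∘ p + u); rewrite !cmpDr e !cmpA ev.
Qed.

(* The objects satisfying P are projective, and the morphisms x : Q -> X with P Q
   play the role of the elements of X. *)
Record projgen A (P : A -> Prop) : Prop := ProjGen {
  pg_cover : fincover P;
  pg_cok : has_cokers A;
  pg_pres : forall X, exists P1 P0 (d : mor P1 P0) (p : mor P0 X),
    [/\ P P1, P P0 & is_coker d p];
  pg_lift : forall X Y Z (f : mor X Y) (q : mor Y Z), is_coker f q ->
    forall Q (z : mor Q Z), P Q -> exists y, z = q ∘ y;
  pg_exact : forall X Y Z (f : mor X Y) (q : mor Y Z), is_coker f q ->
    forall Q (y : mor Q Y), P Q -> q ∘ y = 0 -> exists x, y = f ∘ x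
}.

Section Points.
Variables (A : klincat k) (P : A -> Prop).
Hypothesis PG : projgen P.

Definition surj (X Y : A) (f : mor X Y) : Prop :=
  forall Q (y : mor Q Y), P Q -> exists x, y = f ∘ x.

Definition inj (X Y : A) (f : mor X Y) : Prop :=
  forall Q (x : mor Q X), P Q -> f ∘ x = 0 -> x = 0.

Lemma pts_eq (X Y : A) (f g : mor X Y) :
  (forall Q (x : mor Q X), P Q -> f ∘ x = g ∘ x) -> f = g.
Proof.
by move=> fg; have [P1 [P0 [d [p [_ P0P /coker_epi]]]]] := pg_pres PG X; apply; exact: fg.
Qed.

Lemma pts_zero (X Y : A) (f : mor X Y) :
  (forall Q (x : mor Q X), P Q -> f ∘ x = 0) -> f = 0.
Proof. by move=> f0; apply: pts_eq => Q x /f0 ->; rewrite cmp0m. Qed.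

Lemma mono_inj (X Y : A) (f : mor X Y) : mono f -> inj f.
Proof. by move=> fm Q x _ fx; apply: fm; rewrite fx cmpm0. Qed.

Lemma inj_mono (X Y : A) (f : mor X Y) : inj f -> mono f.
Proof.
move=> fI Z g h e; apply: pts_eq => Q x PQ; apply/eqP; rewrite -subr_eq0 -cmpBl.
by apply/eqP/fI => //; rewrite cmpA cmpBr e subrr cmp0m.
Qed.

Lemma coker_surj (X Y Z : A) (f : mor X Y) (q : mor Y Z) : is_coker f q -> surj q.
Proof. by move=> fq Q y PQ; exact: (pg_lift PG fq). Qed.

Lemma surj_epi (X Y : A) (f : mor X Y) : surj f -> epi f.
Proof.
move=> fs Z g h e; apply: pts_eq => Q y PQ; have [x ->] := fs Q y PQ.
by rewrite !cmpA e.
Qed.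

Lemma epi_surj (X Y : A) (f : mor X Y) : epi f -> surj f.
Proof.
move=> fe Q y PQ; have [Z [q fq]] := pg_cok PG f.
have q0 : q = 0 by apply: fe; rewrite fq.1 cmp0m.
by apply: (pg_exact PG fq PQ); rewrite q0 cmp0m.
Qed.

(** The factorization is chosen on a projective cover of [I] and descends because [m] detects the
    vanishing of the relations. *)
Lemma inj_factor (V I Y : A) (m : mor V Y) (f : mor I Y) : inj m ->
  (forall Q (x : mor Q I), P Q -> exists v, f ∘ x = m ∘ v) -> exists u, f = m ∘ u.
Proof.
move=> mI fm; have [P1 [P0 [d [p [P1P P0P dp]]]]] := pg_pres PG I.
have [v ev] := fm _ p P0P.
have [|u [eu _]] := dp.2 _ v.
  by apply: mI => //; rewrite cmpA -ev -cmpA dp.1 cmpm0.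
by exists u; apply: (coker_epi dp); rewrite ev -cmpA eu.
Qed.

Lemma pts_iso (X Y : A) (f : mor X Y) : inj f -> surj f ->
  exists g, g ∘ f = idm X /\ f ∘ g = idm Y.
Proof.
move=> fI fs; have [|g e] := inj_factor (f := idm Y) fI.
  by move=> Q x PQ; have [y ->] := fs Q x PQ; exists y; rewrite cmp1m.
exists g; split=> //; apply: (inj_mono fI).
by rewrite cmpA -e cmp1m cmpm1.
Qed.

(** A projective [W] covers [N], a second one covers the kernel of [W -> X], and the subobject is
    the cokernel of the resulting map between projectives. *)
Lemma subobject (X : A) (N : forall Q, mor Q X -> Prop) : subfunctor N ->
  exists I (m : mor I X), mono m /\
    forall Q (x : mor Q X), P Q -> (N Q x <-> exists u, x = m ∘ u).
Proof.
move=> sN; have cP := pg_cover PG.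
have [W [w [PW Nw cw]]] := fincover_cover cP sN.
have sN' : subfunctor (fun Q (v : mor Q W) => w ∘ v = 0).
  split=> [Q|Q Q' x u e]; last by rewrite cmpA e cmp0m.
  split; first exact: cmpm0.
  by move=> a x y ex ey; rewrite cmpDr cmpZr ex ey scaler0 addr0.
have [V [r [PV wr cr]]] := fincover_cover cP sN'.
have [I [c rc]] := pg_cok PG r; have [m [em _]] := rc.2 _ w wr.
exists I, m; split.
  apply: inj_mono => Q x PQ mx; have [y ey] := pg_lift PG rc x PQ.
  have [|z ez] := cr Q y PQ; first by rewrite -em -cmpA -ey.
  by rewrite ey ez cmpA rc.1 cmp0m.
move=> Q x PQ; split; first by move=> /cw[] // u ->; exists (c ∘ u); rewrite cmpA em.
move=> [u ->]; have [y ->] := pg_lift PG rc u PQ.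
by rewrite cmpA em; exact: sf_cmp.
Qed.

Lemma kernel (X Y : A) (f : mor X Y) : exists K (r : mor K X),
  [/\ mono r, f ∘ r = 0
    & forall Q (x : mor Q X), P Q -> f ∘ x = 0 -> exists u, x = r ∘ u].
Proof.
have sN : subfunctor (fun Q (x : mor Q X) => f ∘ x = 0).
  split=> [Q|Q Q' x u e]; last by rewrite cmpA e cmp0m.
  split; first exact: cmpm0.
  by move=> a x y ex ey; rewrite cmpDr cmpZr ex ey scaler0 addr0.
have [K [r [rm rN]]] := subobject sN; exists K, r; split=> //.
  apply: pts_zero => Q x PQ; rewrite -cmpA; apply/rN => //; by exists x.
by move=> Q x PQ /rN; apply.
Qed.

(** The factorization of [h] is defined by lifting a projective cover of [Y] to [X]; it respects the
    relations since [h] kills every point that [f] kills. *)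
Lemma surj_coker (X Y : A) (f : mor X Y) : surj f -> exists K (r : mor K X), is_coker r f.
Proof.
move=> fs; have [K [r [rm fr rN]]] := kernel f; exists K, r; split=> // E h hr.
have [P1 [P0 [d [p [P1P P0P dp]]]]] := pg_pres PG Y.
have [p' ep'] := fs _ p P0P.
have hN Q (x : mor Q X) : P Q -> f ∘ x = 0 -> h ∘ x = 0.
  by move=> PQ /rN[] // u ->; rewrite cmpA hr cmp0m.
have [|u [eu _]] := dp.2 _ (h ∘ p').
  by rewrite -cmpA; apply: hN => //; rewrite cmpA -ep' dp.1.
suff euf : u ∘ f = h.
  by exists u; split=> // u' eu'; apply: (surj_epi fs); rewrite euf eu'.
apply: pts_eq => Q x PQ; have [y ey] := pg_lift PG dp (f ∘ x) PQ.
rewrite -cmpA ey cmpA eu -cmpA; apply/esym/subr0_eq; rewrite -cmpBr.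
by apply: hN => //; rewrite cmpBr ey cmpA -ep' subrr.
Qed.

Lemma exact_coker (X Y Z : A) (f : mor X Y) (q : mor Y Z) : q ∘ f = 0 -> surj q ->
  (forall Q (y : mor Q Y), P Q -> q ∘ y = 0 -> exists x, y = f ∘ x) -> is_coker f q.
Proof.
move=> qf qs qx; split=> // E h hf; have [K [r rq]] := surj_coker qs.
apply: rq.2; apply: pts_zero => Q z PQ.
have [|x ex] := qx Q (r ∘ z) PQ; first by rewrite cmpA rq.1 cmp0m.
by rewrite -cmpA ex cmpA hf cmp0m.
Qed.

Lemma image (X Y : A) (f : mor X Y) : exists I (e : mor X I) (m : mor I Y),
  [/\ mono m, surj e & f = m ∘ e].
Proof.
have sN : subfunctor (fun Q (y : mor Q Y) => exists x, y = f ∘ x).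
  split=> [Q|Q Q' y u [x ->]]; last by exists (x ∘ u); rewrite cmpA.
  split; first by exists 0; rewrite cmpm0.
  by move=> a _ _ [x ->] [y ->]; exists (a *: x + y); rewrite cmpDr cmpZr.
have [I [m [mm mN]]] := subobject sN.
have [|e fe] := inj_factor (f := f) (mono_inj mm).
  by move=> Q x PQ; apply/mN => //; exists x.
exists I, e, m; split=> // Q y PQ.
have [|x ex] := (mN Q (m ∘ y) PQ).2; first by exists y.
by exists x; apply: mm; rewrite ex fe cmpA.
Qed.

Lemma simple_surj (S X : A) (f : mor X S) : simple S -> f <> 0 -> surj f.
Proof.
move=> [_ Ss] f0; have [I [e [m [mm es fme]]]] := image f.
case: (Ss _ _ mm) => [I0|[g [_ mg]]].
  by case: f0; rewrite fme [m]zero_mor_l // cmp0m.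
move=> Q y PQ; have [x ex] := es Q (g ∘ y) PQ.
by exists x; rewrite fme -cmpA -ex cmpA mg cmp1m.
Qed.

Lemma coker_zero_iso (X Y Z : A) (m : mor X Y) (q : mor Y Z) : mono m -> is_coker m q ->
  is_zero Z -> exists g, g ∘ m = idm X /\ m ∘ g = idm Y.
Proof.
move=> mm mq Z0; apply: pts_iso; first exact: mono_inj.
by move=> Q y PQ; apply: (pg_exact PG mq PQ); exact: zero_mor_r.
Qed.

Lemma pullback_sub (X Z V : A) (q : mor X Z) (m : mor V Z) : surj q -> mono m ->
  exists I (j : mor I X) (e : mor I V), [/\ mono j, surj e & q ∘ j = m ∘ e].
Proof.
move=> qs mm.
have sN : subfunctor (fun Q (x : mor Q X) => exists v, q ∘ x = m ∘ v).
  split=> [Q|Q Q' y u [x e]]; last by exists (x ∘ u); rewrite !cmpA e.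
  split; first by exists 0; rewrite !cmpm0.
  by move=> a x y [u eu] [v ev]; exists (a *: u + v); rewrite !cmpDr !cmpZr eu ev.
have [I [j [jm jN]]] := subobject sN.
have [|e qe] := inj_factor (f := q ∘ j) (mono_inj mm).
  by move=> Q x PQ; rewrite -cmpA; apply/jN => //; exists x.
exists I, j, e; split=> // Q v PQ; have [x ex] := qs Q (m ∘ v) PQ.
have [|u eu] := (jN Q x PQ).1; first by exists v.
by exists u; apply: mm; rewrite ex eu !cmpA qe.
Qed.

Lemma simple_subquotient_sub (S V X : A) (m : mor V X) : mono m ->
  simple_subquotient S V -> simple_subquotient S X.
Proof.
move=> mm [Ss [U [j [e [jm ee]]]]]; split=> //; exists U, (m ∘ j), e; split=> //.
by move=> T g h; rewrite -!cmpA => /mm /jm.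
Qed.

Lemma simple_subquotient_quot (S X Z : A) (q : mor X Z) : surj q ->
  simple_subquotient S Z -> simple_subquotient S X.
Proof.
move=> qs [Ss [V [m [e [mm ee]]]]]; split=> //.
have [I [j [e' [jm e's _]]]] := pullback_sub qs mm.
exists I, j, (e ∘ e'); split=> // T g h.
by rewrite !cmpA => /(surj_epi e's) /ee.
Qed.

Definition preserves_cokers D (F : functor A D) : Prop :=
  forall X Y Z (f : mor X Y) (q : mor Y Z),
    is_coker f q -> is_coker (fmap F f) (fmap F q).

(* Induction on the dimension of Hom(G, X), for G a projective generator. *)
Lemma simple_subquotients_zero D (F : functor A D) (X : A) : preserves_cokers F ->
  (forall S, simple_subquotient S X -> is_zero (F S)) -> is_zero (F X).
Proof.
move=> Fc; have [G PG' Ggen] := cv_gen (pg_cover PG).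
have Gpts Q Y (y : mor Q Y) (N : forall Q, mor Q Y -> Prop) : subfunctor N ->
    P Q -> (forall x : mor G Y, N G x) -> N Q y.
  move=> sN /Ggen tQ NG; suff gen Q' (h : mor Q' Q) : thru (eq G) h -> N Q' (y ∘ h).
    by rewrite -[y]cmpm1; exact: gen.
  elim=> [|T i p h' GT _ IH]; first by rewrite cmpm0; exact: (sf_subspace sN _).1.
  case: _ / GT in i p *.
  rewrite cmpDr cmpA -[_ ∘ p]scale1r; apply: (sf_subspace sN _).2 => //.
  exact: sf_cmp.
have Gzero Y : (forall x : mor G Y, x = 0) -> is_zero Y.
  move=> Y0; apply: pts_zero => Q x PQ; rewrite cmp1m.
  apply: (Gpts Q Y x (fun Q x => x = 0)) => //; split=> [Q'|Q' Q'' _ u ->].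
    by split=> // a _ _ -> ->; rewrite scaler0 addr0.
  by rewrite cmp0m.
have [n Gn] := cv_fin (pg_cover PG) X PG'.
elim: n X Gn => [|n IH] X Gn XS.
  by apply/is_zero_fmap/Gzero => x; exact: dimle0 Gn.
have [X0|X0] := pselect (is_zero X); first exact: is_zero_fmap.
have [Xs|Xs] := pselect (simple X).
  apply: XS; split=> //; exists X, (idm X), (idm X).
  by split=> Z g h; rewrite ?cmp1m ?cmpm1.
(* Neither zero nor simple, [X] has a proper nonzero subobject [V]. Both [V] and the quotient [Z]
   have strictly fewer morphisms from [G]. *)
have [V [m [mm A0 mN]]] : exists V (m : mor V X), [/\ mono m, ~ is_zero V
    & ~ exists g, g ∘ m = idm V /\ m ∘ g = idm X].
  apply: contrapT => nX; apply: Xs; split=> // V m mm.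
  have [|A0] := pselect (is_zero V); first by left.
  by right; apply: contrapT => mN; apply: nX; exists V, m.
have [Z [q mq]] := pg_cok PG m.
have FA : is_zero (F V).
  apply: IH => [|S /(simple_subquotient_sub mm)]; last exact: XS.
  have [y ym] : exists y : mor G X, forall x, m ∘ x <> y.
    apply: contrapT => ny; apply: mN; apply: pts_iso; first exact: mono_inj.
    move=> Q y PQ; apply: (Gpts Q X y (fun Q y => exists x, y = m ∘ x)) => //.
      split=> [Q'|Q' Q'' _ u [x ->]]; last by exists (x ∘ u); rewrite cmpA.
      split; first by exists 0; rewrite cmpm0.
      by move=> a _ _ [x ->] [x' ->]; exists (a *: x + x'); rewrite cmpDr cmpZr.
    move=> x; apply: contrapT => nx; apply: ny; exists x => z e.
    by apply: nx; exists z.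
  apply: (dimle_inj_strict (f := fun x => m ∘ x)) ym Gn; first exact: cmp_linr.
  exact: mm.
have FZ : is_zero (F Z).
  have qs := coker_surj mq.
  apply: IH => [|S /(simple_subquotient_quot qs)]; last exact: XS.
  have [x x0] : exists x : mor G V, x <> 0.
    apply: contrapT => nx; apply: A0; apply: Gzero => x.
    by apply: contrapT => x0; apply: nx; exists x.
  apply: (dimle_surj_strict (f := fun x => q ∘ x) (x := m ∘ x)) Gn.
  - exact: cmp_linr.
  - by move=> y; have [z ->] := qs G y PG'; exists z.
  - by rewrite cmpA mq.1 cmp0m.
  - by move=> e; apply: x0; apply: mm; rewrite e cmpm0.
(* [F Z] is the cokernel of a map out of the zero object [F V], so the identity of [F X] factors
   through it. *)
have [|u [eu _]] := (Fc _ _ _ _ _ mq).2 _ (idm (F X)).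
  by rewrite cmp1m [fmap F m]zero_mor_l.
by rewrite /is_zero -eu [u]zero_mor_l // cmp0m.
Qed.

End Points.
End ProjectiveGenerators.

(** * The abelianization of a finitary category *)

Section FinitaryCover.
Variable k : closedFieldType.

Lemma biprod_iso (C : klincat k) (A A' B B' S : C) : iso A A' -> iso B B' ->
  is_biprod A B S -> is_biprod A' B' S.
Proof.
move=> [f [f' [ff ff']]] [g [g' [gg gg']]] [i [j [p [q [pi qj pj qi e]]]]].
exists (i ∘ f'), (j ∘ g'), (f ∘ p), (g ∘ q); split.
- by rewrite cmpA -[f ∘ p ∘ i]cmpA pi cmpm1.
- by rewrite cmpA -[g ∘ q ∘ j]cmpA qj cmpm1.
- by rewrite cmpA -[f ∘ p ∘ j]cmpA pj cmpm0 cmp0m.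
- by rewrite cmpA -[g ∘ q ∘ i]cmpA qi cmpm0 cmp0m.
- by rewrite !cmpA -[i ∘ f' ∘ f]cmpA ff -[j ∘ g' ∘ g]cmpA gg !cmpm1.
Qed.

Lemma retract_thru (C : klincat k) (A X : C) : retract A X -> thru (eq X) (idm A).
Proof. by move=> [i [p <-]]; apply: thru1. Qed.

Variables (C : klincat k) (HC : finitary_cat C).

Lemma finitary_sum (A B : C) : exists2 S, True & is_biprod A B S.
Proof. by have [_ /(_ A B)[S ?]] := fc_additive HC; exists S. Qed.

Lemma finitary_dimle (A B : C) : exists n, dimle (mor A B) n.
Proof. by have [n [/dimle_axiom]] := fc_findim HC A B; exists n. Qed.

Lemma finitary_dec (X : C) : thru (fun A => indecomposable A /\ retract A X) (idm X).
Proof. by have [n /thru_dec] := finitary_dimle X X. Qed.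

Lemma finitary_local (G : C) (a : mor G G) : indecomposable G ->
  is_unit a \/ is_unit (idm G - a).
Proof.
move=> Gi; have [n Gn] := finitary_dimle G G.
exact: endo_local (fc_karoubian HC) Gi Gn.
Qed.

(** Run through the finitely many isomorphism classes of indecomposables and add to [G] one
    representative of each class that meets [Q]. *)
Lemma finitary_gen (P Q : C -> Prop) :
  (exists2 Z, P Z & is_zero Z) ->
  (forall A B, P A -> P B -> exists2 S, P S & is_biprod A B S) ->
  (forall A, Q A -> P A /\ indecomposable A) ->
  exists2 G, P G & forall A, Q A -> thru (eq G) (idm A).
Proof.
move=> [Z PZ _] PS QP; have [n [f fP]] := fc_indec HC.
have [G PG Gf] : exists2 G, P G & forall t, t \in enum 'I_n ->
    forall A, Q A -> iso A (f t) -> retract A G.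
  elim: (enum 'I_n) => [|t s [G PG Gs]]; first by exists Z.
  have [[B QB Bt]|nB] := pselect (exists2 B, Q B & iso B (f t)); last first.
    exists G => // u; rewrite inE => /predU1P[->|/Gs //] A QA At.
    by case: nB; exists A.
  have [S PSS [i [j [p [q [pi qj pj qi e]]]]]] := PS _ _ (QP _ QB).1 PG.
  exists S => // u; rewrite inE => /predU1P[->|/Gs us] A QA At.
    apply: (@retract_trans _ _ _ B); last by exists i, p.
    by apply: retract_trans (iso_retract At) (iso_retract (iso_sym Bt)).
  by apply: (retract_trans (us A QA At)); exists j, q.
exists G => // A QA; have [t At] := fP A (QP A QA).2.
by apply: retract_thru; apply: Gf QA At; rewrite mem_enum.
Qed.

Lemma finitary_fincover : fincover (fun _ : C => True).
Proof.
have Cz : exists2 Z : C, True & is_zero Z by have [[Z Z0] _] := fc_additive HC; exists Z.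
split=> //; [by move=> *; exact: finitary_sum| |by move=> *; exact: finitary_dimle].
have [//|||G _ GP] := @finitary_gen (fun=> True) (@indecomposable k C).
- by move=> *; exact: finitary_sum.
- by [].
exists G => // X _; apply: thru_trans (finitary_dec X) => A [Ai _]; exact: GP.
Qed.

End FinitaryCover.

Section BarPoints.
Variables (k : closedFieldType) (C : klincat k).
Implicit Types X Y Z Q : barcat C.

(** Only the arrow has to vanish, not its source, which makes the class stable under the action of
    1-morphisms. A morphism from such a [Q] to [X] is a morphism to [atgt X] modulo those factoring
    through [amor X]. *)
Definition bar_proj Q : Prop := amor Q = 0.

Fact bar_pt_subproof Q X (y : mor (atgt Q) (atgt X)) : bar_proj Q ->
  y ∘ amor Q = amor X ∘ 0.
Proof. by move=> ->; rewrite !cmpm0. Qed.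

Definition bar_pt Q X (PQ : bar_proj Q) (y : mor (atgt Q) (atgt X)) : mor Q X :=
  bar_cl (mk_square (bar_pt_subproof y PQ)).

Lemma bar_ptE Q X (PQ : bar_proj Q) (p : square Q X) :
  bar_cl p = bar_pt PQ (sqv p).2.
Proof. by apply/bar_cl_eq; exists 0; rewrite /= subrr cmpm0. Qed.

Lemma bar_pt_surj Q X (PQ : bar_proj Q) (z : mor Q X) : exists y, z = bar_pt PQ y.
Proof. by have [p ->] := bar_cl_surj z; exists (sqv p).2; exact: bar_ptE. Qed.

Lemma bar_pt_cmp Q X Y (PQ : bar_proj Q) (p : square X Y) (y : mor (atgt Q) (atgt X)) :
  (bar_cl p : mor X Y) ∘ bar_pt PQ y = bar_pt PQ ((sqv p).2 ∘ y).
Proof. by rewrite [LHS]bar_cmpE (bar_ptE PQ). Qed.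

Lemma bar_pt_comp Q Q' X (PQ : bar_proj Q) (PQ' : bar_proj Q')
    (g : mor (atgt Q') (atgt X)) (f : mor (atgt Q) (atgt Q')) :
  bar_pt PQ' g ∘ bar_pt PQ f = bar_pt PQ (g ∘ f).
Proof. exact: bar_pt_cmp. Qed.

Lemma bar_pt_linear Q X (PQ : bar_proj Q) : linear (@bar_pt Q X PQ).
Proof. by move=> a x y; rewrite -bar_clZ -bar_clD (bar_ptE PQ) /=. Qed.

Lemma bar_pt_eq0 Q X (PQ : bar_proj Q) (y : mor (atgt Q) (atgt X)) :
  bar_pt PQ y = 0 <-> exists x, amor X ∘ x = y.
Proof.
rewrite -[X in _ = X](lin0 (bar_pt_linear (X := X) PQ)) [_ = _]bar_cl_eq /=.
by rewrite subr0.
Qed.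

(* A morphism out of Y killing f through which the exactness at Y of any cokernel
   of f can be tested. *)
Lemma bar_test X Y (f : mor X Y) : Defs.additive C -> exists Z (h : mor Y Z),
  h ∘ f = 0 /\ forall Q (y : mor Q Y), bar_proj Q -> h ∘ y = 0 -> exists x, y = f ∘ x.
Proof.
move=> [_ biC]; have [p ->] := bar_cl_surj f.
have [S [i1 [i2 [p1 [p2 [p11 p22 p12 p21 e]]]]]] := biC (asrc Y) (atgt X).
(* The same explicit cokernel as in [bar_has_cokers]. *)
pose Z : barcat C := Arrow (amor Y ∘ p1 + (sqv p).2 ∘ p2).
have eh : idm (atgt Y) ∘ amor Y = amor Z ∘ i1.
  by rewrite cmp1m cmpDl -!cmpA p11 p21 cmpm1 cmpm0 addr0.
exists Z, (bar_cl (@mk_square _ _ Y Z i1 (idm _) eh)); split.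
  rewrite [LHS]bar_cmpE -[RHS](lin0 (@lproj_linear _ _ _ (null_sq_closed _ _))).
  apply/bar_cl_eq; exists i2.
  by rewrite /= subr0 cmp1m cmpDl -!cmpA p12 p22 cmpm0 cmpm1 add0r.
move=> Q y PQ; have [y' ->] := bar_pt_surj PQ y; rewrite bar_pt_cmp /=.
move=> /bar_pt_eq0[z /=]; rewrite cmp1m => ez.
exists (bar_pt PQ (p2 ∘ z)); rewrite [RHS]bar_pt_cmp; apply/subr0_eq.
rewrite -[_ - _]addrC -scaleN1r -bar_pt_linear; apply/bar_pt_eq0.
exists (p1 ∘ z); rewrite -ez cmpDl scaleN1r -!cmpA addrC addrK //.
Qed.

Lemma bar_exact X Y Z (f : mor X Y) (q : mor Y Z) : Defs.additive C -> is_coker f q ->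
  forall Q (y : mor Q Y), bar_proj Q -> q ∘ y = 0 -> exists x, y = f ∘ x.
Proof.
move=> /(bar_test f)[T [h [hf hT]]] [_ fq] Q y PQ qy.
have [u [eu _]] := fq _ h hf.
by apply: hT => //; rewrite -eu -cmpA qy cmpm0.
Qed.

(** The test morphism attached to [q] vanishes because [q] is epi, so every [z] passes the test. *)
Lemma bar_lift X Y Z (f : mor X Y) (q : mor Y Z) : Defs.additive C -> is_coker f q ->
  forall Q (z : mor Q Z), bar_proj Q -> exists y, z = q ∘ y.
Proof.
move=> /(bar_test q)[T [h [hq hT]]] /coker_epi qe Q z PQ.
by apply: hT => //; rewrite [h](qe _ h 0) ?cmp0m.
Qed.

(** The diagram [X] is its own presentation, by the projectives of its two ends. *)
Lemma bar_pres X : exists P1 P0 (d : mor P1 P0) (p : mor P0 X),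
  [/\ bar_proj P1, bar_proj P0 & is_coker d p].
Proof.
pose P1 : barcat C := Arrow (0 : mor (asrc X) (asrc X)).
pose P0 : barcat C := Arrow (0 : mor (asrc X) (atgt X)).
have P1P : bar_proj P1 by []. have P0P : bar_proj P0 by [].
exists P1, P0, (@bar_pt P1 P0 P1P (amor X)), (@bar_pt P0 X P0P (idm _)).
split=> //; split.
  by rewrite bar_pt_comp; apply/bar_pt_eq0; exists (idm _); rewrite cmp1m cmpm1.
move=> E h; have [y ->] := bar_pt_surj P0P h.
rewrite [_ ∘ _]bar_pt_comp /= => /bar_pt_eq0[z ez].
exists (bar_cl (@mk_square _ _ X E z y (esym ez))); split.
  by rewrite [LHS]bar_pt_cmp /= cmpm1.
move=> u; have [p ->] := bar_cl_surj u.
move=> /(etrans (esym (bar_pt_cmp _ _ _)))/bar_cl_eq[x] /=; rewrite cmpm1 => ex.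
by apply/bar_cl_eq; exists (- x); rewrite cmpNr ex opprB.
Qed.

(** A model of P_A that is functorial in [A] without the choice of a zero object. *)
Definition bar_unit (A : C) : barcat C := Arrow (0 : mor A A).

Fact bar_unit_proj A : bar_proj (bar_unit A). Proof. by []. Qed.

Definition bar_unit_map (A B : C) (f : mor A B) : mor (bar_unit A) (bar_unit B) :=
  @bar_pt (bar_unit A) (bar_unit B) (bar_unit_proj A) f.

Fact bar_unit1 A : bar_unit_map (idm A) = idm (bar_unit A).
Proof. by apply/esym; rewrite [LHS](bar_ptE (bar_unit_proj A)). Qed.
Fact bar_unitM A B D (g : mor B D) (f : mor A B) :
  bar_unit_map (g ∘ f) = bar_unit_map g ∘ bar_unit_map f.
Proof. by rewrite bar_pt_comp. Qed.

Fact bar_unit_lin A B : linear (@bar_unit_map A B).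
Proof. exact: (@bar_pt_linear (bar_unit A) (bar_unit B)). Qed.

Definition bar_unit_functor : functor C (barcat C) :=
  Functor bar_unit1 bar_unitM bar_unit_lin.

Lemma bar_unit_iso Q : bar_proj Q -> iso (bar_unit (atgt Q)) Q.
Proof.
move=> PQ; pose Q' := bar_unit (atgt Q); have PQ' : bar_proj Q' := bar_unit_proj _.
exists (@bar_pt Q' Q PQ' (idm _)), (@bar_pt Q Q' PQ (idm _)); split.
  by rewrite bar_pt_comp /= cmp1m; apply/esym; rewrite [LHS](bar_ptE PQ').
by rewrite bar_pt_comp /= cmp1m; apply/esym; rewrite [LHS](bar_ptE PQ).
Qed.

Lemma bar_projgen : finitary_cat C -> projgen bar_proj.
Proof.
move=> HC; have addC := fc_additive HC; have cC := finitary_fincover HC.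
split; last 4 first.
- exact: bar_has_cokers.
- exact: bar_pres.
- by move=> X Y Z f q fq Q z PQ; exact: (bar_lift addC fq).
- by move=> X Y Z f q fq Q y PQ; exact: (bar_exact addC fq).
split.
- have [Z _ Z0] := cv_zero cC; exists (bar_unit Z) => //.
  exact: (is_zero_fmap bar_unit_functor).
- move=> Q Q' PQ PQ'; have [S _ bi] := cv_sum cC (Q := atgt Q) (Q' := atgt Q') I I.
  exists (bar_unit S) => //.
  apply: biprod_iso (bar_unit_iso PQ) (bar_unit_iso PQ') _.
  exact: (biprod_fmap bar_unit_functor).
- have [G _ Ggen] := cv_gen cC; exists (bar_unit G) => // Q PQ.
  have [f [g [_ <-]]] := bar_unit_iso PQ.
  rewrite -[f]cmpm1; apply: thru_cmp.
  rewrite -(fmap1 bar_unit_functor); apply: (thru_fmap (F := bar_unit_functor)) (Ggen _ I).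
  by move=> A <-.
- move=> Q X PQ; have [n nP] := finitary_dimle HC (atgt Q) (atgt X); exists n.
  apply: dimle_surj (bar_pt_linear PQ) _ nP => z.
  by have [y ->] := bar_pt_surj PQ z; exists y.
Qed.

End BarPoints.

(** * Adjunctions and the action of 1-morphisms *)

Section Adjunctions.
Variable k : closedFieldType.

Definition adjoint (A D : klincat k) (L : functor A D) (R : functor D A) : Prop :=
  exists (eta : forall X, mor X (R (L X))) (eps : forall Y, mor (L (R Y)) Y),
  [/\ forall X X' (f : mor X X'), eta X' ∘ f = fmap R (fmap L f) ∘ eta X,
      forall Y Y' (g : mor Y Y'), g ∘ eps Y = eps Y' ∘ fmap L (fmap R g),
      forall X, eps (L X) ∘ fmap L (eta X) = idm (L X)
    & forall Y, fmap R (eps Y) ∘ eta (R Y) = idm (R Y)].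

Variables (A D : klincat k) (L : functor A D) (R : functor D A).

Lemma adjoint_preserves_cokers : adjoint L R -> preserves_cokers L.
Proof.
move=> [eta [eps [etaP epsP LT RT]]] X Y Z f q [qf fq].
split; first by rewrite -fmapM qf fmap0.
have tr E W (v : mor (L W) E) : eps E ∘ fmap L (fmap R v ∘ eta W) = v.
  by rewrite fmapM cmpA -epsP -cmpA LT cmpm1.
move=> E h hf; have [|u [eu uu]] := fq _ (fmap R h ∘ eta Y).
  by rewrite -cmpA etaP cmpA -fmapM hf fmap0 cmp0m.
exists (eps E ∘ fmap L u); split; first by rewrite -cmpA -fmapM eu tr.
move=> v ev; rewrite (uu (fmap R v ∘ eta Z)) ?tr //.
by rewrite -cmpA etaP cmpA -fmapM ev.
Qed.

Lemma adjoint_mono X Y (m : mor X Y) : adjoint L R -> mono m -> mono (fmap R m).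
Proof.
move=> [eta [eps [etaP epsP LT RT]]] mm W g h e.
have tr E V (v : mor V (R E)) : fmap R (eps E ∘ fmap L v) ∘ eta V = v.
  by rewrite fmapM -cmpA -etaP cmpA RT cmp1m.
rewrite -[g]tr -[h]tr; congr (fmap R _ ∘ _); apply: mm.
by rewrite !cmpA epsP -!cmpA -!fmapM e.
Qed.

Lemma adjoint_iso (R' : functor D A) (s : nat_trans R R') (t : nat_trans R' R) :
  (forall Y, t Y ∘ s Y = idm _) -> (forall Y, s Y ∘ t Y = idm _) ->
  adjoint L R -> adjoint L R'.
Proof.
move=> ts st [eta [eps [etaP epsP LT RT]]].
exists (fun X => s (L X) ∘ eta X), (fun Y => eps Y ∘ fmap L (t Y)); split.
- by move=> X X' f; rewrite -cmpA etaP !cmpA ntrP.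
- by move=> Y Y' g; rewrite cmpA epsP -!cmpA -!fmapM ntrP.
- by move=> X; rewrite fmapM cmpA -[_ ∘ fmap L (t _) ∘ _]cmpA -fmapM ts fmap1 cmpm1 LT.
- move=> Y; rewrite cmpA -ntrP fmapM -cmpA -cmpA -etaP [fmap R _ ∘ _]cmpA RT.
  by rewrite cmp1m st.
Qed.

End Adjunctions.

Section ArrowEqualities.
Variables (k : closedFieldType) (C D : klincat k).

Lemma arrow_eqm_l (A B B' : C) (e : B = B') (f : mor A B) :
  Arrow (eqm e ∘ f) = Arrow f.
Proof. by case: _ / e; rewrite cmp1m. Qed.

Lemma arrow_eqm_r (A A' B : C) (e : A' = A) (f : mor A B) :
  Arrow (f ∘ eqm e) = Arrow f.
Proof. by case: _ / e f => f; rewrite cmpm1. Qed.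

Lemma arrow_cmp (A B E A' B' E' : C) (g : mor B E) (f : mor A B)
    (g' : mor B' E') (f' : mor A' B') :
  Arrow g = Arrow g' -> Arrow f = Arrow f' -> Arrow (g ∘ f) = Arrow (g' ∘ f').
Proof.
move=> eg ef; have eA := congr1 (@asrc _ _) ef; have eB := congr1 (@atgt _ _) ef.
have eE := congr1 (@atgt _ _) eg; rewrite /= in eA eB eE.
case: _ / eA in f' ef *; case: _ / eB in f' g' ef eg *; case: _ / eE in g' eg *.
by rewrite (arrow_inj eg) (arrow_inj ef).
Qed.

Lemma arrow_fmap (F : functor C D) (A B A' B' : C) (f : mor A B) (f' : mor A' B') :
  Arrow f = Arrow f' -> Arrow (fmap F f) = Arrow (fmap F f').
Proof.
move=> e; exact (congr1 (fun x : arrow C => Arrow (fmap F (amor x))) e).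
Qed.

End ArrowEqualities.

Section Action.
Variables (k : closedFieldType) (C : cat2 k) (M : two_rep C).

Lemma ract_ob1 i (X : M i) : ract M (id1 i) X = X.
Proof. exact (congr1 (@asrc _ _) (ract_id1 (idm X))). Qed.

Lemma ract_obM i j l (G : hcat C j l) (F : hcat C i j) (X : M i) :
  ract M (G ⊙ F) X = ract M G (ract M F X).
Proof. exact (congr1 (@asrc _ _) (ract_hc1 G F (idm X))). Qed.

Lemma ract2_eqm i j (F G : hcat C i j) (e : F = G) X :
  ract2 M (eqm e) X = eqm (congr1 (fun H => ract M H X : M j) e).
Proof. by case: _ / e; rewrite ract2_id. Qed.

Variables (i j : C) (F : hcat C i j) (Fs : hcat C j i).
Variables (al : mor (F ⊙ Fs) (id1 j)) (be : mor (id1 i) (Fs ⊙ F)).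
Hypothesis tri1 : eqm (hc11l F) ∘ (al ⊛ idm F) ∘ eqm (hc1A F Fs F)
      ∘ (idm F ⊛ be) ∘ eqm (esym (hc11r F)) = idm F.
Hypothesis tri2 : eqm (hc11r Fs) ∘ (idm Fs ⊛ al) ∘ eqm (esym (hc1A Fs F Fs))
      ∘ (be ⊛ idm Fs) ∘ eqm (esym (hc11l Fs)) = idm Fs.

Let eta X : mor X (ract M Fs (ract M F X)) :=
  eqm (ract_obM Fs F X) ∘ ract2 M be X ∘ eqm (esym (ract_ob1 X)).
Let eps Y : mor (ract M F (ract M Fs Y)) Y :=
  eqm (ract_ob1 Y) ∘ ract2 M al Y ∘ eqm (esym (ract_obM F Fs Y)).

Let eta_arrow X : Arrow (eta X) = Arrow (ract2 M be X).
Proof. by rewrite arrow_eqm_r arrow_eqm_l. Qed.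
Let eps_arrow Y : Arrow (eps Y) = Arrow (ract2 M al Y).
Proof. by rewrite arrow_eqm_r arrow_eqm_l. Qed.

(** The triangle identities of the 2-category are evaluated at objects. Comparing arrows instead of
    morphisms absorbs the [eqm] coercions. *)
Lemma ract_adjoint : adjoint (ract M F) (ract M Fs).
Proof.
exists eta, eps; split.
- move=> X X' f; apply: arrow_inj.
  transitivity (Arrow (ract2 M be X' ∘ fmap (ract M (id1 i)) f)).
    by apply: arrow_cmp; [exact: eta_arrow | rewrite ract_id1].
  by rewrite ntrP; apply: arrow_cmp; [exact: ract_hc1 | rewrite eta_arrow].
- move=> Y Y' g; apply: arrow_inj.
  transitivity (Arrow (fmap (ract M (id1 j)) g ∘ ract2 M al Y)).
    by apply: arrow_cmp; [rewrite ract_id1 | exact: eps_arrow].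
  by rewrite -ntrP; apply: arrow_cmp; [rewrite eps_arrow | exact: ract_hc1].
- move=> X; apply: arrow_inj; rewrite -ract2_id -tri1 !ract2_cmp.
  rewrite !ract2_eqm arrow_eqm_r; apply: arrow_cmp; last first.
    by rewrite ract2_hc2 ract2_id cmp1m; apply: arrow_fmap; exact: eta_arrow.
  by rewrite arrow_eqm_r arrow_eqm_l ract2_hc2 ract2_id fmap1 cmpm1 eps_arrow.
- move=> Y; apply: arrow_inj; rewrite -ract2_id -tri2 !ract2_cmp.
  rewrite !ract2_eqm arrow_eqm_r; apply: arrow_cmp; last first.
    by rewrite ract2_hc2 ract2_id fmap1 cmpm1 eta_arrow.
  rewrite arrow_eqm_r arrow_eqm_l ract2_hc2 ract2_id cmp1m.
  by apply: arrow_fmap; exact: eps_arrow.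
Qed.

End Action.

Section FiatAction.
Variables (k : closedFieldType) (C : cat2 k) (M : two_rep C).
Hypothesis fiC : has_fiat_involution C.

(** The adjunction for F* makes F** right adjoint to F*, and F** is isomorphic to F through
    [inv_om]. *)
Lemma ract_star i j (F : hcat C i j) : exists Fs : hcat C j i,
  adjoint (ract M F) (ract M Fs) /\ adjoint (ract M Fs) (ract M F).
Proof.
have [I IA] := fiC; exists (inv1 I F).
have adj l m (G : hcat C l m) : adjoint (ract M G) (ract M (inv1 I G)).
  by have [al [be [t1 t2]]] := IA _ _ G; exact: ract_adjoint t1 t2.
split; first exact: adj.
apply: (adjoint_iso (s := ract2 M (inv_omV I F)) (t := ract2 M (inv_om I F)));
  last exact: adj.
- by move=> Y; rewrite -ract2_cmp inv_omVK ract2_id.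
- by move=> Y; rewrite -ract2_cmp inv_omK ract2_id.
Qed.

Lemma ract_preserves_cokers i j (F : hcat C i j) : preserves_cokers (ract M F).
Proof. by have [Fs [/adjoint_preserves_cokers]] := ract_star F. Qed.

Lemma ract_mono i j (F : hcat C i j) (X Y : M i) (m : mor X Y) :
  mono m -> mono (fmap (ract M F) m).
Proof. by have [Fs [_ adj]] := ract_star F; exact: adjoint_mono adj. Qed.

End FiatAction.

Lemma coker_unique (k : closedFieldType) (C : klincat k) (X Y Z Z' : C)
    (f : mor X Y) (p : mor Y Z) (q : mor Y Z') :
  is_coker f p -> is_coker f q ->
  exists u v, [/\ u ∘ p = q, v ∘ q = p, v ∘ u = idm Z & u ∘ v = idm Z'].
Proof.
move=> fp fq; have [u [eu _]] := fp.2 _ q fq.1; have [v [ev _]] := fq.2 _ p fp.1.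
exists u, v; split=> //.
  by apply: (coker_epi fp); rewrite -cmpA eu ev cmp1m.
by apply: (coker_epi fq); rewrite -cmpA ev eu cmp1m.
Qed.

(** * Generation by an object *)

Section Presentations.
Variables (k : closedFieldType) (C : cat2 k) (fin : finitary C).
Variables (M : two_rep C) (i : C) (X : M i).

(** The first half says that [A] is the value of Coker(a) at [X]. The second, a kernel condition on
    2-morphisms, is what completes a 2-morphism between targets to a square. *)
Definition hat_pres j (A : M j) (a : hat1 i j) (th : mor (ract M (atgt a) X) A) : Prop :=
  is_coker (ract2 M (amor a) X) th /\
  forall F (x : mor F (atgt a)), th ∘ ract2 M x X = 0 -> exists x', x = amor a ∘ x'.

(** A morphism between two presented objects lifts to a 2-morphism [g] between the targets of the
    presentations. The class [good] records the 1-morphisms for which such lifts are available. *)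
Lemma generates_of_pres (good : forall j, hcat C i j -> Prop) :
  (forall j (A : M j), exists (a : hat1 i j) (th : mor (ract M (atgt a) X) A),
     good j (atgt a) /\ hat_pres th) ->
  (forall j (A : M j) (F : hcat C i j) (b : hat1 i j)
     (th : mor (ract M (atgt b) X) A), good j F -> good j (atgt b) -> hat_pres th ->
     forall f : mor (ract M F X) A,
       exists g : mor F (atgt b), f = th ∘ ract2 M g X) ->
  generates fin M X.
Proof.
move=> pres lift j A B.
have [a [thA [ga aP]]] := pres j A; have [b [thB [gb bP]]] := pres j B.
have fa := coker_mapP (@rcok _ _ M j) (ract2 M (amor a) X).
have fb := coker_mapP (@rcok _ _ M j) (ract2 M (amor b) X).
have [ua [va [_ _ vua uva]]] := coker_unique fa aP.1.
have [ub [vb [eub evb vub uvb]]] := coker_unique fb bP.1.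
exists a, b; split; [by exists ua, va | by exists ub, vb | move=> f].
have [g eg] := lift j B _ b thB ga gb bP
  (ub ∘ f ∘ coker_map (@rcok _ _ M j) (ract2 M (amor a) X)).
(* [g ∘ amor a] vanishes in [B], hence factors through [amor b]; this gives the other side of the
   square. *)
have [|g' eg'] := bP.2 _ (g ∘ amor a).
  by rewrite ract2_cmp cmpA -eg -cmpA fa.1 cmpm0.
pose p : square a b := mk_square eg'.
have tP : exists q : square a b, forall l Y,
    hat_nat (principal fin l) p Y = hat_nat (principal fin l) q Y by exists p.
exists (Hat2 tP); rewrite (hat_act2E (p := p)) //.
apply: (coker_epi fa); rewrite hat_natE /= -evb -cmpA -eg !cmpA vub.
by rewrite -[in RHS](cmp1m f).
Qed.

End Presentations.

(** * The unit generates the principal 2-representation *)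

Section UnitObject.
Variables (k : closedFieldType) (C : cat2 k) (fin : finitary C) (i : C).
Let PP := principal fin i.
Let P1 : PP i := proj_ob fin (id1 i).

Lemma hc21r_eqm j (F G : hcat C i j) (x : mor F G) :
  x ⊛ idm (id1 i) = eqm (esym (hc11r G)) ∘ x ∘ eqm (hc11r F).
Proof. by apply: arrow_inj; rewrite arrow_eqm_r arrow_eqm_l hc21r. Qed.

Lemma principal_projgen j : projgen (@bar_proj k (hcat C i j)).
Proof. exact: bar_projgen (fin_hom fin i j). Qed.

Lemma bar_proj_ract j l (F : hcat C j l) (Q : PP j) :
  bar_proj Q -> bar_proj (ract PP F Q : barcat (hcat C i l)).
Proof. by rewrite /bar_proj /= => ->; exact: (fmap0 (lcomp i F)). Qed.

Lemma bar_proj_unit j (F : hcat C i j) : bar_proj (ract PP F P1 : barcat (hcat C i j)).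
Proof. exact: bar_proj_ract. Qed.

Lemma ract2_bar_pt j (F G : hcat C i j) (x : mor F G) :
  ract2 PP x P1 = bar_pt (X := ract PP G P1 : barcat (hcat C i j))
    (bar_proj_unit F) (x ⊛ idm (id1 i)).
Proof. exact: bar_ptE. Qed.

Lemma ract2_unit_full j (F G : hcat C i j) (x : mor (ract PP F P1) (ract PP G P1)) :
  exists g, x = ract2 PP g P1.
Proof.
have [y ->] := bar_pt_surj (bar_proj_unit F) x.
exists (eqm (hc11r G) ∘ y ∘ eqm (esym (hc11r F))).
rewrite ract2_bar_pt; congr bar_pt; apply: arrow_inj.
by rewrite hc21r arrow_eqm_r arrow_eqm_l.
Qed.

Definition unit_cover j (A : PP j) : mor (ract PP (atgt A) P1) A :=
  bar_pt (bar_proj_unit (atgt A)) (eqm (hc11r (atgt A))).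

Lemma unit_cover_pt j (A : PP j) (Q : PP j) (PQ : bar_proj Q)
    (y : mor (atgt Q) (atgt A ⊙ id1 i)) :
  unit_cover A ∘ bar_pt (X := ract PP (atgt A) P1 : barcat (hcat C i j)) PQ y =
  bar_pt PQ (eqm (hc11r (atgt A)) ∘ y).
Proof. exact: bar_pt_comp. Qed.

(** An object of the abelianization is a diagram of 1-morphisms, hence already the [hat1] that
    produces it from P_1; only the identification of [F ⊙ id1 i] with [F] has to be carried
    along. *)
Lemma unit_cover_pres j (A : PP j) : hat_pres (a := A) (unit_cover A).
Proof.
split; last first.
  move=> F x; rewrite ract2_bar_pt unit_cover_pt => /bar_pt_eq0[z ez].
  exists (z ∘ eqm (esym (hc11r F))); rewrite cmpA ez hc21r_eqm !cmpA.
  by rewrite eqmVK cmp1m -cmpA eqmVK cmpm1.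
apply: (exact_coker (principal_projgen j)).
- rewrite ract2_bar_pt unit_cover_pt; apply/bar_pt_eq0.
  exists (eqm (hc11r (asrc A))); rewrite hc21r_eqm !cmpA eqmVK cmp1m //.
- move=> Q z PQ; have [y ->] := bar_pt_surj PQ z.
  exists (bar_pt (X := ract PP (atgt A) P1 : barcat (hcat C i j)) PQ
    (eqm (esym (hc11r (atgt A))) ∘ y)).
  by rewrite unit_cover_pt cmpA eqmVK cmp1m.
- move=> Q z PQ; have [y ->] := bar_pt_surj PQ z.
  rewrite unit_cover_pt => /bar_pt_eq0[x ex].
  exists (bar_pt (X := ract PP (asrc A) P1 : barcat (hcat C i j)) PQ
    (eqm (esym (hc11r (asrc A))) ∘ x)).
  rewrite ract2_bar_pt [RHS]bar_pt_comp; congr bar_pt.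
  rewrite hc21r_eqm !cmpA -[_ ∘ eqm (hc11r (asrc A)) ∘ _]cmpA eqmVK cmpm1.
  by rewrite -cmpA ex cmpA eqmK cmp1m.
Qed.

Lemma principal_generated : generates fin PP P1.
Proof.
apply: (@generates_of_pres _ _ _ _ _ _ (fun _ _ => True)).
  by move=> j A; exists A, (unit_cover A); split=> //; exact: unit_cover_pres.
move=> j A F b th _ _ [thC _] f.
have [x ->] := pg_lift (principal_projgen j) thC f (bar_proj_unit F).
by have [g ->] := ract2_unit_full x; exists g.
Qed.

End UnitObject.

Section Evaluation.
Variables (k : closedFieldType) (C : cat2 k) (M : two_rep C) (i j : C) (X : M i).

Definition evaluation : functor (hcat C i j) (M j) :=
  @Functor _ (hcat C i j) (M j) (fun F => ract M F X) (fun F G a => ract2 M a X)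
    (fun F => ract2_id F X) (fun F G H b a => ract2_cmp b a X)
    (fun F G => @ract2_lin _ _ M i j F G X).

Lemma ract_retract (F G : hcat C i j) :
  retract F G -> retract (ract M F X) (ract M G X).
Proof. exact: (retract_fmap evaluation). Qed.

Lemma ract_zero_retract (F G : hcat C i j) :
  retract F G -> is_zero (ract M G X) -> is_zero (ract M F X).
Proof.
move=> /ract_retract [f [g gf]] G0.
by rewrite /is_zero -gf [f]zero_mor_r // cmpm0.
Qed.

End Evaluation.

(** * The right preorder *)

Section RightOrder.
Variables (k : closedFieldType) (C : cat2 k) (fin : finitary C).

Lemma retract_refl (D : klincat k) (A : D) : retract A A.
Proof. by exists (idm A), (idm A); rewrite cmp1m. Qed.

(** Idempotents split, so a retract of [H ⊙ F] is a direct summand. *)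
Lemma leRP i j l (F : hcat C i j) (G : hcat C i l) :
  leR F G <-> exists H : hcat C j l, retract G (H ⊙ F).
Proof.
split=> [[H /dsummand_retract]|[H]]; first by exists H.
by exists H; apply: retract_dsummand => //; exact: fc_karoubian (fin_hom fin i l).
Qed.

Lemma leR_refl i j (F : hcat C i j) : leR F F.
Proof. by apply/leRP; exists (id1 j); rewrite hc11l; exact: retract_refl. Qed.

Lemma leR_trans i j l m (F : hcat C i j) (G : hcat C i l) (H : hcat C i m) :
  leR F G -> leR G H -> leR F H.
Proof.
move=> /leRP[X FG] /leRP[Y GH]; apply/leRP; exists (Y ⊙ X); rewrite -hc1A.
exact: retract_trans GH (retract_fmap (lcomp i Y) FG).
Qed.

End RightOrder.

Section UnitPoints.
Variables (k : closedFieldType) (C : cat2 k) (fin : finitary C) (i : C).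
Let PP := principal fin i.
Let P1 : PP i := proj_ob fin (id1 i).

Lemma ract2_unit_inj j (F G : hcat C i j) (x y : mor F G) :
  ract2 PP x P1 = ract2 PP y P1 -> x = y.
Proof.
rewrite !ract2_bar_pt => /bar_cl_eq[z]; rewrite /= [X in X ∘ z](bar_proj_unit fin G) cmp0m.
move=> /esym/subr0_eq e; apply: arrow_inj.
by rewrite -[LHS]hc21r -[RHS]hc21r e.
Qed.

(* A nonzero quotient of the projective F P_1, F indecomposable, detects
   automorphisms of F P_1, as F has a local endomorphism ring. *)
Lemma local_unit j (F : hcat C i j) (X : PP j) (s : mor (ract PP F P1) X)
    (u : mor (ract PP F P1) (ract PP F P1)) :
  indecomposable F -> s <> 0 -> s ∘ u = s -> is_unit u.
Proof.
move=> Fi s0; have [a ->] := ract2_unit_full u => su.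
have [[b [ba ab]]|[b [ba ab]]] := finitary_local (fin_hom fin i j) a Fi.
  by exists (ract2 PP b P1); rewrite -!ract2_cmp ba ab !ract2_id.
case: s0; rewrite -[s]cmpm1 -(ract2_id (t := PP) F) -ab ract2_cmp cmpA.
have -> : ract2 PP (idm F - a) P1 = idm _ - ract2 PP a P1.
  by rewrite [LHS](fmapB (evaluation j P1)) [X in X - _](ract2_id (t := PP)).
by rewrite cmpBr cmpm1 su subrr cmp0m.
Qed.

(** The endomorphism [g ∘ f] fixes [s], so [local_unit] inverts it and [f] is a split
    monomorphism. *)
Lemma unit_retract j (F H : hcat C i j) (X : PP j) (s : mor (ract PP F P1) X)
    (t : mor (ract PP H P1) X) f g :
  indecomposable F -> s <> 0 -> t ∘ f = s -> s ∘ g = t -> retract F H.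
Proof.
move=> Fi s0; have [a ->] := ract2_unit_full f; have [b ->] := ract2_unit_full g.
move=> ts st; have [|v [vu uv]] := local_unit (u := ract2 PP (b ∘ a) P1) Fi s0.
  by rewrite ract2_cmp cmpA st.
have [c ec] := ract2_unit_full v; exists a, (c ∘ b); apply: ract2_unit_inj.
by rewrite -cmpA ract2_cmp ract2_id -ec.
Qed.

End UnitPoints.

(** * The projectives F L of a cell 2-representation *)

Section CellProjectives.
Variables (k : closedFieldType) (C : cat2 k) (fin : finitary C).
Hypothesis fiC : has_fiat_involution C.
Variable i : C.
Let PP := principal fin i.
Let P1 : PP i := proj_ob fin (id1 i).
Local Notation "F • X" := (ract PP F X) (at level 35, right associativity).

Variables (K Q L U : PP i) (kap : mor K P1) (q : mor P1 Q) (r : mor U K) (p : mor K L).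
Hypotheses (kap_mono : mono kap) (kap_q : is_coker kap q) (r_p : is_coker r p).

Let PG j := principal_projgen fin i j.
Let proj1 j (F : hcat C i j) : bar_proj (F • P1 : barcat (hcat C i j)) :=
  bar_proj_unit fin F.

Definition kills_quot j (F : hcat C i j) : Prop := is_zero (F • Q).

Lemma kills_quot_comp j l (N : hcat C j l) (F : hcat C i j) :
  kills_quot F -> kills_quot (N ⊙ F).
Proof. by rewrite /kills_quot ract_obM; exact: is_zero_fmap. Qed.

Lemma kills_quot_retract j (F H : hcat C i j) :
  retract F H -> kills_quot H -> kills_quot F.
Proof. exact: ract_zero_retract. Qed.

Lemma kap_iso j (F : hcat C i j) : kills_quot F ->
  exists g, g ∘ fmap (ract PP F) kap = idm (F • K) /\
            fmap (ract PP F) kap ∘ g = idm (F • P1).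
Proof.
apply: (coker_zero_iso (PG j)); first exact: (ract_mono fiC kap_mono).
exact: (ract_preserves_cokers fiC F kap_q).
Qed.

Fact eps_subproof j (F : hcat C i j) : kills_quot F ->
  exists e : mor (F • P1) (F • L), e ∘ fmap (ract PP F) kap = fmap (ract PP F) p.
Proof.
move=> /kap_iso[g [gk _]]; exists (fmap (ract PP F) p ∘ g).
by rewrite -cmpA gk cmpm1.
Qed.

(* F P_1 <- F K -> F L, where the first map is invertible if F kills P_1 / K. *)
Definition eps j (F : hcat C i j) (WF : kills_quot F) : mor (F • P1) (F • L) :=
  sval (cid (eps_subproof WF)).

Lemma epsE j (F : hcat C i j) (WF : kills_quot F) :
  eps WF ∘ fmap (ract PP F) kap = fmap (ract PP F) p.
Proof. exact: (svalP (cid (eps_subproof WF))). Qed.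

Lemma eps_epi j (F : hcat C i j) (WF : kills_quot F) : epi (eps WF).
Proof.
move=> X g h e; apply: (coker_epi (ract_preserves_cokers fiC F r_p)).
by rewrite -(epsE WF) !cmpA e.
Qed.

Lemma eps_surj j (F : hcat C i j) (WF : kills_quot F) :
  surj (@bar_proj _ (hcat C i j)) (eps WF).
Proof. exact: (epi_surj (PG j) (@eps_epi _ _ WF)). Qed.

(** By projectivity [x] lifts to [H K]; followed by the inclusion into [H P_1], the lift is the
    value of a 2-morphism [g]. Naturality along [kap] and [p] then transfers [g] to [L]. *)
Lemma eps_full j (F H : hcat C i j) (WF : kills_quot F) (x : mor (F • P1) (H • L)) :
  exists g, x = ract2 PP g L ∘ eps WF.
Proof.
have [y ey] := pg_lift (PG j) (ract_preserves_cokers fiC H r_p) x (proj1 F).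
have [g eg] := ract2_unit_full (fmap (ract PP H) kap ∘ y).
have [v [_ kv]] := kap_iso WF; exists g.
rewrite -[x]cmpm1 -[_ ∘ eps WF]cmpm1 -kv !cmpA; congr (_ ∘ v).
rewrite -[ract2 PP g L ∘ _ ∘ _]cmpA epsE ntrP ey -!cmpA; congr (_ ∘ _).
apply: (ract_mono (F := H) fiC kap_mono).
by rewrite cmpA eg ntrP.
Qed.

Lemma eps_factor j (F H : hcat C i j) (WF : kills_quot F) (x : mor (F • L) (H • L)) :
  exists g, x = ract2 PP g L.
Proof.
have [g eg] := eps_full WF (x ∘ eps WF); exists g.
exact: (@eps_epi _ _ WF).
Qed.

Variable G : hcat C i i.
Hypotheses (L_simple : simple L) (G_indec : indecomposable G).
Variable e : mor (G • P1) L.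
Hypothesis e0 : e <> 0.

Lemma e_surj : surj (@bar_proj _ (hcat C i i)) e.
Proof. exact: (simple_surj (PG i) L_simple e0). Qed.

Lemma eps_neq0 j (F : hcat C i j) (WF : kills_quot F) :
  ~ is_zero (F • L) -> eps WF <> 0.
Proof.
move=> FL0 e0'; apply: FL0; apply: (@eps_epi _ _ WF).
by rewrite e0' !cmpm0.
Qed.

(* Hom(F P_1, F L) = Hom(F* F P_1, L) is nonzero, so that P_G is a summand of F* F P_1. *)
Lemma top_above j (F : hcat C i j) :
  kills_quot F -> ~ is_zero (F • L) -> exists N, retract G (N ⊙ F).
Proof.
move=> WF FL0; have [Fs [_ [eta [ep [etaP epP LT RT]]]]] := ract_star PP fiC F.
exists Fs.
pose t : mor (Fs • F • P1) L := ep L ∘ fmap (ract PP Fs) (eps WF).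
have t0 : t <> 0.
  move=> t0; apply: (eps_neq0 FL0 (WF := WF)).
  have : fmap (ract PP F) t ∘ eta (F • P1) = eps WF.
    by rewrite fmapM -cmpA -etaP cmpA RT cmp1m.
  by move=> <-; rewrite t0 fmap0 cmp0m.
pose t' : mor ((Fs ⊙ F) • P1) L := t ∘ eqm (ract_obM Fs F P1).
have t'0 : t' <> 0.
  move=> t'0; apply: t0; rewrite -[t]cmpm1 -(eqmVK (ract_obM Fs F P1)) cmpA.
  by rewrite -/t' t'0 cmp0m.
have [g eg] := simple_surj (PG i) L_simple t'0 e (proj1 G).
have [f ef] := e_surj t' (proj1 (Fs ⊙ F)).
exact: (unit_retract G_indec e0 (esym eg) (esym ef)).
Qed.

(** [F L] is a quotient of [F P_1] and, [F] being exact, of [F G P_1]. Each of the two covers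
    factors through the other, so [unit_retract] applies. *)
Lemma top_below j (F : hcat C i j) : indecomposable F ->
  kills_quot F -> ~ is_zero (F • L) -> retract F (F ⊙ G).
Proof.
move=> Fi WF FL0; have [V [v vP]] := surj_coker (PG i) e_surj.
have tP := ract_preserves_cokers (M := PP) fiC F vP.
pose t : mor ((F ⊙ G) • P1) (F • L) := fmap (ract PP F) e ∘ eqm (ract_obM F G P1).
have [f ef] := pg_lift (PG j) tP (eps WF) (proj1 F).
have [g eg] := eps_surj WF t (proj1 (F ⊙ G)).
apply: (unit_retract Fi (eps_neq0 FL0) (t := t) (f := eqm (esym (ract_obM F G P1)) ∘ f)
  _ (esym eg)).
by rewrite /t -cmpA [eqm _ ∘ (_ ∘ _)]cmpA eqmVK cmp1m.
Qed.

(** If [e] did not vanish on the kernel [v] of [eps WG], then [e = e ∘ v ∘ y] for some [y]; locality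
    would make [v ∘ y] invertible and [eps WG] zero. *)
Lemma top_map (WG : kills_quot G) : ~ is_zero (G • L) ->
  exists2 pi : mor (G • L) L, pi <> 0 & pi ∘ eps WG = e.
Proof.
move=> GL0; have [V [v vP]] := surj_coker (PG i) (eps_surj WG).
have ev : e ∘ v = 0.
  apply: contrapT => /(simple_surj (PG i) L_simple)/(_ _ e (proj1 G))[y ey].
  have [|b [_ bu]] := local_unit (u := v ∘ y) G_indec e0; first by rewrite cmpA -ey.
  apply: (eps_neq0 GL0 (WF := WG)).
  by rewrite -[eps WG]cmpm1 -bu !cmpA vP.1 !cmp0m.
have [pi [epi _]] := vP.2 _ e ev; exists pi => // pi0.
by apply: e0; rewrite -epi pi0 cmp0m.
Qed.

(** Lift [e] along [pi ∘ x] to some [y]. Then [x ∘ y] comes from an endomorphism [u] of [G P_1]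
    fixing [e], which is invertible by locality; correcting [y] by its inverse gives the section. *)
Lemma top_split (WG : kills_quot G) (pi : mor (G • L) L) (F : hcat C i i)
    (x : mor (F • L) (G • L)) : pi ∘ eps WG = e -> kills_quot F ->
  pi ∘ x <> 0 -> exists s, x ∘ s = idm (G • L).
Proof.
move=> epi WF /(simple_surj (PG i) L_simple)/(_ _ e (proj1 G))[y ey].
have [g eg] := eps_full WG y.
have [u eu] := eps_surj WG (x ∘ y) (proj1 G).
have [|v [_ uv]] := local_unit (u := u) G_indec e0.
  by rewrite -{1}epi -cmpA -eu cmpA -ey.
have [h eh] := eps_full WG (y ∘ v); exists (ract2 PP h L).
apply: (@eps_epi _ _ WG).
by rewrite -cmpA -eh cmpA eu -cmpA uv cmpm1 cmp1m.
Qed.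

End CellProjectives.

Section FullSubcategories.
Variables (k : closedFieldType) (C : klincat k) (P : C -> Prop).

Lemma fullsub_coker (X Y Z : fullsub P) (f : mor X Y) (q : mor Y Z) :
  @is_coker k C (sval X) (sval Y) (sval Z) f q -> is_coker f q.
Proof. by move=> [qf fq]; split=> // E h; exact: (fq (sval E)). Qed.

Lemma fullsub_thru (Q : C -> Prop) (X Y : fullsub P) (h : @mor k C (sval X) (sval Y)) :
  (forall A, Q A -> P A) -> thru Q h ->
  @thru k (fullsub P) (fun A => Q (sval A)) X Y h.
Proof.
move=> QP; elim=> [|A a b h' QA _ IH]; first exact: thru0.
exact: (@thruS k (fullsub P) (fun A => Q (sval A)) X Y
  (exist _ A (QP A QA)) a b h' QA IH).
Qed.

End FullSubcategories.

Lemma is_coker_iso (k : closedFieldType) (C : klincat k) (X Y Z Z' : C)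
    (f : mor X Y) (q : mor Y Z) (q' : mor Y Z') u v :
  is_coker f q -> u ∘ q = q' -> v ∘ q' = q -> u ∘ v = idm Z' -> is_coker f q'.
Proof.
move=> fq uq vq uv; have qe := coker_epi fq; case: fq => qf fq.
split; first by rewrite -uq -cmpA qf cmpm0.
move=> E h /fq[w [ew _]]; exists (w ∘ v); split; first by rewrite -cmpA vq.
move=> w' ew'; rewrite -[w']cmpm1 -uv cmpA; congr (_ ∘ v).
by apply: qe; rewrite ew -cmpA uq.
Qed.

(** * The cell 2-representation *)

Section CellCategory.
Variables (k : closedFieldType) (C : cat2 k) (fin : finitary C).
Hypothesis fiC : has_fiat_involution C.
Variable I : forall i j : C, hcat C i j -> Prop.
Hypothesis HI : complete_indec I.
Variable i : C.
Variable R : forall j : C, hcat C i j -> Prop.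
Hypothesis HR : right_cell I R.
Let PP := principal fin i.
Let P1 : PP i := proj_ob fin (id1 i).
Local Notation "F • X" := (ract PP F X) (at level 35, right associativity).

Variables (K Q L U : PP i) (kap : mor K P1) (q : mor P1 Q) (r : mor U K) (p : mor K L).
Hypotheses (kap_mono : mono kap) (kap_q : is_coker kap q) (r_p : is_coker r p).
Variable G : hcat C i i.
Hypotheses (L_simple : simple L) (IG : I G).
Variable e : mor (G • P1) L.
Hypothesis e0 : e <> 0.
Let W j (F : hcat C i j) := kills_quot Q F.
Hypothesis RW : forall j (F : hcat C i j), R F -> W F.
Hypothesis Rnz : forall j (F : hcat C i j), R F -> ~ is_zero (F • L).

Let PG j := principal_projgen fin i j.
Let proj1 j (F : hcat C i j) : bar_proj (F • P1 : barcat (hcat C i j)) :=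
  bar_proj_unit fin F.
Let ep j (F : hcat C i j) (WF : W F) := eps fiC p kap_mono kap_q WF.
Let ep_epi j (F : hcat C i j) (WF : W F) : epi (ep WF) :=
  @eps_epi _ _ _ _ _ _ _ _ _ _ _ _ _ _ _ r_p _ _ WF.
Let I_indec j (F : hcat C i j) : I F -> indecomposable F.
Proof. by case: HI => h _ _; exact: h. Qed.
Let G_indec := I_indec IG.

Lemma right_cell_indec j (F : hcat C i j) : R F -> I F.
Proof. by have [j0 [F0 [_ RP]]] := HR; move=> /RP[]. Qed.

Lemma leR_top j (F : hcat C i j) : W F -> ~ is_zero (F • L) -> leR F G.
Proof.
move=> WF FL0; apply/(leRP fin).
exact: (top_above fiC kap_mono kap_q r_p L_simple G_indec e0 WF FL0).
Qed.

(** For [F0] in the cell, [top_above] gives one inequality and [top_below], with [F0] a retract of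
    [F0 ⊙ G], the other. *)
Lemma right_cell_top : R G.
Proof.
have [j0 [F0 [IF0 RP]]] := HR.
have RF0 : R F0 by apply/RP; split=> //; exact: leR_refl.
apply/RP; split=> //; first exact: leR_top (RW RF0) (Rnz RF0).
apply/(leRP fin); exists F0.
apply: (top_below fiC kap_mono kap_q r_p L_simple e0 _ (RW RF0) (Rnz RF0)).
exact: I_indec.
Qed.

(** [leR_top] brings [H] back below [G], which belongs to the cell. *)
Lemma right_cell_above j l (F : hcat C i j) (H : hcat C i l) :
  R F -> I H -> leR F H -> ~ is_zero (H • L) -> R H.
Proof.
move=> RF IH /[dup] FH /(leRP fin)[N NH] HL0.
have WH : W H by apply: kills_quot_retract NH _; exact/kills_quot_comp/RW.
have HG := leR_top WH HL0.
have [j0 [F0 [IF0 RP]]] := HR.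
have [_ F0F _] := (RP _ _).1 RF; have [_ _ GF0] := (RP _ _).1 right_cell_top.
by apply/RP; split=> //; [exact: leR_trans F0F FH | exact: leR_trans HG GF0].
Qed.

(* F L is then projective in the cell 2-representation; the indecomposable summands of
   F need not all be in R, but those outside R kill L. *)
Definition cell_cover j (F : hcat C i j) : Prop :=
  W F /\ thru (@cell_gen _ _ fin i R L j) (idm (F • L)).

Definition cell_proj j (Y : PP j) : Prop := exists2 F, cell_cover F & Y = F • L.

Lemma cell_gen_id j (F : hcat C i j) : R F ->
  thru (@cell_gen _ _ fin i R L j) (idm (F • L)).
Proof. by move=> RF; rewrite -(cmp1m (idm _)); apply: thru1; exists F. Qed.

Lemma cell_cover_cell j (F : hcat C i j) : R F -> cell_cover F.
Proof. by move=> RF; split; [exact: RW | exact: cell_gen_id]. Qed.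

Lemma cell_cover_zero j : exists2 F : hcat C i j, cell_cover F & is_zero F.
Proof.
have [[Z Z0] _] := fc_additive (fin_hom fin i j); exists Z => //; split.
  exact: (is_zero_fmap (evaluation (M := PP) j Q) Z0).
by rewrite (is_zero_fmap (evaluation (M := PP) j L) Z0 : idm (Z • L) = 0); exact: thru0.
Qed.

Lemma cell_cover_sum j (F H : hcat C i j) : cell_cover F -> cell_cover H ->
  exists2 S, cell_cover S & is_biprod F H S.
Proof.
move=> [WF tF] [WH tH]; have [_ /(_ F H)[S bi]] := fc_additive (fin_hom fin i j).
exists S => //; split.
  have := biprod_thru (biprod_fmap (evaluation (M := PP) j Q) bi).
  move=> h; apply: thru_is_zero; apply: h.
    by rewrite [idm _](WF : idm (F • Q) = 0); exact: thru0.
  by rewrite [idm _](WH : idm (H • Q) = 0); exact: thru0.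
exact: biprod_thru (biprod_fmap (evaluation (M := PP) j L) bi) tF tH.
Qed.

(** For [H] in the cell, an indecomposable summand of [N ⊙ H] lies above [H]: it is in the cell up
    to isomorphism, or kills [L] by [right_cell_above]. *)
Lemma cell_cover_comp j l (N : hcat C j l) (F : hcat C i j) :
  cell_cover F -> cell_cover (N ⊙ F).
Proof.
move=> [WF tF]; split; first exact: kills_quot_comp.
rewrite ract_obM -fmap1.
have tN := thru_fmap (F := ract PP N) (Q' := fun Y => exists2 H, R H & Y = N • H • L) _ tF.
apply: thru_trans (tN _) => [_ [H RH ->]|_ [H RH ->]]; last by exists H.
rewrite -ract_obM.
have := thru_fmap (F := evaluation (M := PP) l L)
  (Q' := fun Y => exists2 A, indecomposable A /\ retract A (N ⊙ H) & Y = A • L)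
  _ (finitary_dec (fin_hom fin i l) (N ⊙ H)).
rewrite fmap1 => tD; apply: thru_trans (tD _) => [_ [A [Ai AN] ->]|A AP]; last by exists A.
have [_ _ /(_ _ _ A Ai)[B IB AB]] := HI.
have [BL0|BL0] := pselect (is_zero (B • L)).
  rewrite [idm _](_ : _ = 0); first exact: thru0.
  exact: ract_zero_retract (iso_retract AB) BL0.
have RB : R B.
  apply: right_cell_above RH IB _ BL0; apply/(leRP fin); exists N.
  exact: retract_trans (iso_retract (iso_sym AB)) AN.
have [f [g gf]] := ract_retract L (iso_retract AB).
by rewrite -gf; apply: thru1; exists B.
Qed.

Lemma cell_proj_zero j : exists2 Z : PP j, cell_proj Z & is_zero Z.
Proof.
have [F TF F0] := cell_cover_zero j; exists (F • L); first by exists F.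
exact: (is_zero_fmap (evaluation (M := PP) j L) F0).
Qed.

Lemma cell_proj_sum j (X Y : PP j) : cell_proj X -> cell_proj Y ->
  exists2 S, cell_proj S & is_biprod X Y S.
Proof.
move=> [F TF ->] [H TH ->]; have [S TS bi] := cell_cover_sum TF TH.
exists (S • L); first by exists S.
exact: (biprod_fmap (evaluation (M := PP) j L) bi).
Qed.

Lemma cell_proj_ract j l (N : hcat C j l) (X : PP j) : cell_proj X -> cell_proj (N • X).
Proof.
move=> [F TF ->]; exists (N ⊙ F); first exact: cell_cover_comp.
by rewrite ract_obM.
Qed.

Lemma cell_proj_gen j (X : PP j) : cell_gen R L X -> cell_proj X.
Proof. by move=> [F RF ->]; exists F => //; exact: cell_cover_cell. Qed.

Lemma cell_proj_in_add j (X : PP j) : cell_proj X -> in_add (@cell_gen _ _ fin i R L j) X.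
Proof.
move=> [F [_ tF] ->].
apply: (thru_in_add _ (cell_proj_zero j) (@cell_proj_sum j) (@cell_proj_gen j) tF).
exact/cokers_karoubian/principal_cok.
Qed.

Lemma in_add_cell_proj j (X : PP j) : in_add (@cell_gen _ _ fin i R L j) X ->
  exists2 Y, cell_proj Y & retract X Y.
Proof.
move=> /in_add_thru tX.
have [Y PY [b [a ba]]] := thru_factor (cell_proj_zero j) (@cell_proj_sum j)
  (thru_sub (@cell_proj_gen j) tX).
by exists Y => //; exists a, b.
Qed.

Lemma cell_obP j (M : PP j) : cell_ob R L M <->
  exists X1 X0 (d : mor X1 X0) (c : mor X0 M),
    [/\ cell_proj X1, cell_proj X0 & is_coker d c].
Proof.
split=> [|[X1 [X0 [d [c [P1' P0' dc]]]]]]; last first.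
  by exists X1, X0, d, c; split=> //; exact: cell_proj_in_add.
move=> [X1 [X0 [d [c [/in_add_cell_proj[Y1 PY1 [i1 [p1 pi1]]]]]]]].
move=> /in_add_cell_proj[Y0 PY0 [i0 [p0 pi0]]] dc.
have [S PS [j1 [j0 [q1 [q0 [qj1 qj0 qj10 qj01 sE]]]]]] := cell_proj_sum PY1 PY0.
(* Besides [d], the relations contain [idm Y0 - i0 ∘ p0], which kills the complement of [X0] in
   [Y0]. *)
pose phi : mor S Y0 := i0 ∘ d ∘ p1 ∘ q1 + (idm Y0 - i0 ∘ p0) ∘ q0.
have phi1 : phi ∘ j1 = i0 ∘ d ∘ p1.
  by rewrite cmpDl -!cmpA qj1 qj01 !cmpm0 addr0 cmpm1.
have phi0 : phi ∘ j0 = idm Y0 - i0 ∘ p0.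
  by rewrite cmpDl -[X in X + _]cmpA -[X in _ + X]cmpA qj10 qj0 cmpm0 add0r cmpm1.
exists S, Y0, phi, (c ∘ p0); split=> //.
split.
  rewrite cmpDr !cmpA -[c ∘ p0 ∘ i0]cmpA pi0 cmpm1 dc.1 !cmp0m add0r.
  by rewrite cmpBr cmpm1 !cmpA -[c ∘ p0 ∘ i0]cmpA pi0 cmpm1 subrr cmp0m.
move=> E h hS.
have hd : h ∘ i0 ∘ d = 0.
  have <- : h ∘ phi ∘ j1 ∘ i1 = h ∘ i0 ∘ d; last by rewrite hS !cmp0m.
  by rewrite -[h ∘ phi ∘ j1]cmpA phi1 !cmpA -[_ ∘ p1 ∘ i1]cmpA pi1 cmpm1.
have he : h = h ∘ i0 ∘ p0.
  by apply/subr0_eq; rewrite -{1}[h]cmpm1 -cmpA -cmpBr -phi0 cmpA hS cmp0m.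
have [u [eu uu]] := dc.2 _ _ hd; exists u; split; first by rewrite cmpA eu -he.
move=> v ev; apply: uu; rewrite -ev -!cmpA pi0 cmpm1 //.
Qed.

Lemma cell_cover_full j (F H : hcat C i j) (x : mor (F • L) (H • L)) :
  cell_cover F -> exists g, x = ract2 PP g L.
Proof. by move=> [WF _]; exact: (eps_factor fiC kap_mono kap_q r_p WF). Qed.

(** Lift [x] to the projective term [H L] of a presentation of [Y] and apply [eps_full]. Thus
    objects of C_R have the same points at [F P_1] as at [F L], and projectivity passes from the
    former to the latter. *)
Lemma cell_extend j (F : hcat C i j) (WF : W F) (Y : PP j) (x : mor (F • P1) Y) :
  cell_ob R L Y -> exists y, x = y ∘ ep WF.
Proof.
move=> /cell_obP[X1 [X0 [d [c [_ [H _ EX0] dc]]]]]; case: _ / (esym EX0) in d c dc *.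
have [y ->] := pg_lift (PG j) dc x (proj1 F).
have [g ->] := eps_full fiC kap_mono kap_q r_p WF y.
by exists (c ∘ ract2 PP g L); rewrite cmpA.
Qed.

Lemma cell_lift j (X Y Z S : PP j) (f : mor X Y) (g : mor Y Z) (z : mor S Z) :
  is_coker f g -> cell_ob R L Y -> cell_proj S -> exists y, z = g ∘ y.
Proof.
move=> fg CY [F [WF _] ES]; case: _ / (esym ES) in z *.
have [y ey] := pg_lift (PG j) fg (z ∘ ep WF) (proj1 F).
have [y' ey'] := cell_extend WF y CY; exists y'; apply: (@ep_epi _ _ WF).
by rewrite ey ey' cmpA.
Qed.

Lemma cell_exact j (X Y Z S : PP j) (f : mor X Y) (g : mor Y Z) (y : mor S Y) :
  is_coker f g -> cell_ob R L X -> cell_proj S -> g ∘ y = 0 -> exists x, y = f ∘ x.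
Proof.
move=> fg CX [F [WF _] ES]; case: _ / (esym ES) in y * => gy.
have [|x ex] := pg_exact (PG j) fg (y := y ∘ ep WF) (proj1 F); first by rewrite cmpA gy cmp0m.
have [x' ex'] := cell_extend WF x CX; exists x'; apply: (@ep_epi _ _ WF).
by rewrite ex ex' cmpA.
Qed.

Lemma cell_proj_ob j (X : PP j) : cell_proj X -> cell_ob R L X.
Proof.
move=> PX; have [Z PZ Z0] := cell_proj_zero j; apply/cell_obP.
exists Z, X, 0, (idm X); split=> //; split; first by rewrite cmpm0.
move=> E h _; exists h; split; first by rewrite cmpm1.
by move=> h' <-; rewrite cmpm1.
Qed.

(** The quotient is presented by the generators of [B], with the relations of [B] and the lifted
    images of the generators of [A]. *)
Lemma cell_coker j (A B Z : PP j) (f : mor A B) (g : mor B Z) :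
  is_coker f g -> cell_ob R L A -> cell_ob R L B -> cell_ob R L Z.
Proof.
move=> fg /cell_obP[X1 [X0 [dA [a [_ PX0 /coker_epi aE]]]]] /[dup] CB.
move=> /cell_obP[Y1 [Y0 [d [b [PY1 PY0 db]]]]]; apply/cell_obP.
have [x ex] := cell_lift (f ∘ a) db (cell_proj_ob PY0) PX0.
have [S PS [i1 [i2 [p1 [p2 [pi1 pi2 p1i2 p2i1 sE]]]]]] := cell_proj_sum PX0 PY1.
exists S, Y0, (x ∘ p1 + d ∘ p2), (g ∘ b); split=> //; split.
  rewrite cmpDr !cmpA -[g ∘ b ∘ x]cmpA -ex -[g ∘ b ∘ d]cmpA db.1 cmpm0 cmp0m addr0.
  by rewrite cmpA fg.1 !cmp0m.
move=> E h hS.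
have hx : h ∘ x = 0.
  have <- : h ∘ (x ∘ p1 + d ∘ p2) ∘ i1 = h ∘ x; last by rewrite hS cmp0m.
  by rewrite -cmpA cmpDl -!cmpA pi1 p2i1 cmpm1 !cmpm0 addr0.
have hd : h ∘ d = 0.
  have <- : h ∘ (x ∘ p1 + d ∘ p2) ∘ i2 = h ∘ d; last by rewrite hS cmp0m.
  by rewrite -cmpA cmpDl -!cmpA pi2 p1i2 cmpm1 !cmpm0 add0r.
have [u [eu _]] := db.2 _ _ hd.
have [|v [ev _]] := fg.2 _ u.
  by apply: aE; rewrite -cmpA ex cmpA eu hx cmp0m.
exists v; split; first by rewrite cmpA ev eu.
move=> w ew; apply: (coker_epi fg); apply: (coker_epi db).
by rewrite ev eu -ew cmpA.
Qed.

Lemma cell_is_subrep : is_subrep (M := PP) (fun j => @cell_ob _ _ fin i R L j).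
Proof.
split=> [j l N X|j A B f].
  move=> /cell_obP[X1 [X0 [d [c [PX1 PX0 dc]]]]]; apply/cell_obP.
  exists (N • X1), (N • X0), (fmap (ract PP N) d), (fmap (ract PP N) c).
  by split; [exact: cell_proj_ract | exact: cell_proj_ract | exact: ract_preserves_cokers dc].
have [Z [g fg]] := pg_cok (PG j) (f : @mor k (PP j) (sval A) (sval B)).
exists (exist _ Z (cell_coker fg (svalP A) (svalP B))), g.
exact: fullsub_coker.
Qed.

Variable HS : is_subrep (M := PP) (fun j => @cell_ob _ _ fin i R L j).
Let CR := subrep HS.

Definition cell_projC j (Y : CR j) : Prop := cell_proj (sval Y).

(** The ambient cokernel already lies in C_R, so uniqueness identifies it with the one taken
    there. *)
Lemma cell_coker_val j (X Y Z : CR j) (f : mor X Y) (g : mor Y Z) : is_coker f g ->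
  @is_coker k (PP j) (sval X) (sval Y) (sval Z) f g.
Proof.
move=> fg; have [Z' [g' fg']] := pg_cok (PG j) (f : @mor k (PP j) (sval X) (sval Y)).
have CZ' := cell_coker fg' (svalP X) (svalP Y).
have fgS : @is_coker k (CR j) X Y (exist _ Z' CZ') f g' by exact: fullsub_coker.
have [u [v [ug vg _ uv]]] := coker_unique fgS fg.
exact: (@is_coker_iso k (PP j) (sval X) (sval Y) Z' (sval Z) f g' g u v fg' ug vg uv).
Qed.

Lemma cell_projgen j : projgen (@cell_projC j).
Proof.
split.
- split.
  + have [Z PZ Z0] := cell_proj_zero j.
    by exists (exist _ Z (cell_proj_ob PZ)).
  + move=> X Y PX PY; have [S PS bi] := cell_proj_sum PX PY.
    by exists (exist _ S (cell_proj_ob PS)).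
  (* Every element of the cell is a retract of a power of [H], so [H L] is a generator. *)
  + have [|||H TH Hgen] := @finitary_gen _ _ (fin_hom fin i j) (@cell_cover j) (@R j).
    * exact: cell_cover_zero.
    * exact: cell_cover_sum.
    * move=> A RA; split; first exact: cell_cover_cell.
      exact/I_indec/right_cell_indec.
    have PH : cell_proj (H • L) by exists H.
    pose GH : CR j := exist _ (H • L) (cell_proj_ob PH).
    exists GH => // X [F [_ tF] EX].
    have tX : thru (eq (H • L)) (idm (sval X)).
      rewrite EX; apply: thru_trans tF => _ [A RA ->].
      have := thru_fmap (F := evaluation (M := PP) j L) (Q' := eq (H • L)) _ (Hgen A RA).
      by rewrite fmap1; apply=> B <-.
    apply: (thru_sub (Q := fun A : CR j => H • L = sval A)).
      move=> A EA; have EA' : sval GH = sval A by [].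
      by apply: eq_sig_hprop EA' => *; exact: Prop_irrelevance.
    apply: fullsub_thru tX => A <-; exact: (svalP GH).
  + move=> X Y [F [WF _] EX].
    have [n nP] := cv_fin (pg_cover (PG j)) (sval Y) (proj1 F); exists n.
    case: X EX => X hX /= EX; case: _ / (esym EX) in hX *.
    (* Precomposition with the epimorphism [ep WF] embeds the morphisms out of [F L] into those out
       of [F P_1]. *)
    apply: (dimle_inj (f := fun x : @mor k (PP j) (F • L) (sval Y) => x ∘ ep WF)) nP.
      exact: cmp_linl.
    by move=> x y /(@ep_epi _ _ WF).
- exact: rcok.
- move=> X; have /cell_obP[X1 [X0 [d [c [PX1 PX0 dc]]]]] := svalP X.
  exists (exist _ X1 (cell_proj_ob PX1)), (exist _ X0 (cell_proj_ob PX0)), d, c.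
  by split=> //; exact: fullsub_coker.
- move=> X Y Z f g /cell_coker_val fg S z PS.
  exact: (cell_lift z fg (svalP Y) PS).
- move=> X Y Z f g /cell_coker_val fg S y PS.
  exact: (cell_exact fg (svalP X) PS).
Qed.

Let WG : W G := RW right_cell_top.

(** * Comparison of the top of [G L] in C_R with [L] *)

Section Top.
Hypothesis CGL : cell_ob R L (G • L).
Let GL : CR i := exist _ (G • L) CGL.
Variable pi : mor (G • L) L.
Hypothesis pi_e : pi ∘ ep WG = e.
Variables (V LG : CR i) (w : mor V GL) (c : mor GL LG).
Hypothesis w_c : is_coker w c.
Let w_cP : @is_coker k (PP i) (sval V) (sval GL) (sval LG) w c := cell_coker_val w_c.
Hypothesis c_pi : forall (Y : PP i) (x : mor Y (G • L)), cell_proj Y ->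
  (@cmp k (PP i) _ _ _ c x = 0 <-> pi ∘ x = 0).

(** [pi] kills [w]: this is tested on a projective cover of [V], where [c_pi] applies. *)
Lemma cell_top_factor : exists cb : @mor k (PP i) (sval LG) L, @cmp k (PP i) _ _ _ cb c = pi.
Proof.
have [|cb [ecb _]] := w_cP.2 _ pi; last by exists cb.
have /cell_obP[X1 [X0 [d [a [_ PX0 /coker_epi aE]]]]] := svalP V.
apply: aE; rewrite cmp0m -cmpA; apply/c_pi => //.
by rewrite cmpA w_cP.1 cmp0m.
Qed.

Section Comparison.
Variable cb : @mor k (PP i) (sval LG) L.
Hypothesis cb_c : @cmp k (PP i) _ _ _ cb c = pi.

Lemma cell_top_inj (Y : PP i) (x : @mor k (PP i) Y (sval LG)) :
  cell_proj Y -> cb ∘ x = 0 -> x = 0.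
Proof.
move=> PY; have [x' ->] := cell_lift x w_cP CGL PY.
by rewrite cmpA cb_c => /c_pi; apply.
Qed.

(** On [F P_1], [y] lifts along the surjection [e], which equals [cb ∘ c ∘ ep WG]; [eps_full]
    returns the lift to [F L]. *)
Lemma cell_top_surj (Y : PP i) (y : @mor k (PP i) Y L) :
  cell_proj Y -> exists x, y = cb ∘ x.
Proof.
move=> [F [WF _] EY]; case: _ / (esym EY) in y *.
have eS := simple_surj (PG i) L_simple e0.
have [z ez] := eS _ (y ∘ ep WF) (proj1 F).
have [g eg] := eps_full fiC kap_mono kap_q r_p WF (ep WG ∘ z).
exists (@cmp k (PP i) _ _ _ c (ract2 PP g L)); apply: (@ep_epi _ _ WF).
by rewrite ez -pi_e -cb_c -!cmpA eg.
Qed.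

(** Morphisms from [Y] to [F Z] correspond to morphisms from F* [Y] to [Z], and F* preserves
    [cell_proj]. As [cb] is bijective on such points, so is its image under [F]. *)
Lemma cell_top_iso j (F : hcat C i j) : cell_cover F ->
  exists s : mor (F • L) (F • sval LG),
    s ∘ fmap (ract PP F) cb = idm _ /\ fmap (ract PP F) cb ∘ s = idm _.
Proof.
move=> TF; have PF : cell_proj (F • L) by exists F.
pose FL : CR j := exist _ (F • L) (cell_proj_ob PF).
have [Fs [_ [eta [eps' [etaP epsP LT RT]]]]] := ract_star PP fiC F.
have tr (Y : PP j) (Z : PP i) (y : mor Y (F • Z)) :
    fmap (ract PP F) (eps' Z ∘ fmap (ract PP Fs) y) ∘ eta Y = y.
  by rewrite fmapM -cmpA -etaP cmpA RT cmp1m.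
apply: (@pts_iso k (CR j) _ (cell_projgen j) (ract CR F LG) FL).
  move=> Y x PY Fx; rewrite -[x](tr (sval Y) (sval LG)).
  rewrite [eps' _ ∘ _](_ : _ = 0); first by rewrite fmap0 cmp0m.
  apply: cell_top_inj; first exact: cell_proj_ract.
  rewrite cmpA epsP -cmpA -fmapM.
  by rewrite [X in fmap _ X](_ : _ = 0) ?fmap0 ?cmpm0.
move=> Y y PY.
have [x ex] := cell_top_surj (eps' L ∘ fmap (ract PP Fs) y) (cell_proj_ract Fs PY).
exists (@cmp k (PP j) _ _ _ (fmap (ract PP F) x) (eta (sval Y))).
by rewrite -[LHS](tr (sval Y) L) ex fmapM [RHS]cmpA.
Qed.

Lemma cell_top_generates : generates fin CR LG.
Proof.
apply: (@generates_of_pres _ _ _ _ _ _ (@cell_cover)).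
  move=> j A.
  have /cell_obP[X1 [X0 [d [rho [[F1 T1 E1] [H0 T0 E0] drho]]]]] := svalP A.
  case: _ / (esym E1) in d drho *; case: _ / (esym E0) in d rho drho *.
  have [s [scb cbs]] := cell_top_iso T0.
  pose th : @mor k (PP j) (H0 • sval LG) (sval A) := rho ∘ fmap (ract PP H0) cb.
  have [al eal] := cell_cover_full d T1.
  (* The 2-morphisms into [H0] that vanish in [A]; a cover [be] of them is the arrow whose cokernel
     functor gives [A]. *)
  have sN : subfunctor (fun F (x : mor F H0) => th ∘ ract2 PP x (sval LG) = 0).
    split=> [F|F F' x u ex]; last by rewrite ract2_cmp cmpA ex cmp0m.
    split; first by rewrite [X in th ∘ X](fmap0 (evaluation (M := PP) j (sval LG))) cmpm0.
    move=> a x y ex ey; rewrite [X in th ∘ X](fmap_lin (evaluation (M := PP) j (sval LG))).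
    by rewrite cmpDr cmpZr [X in a *: X]ex [X in _ + X]ey scaler0 addr0.
  have [H1 [be [_ be0 beP]]] := fincover_cover (finitary_fincover (fin_hom fin i j)) sN.
  (* The relation [d] of the presentation is the value of [al], which vanishes in [A] and so factors
     through [be]. *)
  have [al' eal'] : exists al', al = be ∘ al'.
    apply: beP => //; rewrite -cmpA -ntrP cmpA.
    by rewrite [X in X ∘ _](_ : _ = 0) ?cmp0m // -drho.1 eal.
  have thC : is_coker (ract2 PP be (sval LG)) th.
    split=> // E h hbe.
    have hd : h ∘ s ∘ d = 0.
      have [s1 [scb1 cbs1]] := cell_top_iso T1.
      rewrite eal -[ract2 PP al L]cmpm1 -cbs1 !cmpA.
      rewrite -[h ∘ s ∘ _ ∘ _]cmpA ntrP cmpA -[h ∘ s ∘ _]cmpA scb cmpm1.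
      by rewrite eal' ract2_cmp cmpA hbe !cmp0m.
    have [u [eu _]] := drho.2 _ _ hd; exists u; split.
      by rewrite cmpA eu -cmpA scb cmpm1.
    move=> v ev; apply: (coker_epi drho); rewrite eu.
    by rewrite -ev -!cmpA cbs cmpm1.
  exists (Arrow be), th; split=> //; split; last by move=> F x /beP; apply.
  exact: (@fullsub_coker _ (PP j) _ (ract CR H1 LG) (ract CR H0 LG) A).
move=> j A F b th TF Tb [thC _] f.
have [s [scb cbs]] := cell_top_iso TF; have [t [tcb cbt]] := cell_top_iso Tb.
have PF : cell_proj (F • L) by exists F.
(* Transported by [s] to [F L], [f] lifts along [th]. Followed by the invertible action on [cb], the
   lift is the value of a 2-morphism [g] at [L]. *)
have [y ey] := cell_lift (@cmp k (PP j) _ _ _ f s) (cell_coker_val thC)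
  (svalP (ract CR (atgt b) LG)) PF.
have [g eg] := cell_cover_full (fmap (ract PP (atgt b)) cb ∘ y) TF.
have e1 : fmap (ract PP (atgt b)) cb ∘ (y ∘ fmap (ract PP F) cb) =
    fmap (ract PP (atgt b)) cb ∘ ract2 PP g (sval LG) by rewrite cmpA eg ntrP.
have e2 : y ∘ fmap (ract PP F) cb = ract2 PP g (sval LG).
  by rewrite -[LHS]cmp1m -[RHS]cmp1m -tcb -!cmpA e1.
have e3 : @cmp k (PP j) _ _ _ th (ract2 PP g (sval LG)) = f.
  by rewrite -e2 cmpA -ey -cmpA scb cmpm1.
by exists g; exact: esym e3.
Qed.

End Comparison.

Lemma cell_quotient_generates : generates fin CR LG.
Proof. by have [cb ecb] := cell_top_factor; exact: cell_top_generates ecb. Qed.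

End Top.

Let GL0 : ~ is_zero (G • L) := Rnz right_cell_top.

Lemma cell_top_cover : cell_cover G.
Proof. exact/cell_cover_cell/right_cell_top. Qed.

(** [LG] is built as [G L] modulo a cover of the morphisms killed by [pi]; its comparison with [L]
    follows by exactness. *)
Lemma cell_cyclic : cyclic fin CR.
Proof.
have [pi pi0 pi_e] := top_map fiC kap_mono kap_q r_p L_simple G_indec e0 WG GL0.
have PGL : cell_proj (G • L) by exists G => //; exact: cell_top_cover.
have CGL := cell_proj_ob PGL; pose GL : CR i := exist _ (G • L) CGL.
have sN : subfunctor (fun (Y : CR i) (x : mor Y GL) => @cmp k (PP i) _ _ _ pi x = 0).
  split=> [Y|Y Y' x u ex]; last by rewrite [LHS]cmpA ex cmp0m.
  split; first exact: cmpm0.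
  by move=> a x y ex ey; rewrite cmpDr cmpZr ex ey scaler0 addr0.
have [V [w [PV w0 wP]]] := fincover_cover (pg_cover (cell_projgen i)) sN.
have [LG [c wc]] := pg_cok (cell_projgen i) w.
exists i, LG; apply: (cell_quotient_generates pi_e wc) => Y x PY.
pose Y' : CR i := exist _ Y (cell_proj_ob PY).
split=> [cx|pix].
  have [y ->] := pg_exact (cell_projgen i) wc (Q := Y') (y := x) PY cx.
  by rewrite cmpA w0 cmp0m.
have [y ey] := wP Y' x PY pix.
by rewrite ey [LHS]cmpA (wc.1 : @cmp k (PP i) _ _ _ c w = 0) cmp0m.
Qed.

(* A point of the radical of G L with nonzero image in L would be split epi, and a
   point of G L vanishing in L but not in the top LG would be surjective onto LG. *)
Lemma cell_simple_top_generates (CGL : cell_ob R L (G • L)) (LG : CR i) :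
  is_simple_top (exist _ (G • L) CGL : CR i) LG -> generates fin CR LG.
Proof.
have [pi pi0 pi_e] := top_map fiC kap_mono kap_q r_p L_simple G_indec e0 WG GL0.
have PGL : cell_proj (G • L) by exists G => //; exact: cell_top_cover.
set GL : CR i := exist _ _ _ => -[LGs [V [w [c [_ wc]]]]].
have PGi := cell_projgen i.
have split_pt (Y : CR i) (x : mor Y GL) : cell_projC Y ->
    @cmp k (PP i) _ _ _ pi x <> 0 -> exists s, x ∘ s = idm GL.
  case: Y x => Y CY x [F [WF _] /= EY]; case: _ / (esym EY) in CY x *.
  exact: (top_split r_p L_simple G_indec e0 pi_e WF).
have piw : @cmp k (PP i) _ _ _ pi w = 0.
  have [X1 [X0 [d [a [_ PX0 /cell_coker_val/coker_epi aE]]]]] := pg_pres PGi V.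
  apply: aE; apply: contrapT; rewrite cmp0m -cmpA => /(split_pt _ (w ∘ a) PX0)[s ws].
  apply: LGs.1; apply: (coker_epi wc).
  by rewrite cmp1m cmp0m -[c]cmpm1 -ws !cmpA wc.1 !cmp0m.
have c_pi (Y : CR i) (x : mor Y GL) : cell_projC Y -> c ∘ x = 0 ->
    @cmp k (PP i) _ _ _ pi x = 0.
  by move=> PY /(pg_exact PGi wc PY)[v ->]; rewrite [LHS]cmpA piw cmp0m.
apply: (cell_quotient_generates pi_e wc) => Y x PY.
pose Y' : CR i := exist _ Y (cell_proj_ob PY); split; first exact: (c_pi Y' x PY).
move=> pix; apply: contrapT => cx.
have [s cs] := simple_surj PGi LGs (f := (c : mor GL LG) ∘ (x : mor Y' GL)) cx c PGL.
(* [idm GL - x ∘ s] dies under [c], hence under [pi]; since [pi] kills [x], it would be zero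
   itself. *)
apply: pi0; have := c_pi GL (idm GL - (x : mor Y' GL) ∘ s) PGL.
rewrite cmpBr cmpm1 cmpA -cs subrr => /(_ erefl).
by rewrite [LHS]cmpBr cmpm1 cmpA pix cmp0m subr0.
Qed.
End CellCategory.
(** The epimorphism from P_F to [L], preceded by the cover of P_F by [F P_1]. *)
Lemma unit_point (k : closedFieldType) (C : cat2 k) (fin : finitary C) (i : C)
    (F : hcat C i i) (L : principal fin i i) :
  is_simple_of F L -> exists e : mor (ract (principal fin i) F (proj_ob fin (id1 i))) L, e <> 0.
Proof.
move=> [[L0 _] [e eE]]; exists (e ∘ unit_cover (proj_ob fin F)) => e0; apply: L0.
apply: eE; apply: (coker_epi (unit_cover_pres (proj_ob fin F)).1).
by rewrite cmp1m e0 !cmp0m.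
Qed.

(** Inside C_R the object L_{G_R} is the simple top [LG] of [G L] computed there, whereas [L] is its
    counterpart in P_i. *)
Theorem proposition40 (k : closedFieldType) (C : cat2 k) (HC : fiat C) :
  let fin := fiat_finitary HC in
  (forall i : C,
     cyclic fin (principal fin i) /\
     generates fin (principal fin i) (proj_ob fin (id1 i)))
  /\
  (forall I : (forall i j : C, hcat C i j -> Prop), complete_indec I ->
   forall (i : C) (R : forall j : C, hcat C i j -> Prop), right_cell I R ->
   forall (K : principal fin i i) (kap : mor K (proj_ob fin (id1 i)))
     (G : hcat C i i) (L : principal fin i i),
     cell_submodule I R kap G L ->
   exists HR : is_subrep (M := principal fin i) (cell_ob R L),
     let CR := subrep HR in
     cyclic fin CR /\
     forall (hGL : cell_ob R L (ract (principal fin i) G L)) (LG : CR i),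
       is_simple_top (exist _ (ract (principal fin i) G L) hGL : CR i) LG ->
       generates fin CR LG).
Proof.
move=> fin; have fiC := fiat_involution HC; split.
  by move=> i; split; [exists i, (proj_ob fin (id1 i)) |]; exact: principal_generated.
move=> I HI i R HR K kap G L [kap_mono Rquot IG simpleL [L_simple [U [r [p [_ r_p]]]]] Rnz].
have [Q [q kap_q]] := pg_cok (principal_projgen fin i i) kap.
have [e e0] := unit_point simpleL.
have RW j (F : hcat C i j) : R j F -> kills_quot (fin := fin) Q F.
  (* [F] kills the simple subquotients of [Q] and is right exact, hence kills [Q]. *)
  move=> RF; apply: (simple_subquotients_zero (principal_projgen fin i i)).
    exact: (ract_preserves_cokers (M := principal fin i) fiC F).
  by move=> S SQ; exact: Rquot kap_q _ SQ _ _ RF.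
have HS := cell_is_subrep fiC HI HR kap_mono kap_q r_p L_simple IG e0 RW Rnz.
exists HS; split.
  exact: (cell_cyclic fiC HI HR kap_mono kap_q r_p L_simple IG e0 RW Rnz).
move=> hGL LG.
exact: (cell_simple_top_generates fiC HI HR kap_mono kap_q r_p L_simple IG e0 RW Rnz).
Qed.
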